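(* Assume the setting and Assumption (A1) of the context, and Assumption (G') of the context. Then with probability tending to one the GMM estimator $\widehat\theta$ is well-defined and $\sqrt{\underline C}(\widehat\theta-\theta_0)\to\mathcal N(0,V_0)$ in distribution as $\underline C\to\infty$, where $V_0=(J'\Xi J)^{-1}J'\Xi H\Xi J(J'\Xi J)^{-1}$ and $H=\sum_{i=1}^k\lambda_iE[(\sum_{\ell=1}^{N_{\mathbf 1}}m(Y_{\ell,\mathbf 1},\theta_0))(\sum_{\ell=1}^{N_{\mathbf 2_i}}m(Y_{\ell,\mathbf 2_i},\theta_0))']$.
   Context: Fix $k,l,L,p\ge1$, $\mathcal Y\subset\mathbb R^l$. Cells $\mathbf j\in(\mathbb N^* )^k$, componentwise order $\le$, $\mathbf 1=(1,\dots,1)$, $\mathbf 2_i$ = $k$-tuple with $1$ in position $i$ and $2$ elsewhere. Data array $(N_{\mathbf j},(Y_{\ell,\mathbf j})_{\ell\ge1})_{\mathbf j\ge\mathbf 1}$, $N_{\mathbf j}\in\mathbb N$, $Y_{\ell,\mathbf j}\in\mathcal Y$. $\underline C=\min_iC_i$, $\Pi_C=\prod_iC_i$. Assumption (A1): (i) separate exchangeability: for any permutations $\pi_1,\dots,\pi_k$ of $\mathbb N^*$ the array has the same joint law as the array with cell $\mathbf j$ replaced by cell $(\pi_1(j_1),\dots,\pi_k(j_k))$; (ii) for any $\mathbf c\ge\mathbf 1$, the cells $\mathbf 1\le\mathbf j\le\mathbf c$ are jointly independent of the cells $\mathbf j'\ge\mathbf c+\mathbf 1$; (iii) $E(N_{\mathbf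 1})>0$; (iv) cells $\mathbf 1\le\mathbf j\le\mathbf C$ observed, asymptotics $\underline C\to\infty$ with $\underline C/C_i\to\lambda_i\ge0$. $m:\mathcal Y\times\Theta\to\mathbb R^L$; the GMM estimator $\widehat\theta$ minimizes $\widehat g(\theta)'\widehat\Xi\widehat g(\theta)$ over $\Theta$, $\widehat g(\theta)=\frac1{\Pi_C}\sum_{\mathbf 1\le\mathbf j\le\mathbf C}\sum_{\ell=1}^{N_{\mathbf j}}m(Y_{\ell,\mathbf j},\theta)$. Class terminology: pointwise measurable = countable subclass whose pointwise limits give all elements; envelope = measurable $F\ge\sup|f|$; for $\beta\in\mathbb R$, $\|f\|_{\infty,\beta}=\sup_{y\in\mathcal Y}|f(y)(1+|y|^2)^{\beta/2}|$; covering number $N(\varepsilon,\mathcal F,\|\cdot\|_{\infty,\beta})$. Condition (A3'): some $\beta\in\mathbb R$ and envelope $F$ with $\|F\|_{\infty,\beta}<\infty$, $E[(\sum_{\ell=1}^{N_{\mathbf 1}}(1+|Y_{\ell,\mathbf 1}|^2)^{-\beta/2})^2]<\infty$, $\int_0^\infty\sqrt{\log N(\varepsilon\|F\|_{\infty,\beta},\mathcal F,\|\cdot\|_{\infty,\beta})}d\varepsilon<\infty$. Assumption (G'): (1) $\theta_0\in\mathrm{int}\,\Theta$, $\Theta\subset\mathbb R^p$ compact; (2) $E[\sum_{\ell\le N_{\mathbf 1}}m(Y_{\ell,\mathbf 1},\theta)]=0$ iff $\theta=\theta_0$; (3) for all $\theta\in\Theta$, $\lim_{\theta'\to\theta}E|\sum_{\ell\le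 N_{\mathbf 1}}(m(Y_{\ell,\mathbf 1},\theta')-m(Y_{\ell,\mathbf 1},\theta))|^2=0$; (4) $\theta\mapsto E[\sum_{\ell\le N_{\mathbf 1}}m(Y_{\ell,\mathbf 1},\theta)]$ is differentiable at $\theta_0$ with Jacobian $J$ of rank $p$; (5) $\widehat\Xi$ random symmetric, $\widehat\Xi\to\Xi$ in probability with $\Xi$ positive definite; (6) for each $s=1,\dots,L$ the class $\{y\mapsto m_s(y,\theta):\theta\in\Theta\}$ is pointwise measurable and satisfies (A3'). *)

(* Defs.v *)
From HB Require Import structures.
From mathcomp Require Import all_boot all_order all_algebra.
From mathcomp Require Import all_classical all_reals all_analysis.
Set Implicit Arguments. Unset Strict Implicit. Unset Printing Implicit Defensive.
Import Order.TTheory GRing.Theory Num.Theory.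
Import numFieldNormedType.Exports.
Local Open Scope classical_set_scope.
Local Open Scope ring_scope.

Section GMMDefs.
Context {R : realType}.

(* Cells (N^* )^k are encoded 0-based: the cell j = (j_1,...,j_k) with j_i >= 1
   is represented by (fun i => j_i - 1).  Likewise the index ell >= 1 of
   Y_{ell,j} is encoded as ell - 1. *)
Definition cell (k : nat) := 'I_k -> nat.

Definition cell1 (k : nat) : cell k := fun _ => 0%N.
#[global] Arguments cell1 : clear implicits.
Definition cell2 (k : nat) (i : 'I_k) : cell k :=
  fun i' => if i' == i then 0%N else 1%N.

Definition sqnorm (l : nat) (y : 'rV[R]_l) : R := \sum_(s < l) (y ord0 s) ^+ 2.

Definition borel_rV (l : nat) (A : set 'rV[R]_l) : Prop :=
  <<s [set O : set 'rV[R]_l | open O] >> A.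
Definition borel_fun_on (l : nat) (Ycal : set 'rV[R]_l) (f : 'rV[R]_l -> R) :=
  forall B : set R, measurable B ->
    exists A, borel_rV A /\ Ycal `&` f @^-1` B = Ycal `&` A.

(* coordinates of a cell: N_j (None) or the s-th component of Y_{ell,j} *)
Definition coord (l : nat) := option (nat * 'I_l)%type.

Definition arr_val {T : Type} (k l : nat) (N : cell k -> T -> nat)
  (Y : cell k -> nat -> T -> 'rV[R]_l) (j : cell k) (o : coord l) (w : T) : R :=
  match o with
  | None => (N j w)%:R
  | Some (ell, s) => Y j ell w ord0 s
  end.

Definition cyl {T : Type} (k l : nat) (N : cell k -> T -> nat)
  (Y : cell k -> nat -> T -> 'rV[R]_l) (n : nat) (c : 'I_n -> cell k)
  (o : 'I_n -> coord l) (B : 'I_n -> set R) : set T :=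
  \bigcap_(i in [set: 'I_n]) [set w | B i (arr_val N Y (c i) (o i) w)].

(* (A1)(i) separate exchangeability: equality of the joint laws of the array
   and of the array whose cell j is replaced by (pi_1(j_1),...,pi_k(j_k)),
   expressed through all finite-dimensional cylinder events. *)
Definition sep_exchangeable {d} {T : measurableType d} (P : probability T R)
  (k l : nat) (N : cell k -> T -> nat) (Y : cell k -> nat -> T -> 'rV[R]_l) :=
  forall pi : 'I_k -> nat -> nat, (forall i, bijective (pi i)) ->
  forall (n : nat) (c : 'I_n -> cell k) (o : 'I_n -> coord l) (B : 'I_n -> set R),
    (forall i, measurable (B i)) ->
    P (cyl N Y c o B) = P (cyl N Y (fun t i => pi i (c t i)) o B).

Definition block_independent {d} {T : measurableType d} (P : probability T R)
  (k l : nat) (N : cell k -> T -> nat) (Y : cell k -> nat -> T -> 'rV[R]_l) :=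
  forall (cc : cell k)
    (n1 : nat) (c1 : 'I_n1 -> cell k) (o1 : 'I_n1 -> coord l) (B1 : 'I_n1 -> set R)
    (n2 : nat) (c2 : 'I_n2 -> cell k) (o2 : 'I_n2 -> coord l) (B2 : 'I_n2 -> set R),
    (forall t, measurable (B1 t)) -> (forall t, measurable (B2 t)) ->
    (forall t i, (c1 t i <= cc i)%N) -> (forall t i, (cc i < c2 t i)%N) ->
    P (cyl N Y c1 o1 B1 `&` cyl N Y c2 o2 B2)
    = (P (cyl N Y c1 o1 B1) * P (cyl N Y c2 o2 B2))%E.

Definition Cmin (k : nat) (C : cell k) : nat :=
  \big[minn/(\max_(i < k) C i)%N]_(i < k) C i.
Definition PiC (k : nat) (C : cell k) : nat := (\prod_(i < k) C i)%N.

Definition cellsum {T : Type} (k l p L : nat) (N : cell k -> T -> nat)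
  (Y : cell k -> nat -> T -> 'rV[R]_l) (m : 'rV[R]_l -> 'rV[R]_p -> 'rV[R]_L)
  (j : cell k) (th : 'rV[R]_p) (w : T) : 'rV[R]_L :=
  \sum_(ell < N j w) m (Y j ell w) th.

Definition ghat {T : Type} (k l p L : nat) (N : cell k -> T -> nat)
  (Y : cell k -> nat -> T -> 'rV[R]_l) (m : 'rV[R]_l -> 'rV[R]_p -> 'rV[R]_L)
  (C : cell k) (th : 'rV[R]_p) (w : T) : 'rV[R]_L :=
  ((PiC C)%:R)^-1 *:
    \sum_(j : {dffun forall i : 'I_k, 'I_(C i)})
       cellsum N Y m (fun i => nat_of_ord (j i)) th w.

Definition gmm_obj {T : Type} (k l p L : nat) (N : cell k -> T -> nat)
  (Y : cell k -> nat -> T -> 'rV[R]_l) (m : 'rV[R]_l -> 'rV[R]_p -> 'rV[R]_L)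
  (C : cell k) (Xih : 'M[R]_L) (th : 'rV[R]_p) (w : T) : R :=
  (ghat N Y m C th w *m Xih *m (ghat N Y m C th w)^T) ord0 ord0.

Definition is_minimizer (p : nat) (Th : set 'rV[R]_p) (Q : 'rV[R]_p -> R)
  (th : 'rV[R]_p) : Prop :=
  Th th /\ forall th', Th th' -> Q th <= Q th'.

Definition wnorm (l : nat) (Ycal : set 'rV[R]_l) (beta : R) (f : 'rV[R]_l -> R)
  : \bar R :=
  ereal_sup [set (`|f y * (1 + sqnorm y) `^ (beta / 2)|)%:E | y in Ycal].

Definition eps_cover (l : nat) (Ycal : set 'rV[R]_l) (beta : R)
  (FF : set ('rV[R]_l -> R)) (eps : R) (gs : seq ('rV[R]_l -> R)) : Prop :=
  forall f, FF f -> exists i : 'I_(size gs),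
    (wnorm Ycal beta (fun y => (f y - nth (fun=> 0) gs i y)%R) < eps%:E)%E.

(* covering number N(eps, FF, ||.||_{infty,beta}) (+oo if no finite cover) *)
Definition covnum (l : nat) (Ycal : set 'rV[R]_l) (beta : R)
  (FF : set ('rV[R]_l -> R)) (eps : R) : \bar R :=
  ereal_inf [set (n%:R)%:E | n in
    [set n : nat | exists gs, size gs = n /\ eps_cover Ycal beta FF eps gs]].

Definition sqrt_log_e (x : \bar R) : \bar R :=
  if x is r%:E then (Num.sqrt (ln r))%:E else +oo%E.

Definition pointwise_measurable (l : nat) (Ycal : set 'rV[R]_l)
  (FF : set ('rV[R]_l -> R)) : Prop :=
  exists GG : set ('rV[R]_l -> R), GG `<=` FF /\ countable GG /\
    forall f, FF f -> exists g : nat -> 'rV[R]_l -> R,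
      (forall n, GG (g n)) /\ forall y, Ycal y -> g n y @[n --> \oo] --> f y.

Definition cond_A3' {d} {T : measurableType d} (P : probability T R)
  (k l : nat) (N : cell k -> T -> nat) (Y : cell k -> nat -> T -> 'rV[R]_l)
  (Ycal : set 'rV[R]_l) (FF : set ('rV[R]_l -> R)) : Prop :=
  exists (beta : R) (F : 'rV[R]_l -> R),
    borel_fun_on Ycal F /\
    (forall f y, FF f -> Ycal y -> `|f y| <= F y) /\
    (wnorm Ycal beta F < +oo)%E /\
    (\int[P]_w ((\sum_(ell < N (cell1 k) w)
         (1 + sqnorm (Y (cell1 k) ell w)) `^ (- beta / 2)) ^+ 2)%:E < +oo)%E /\
    (\int[lebesgue_measure]_(eps in [set x : R | (0 <= x)%R])
        sqrt_log_e (covnum Ycal beta FF (eps * fine (wnorm Ycal beta F))%R) < +oo)%E.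

Definition Gam {d} {T : measurableType d} (P : probability T R)
  (k l p L : nat) (N : cell k -> T -> nat) (Y : cell k -> nat -> T -> 'rV[R]_l)
  (m : 'rV[R]_l -> 'rV[R]_p -> 'rV[R]_L) (th : 'rV[R]_p) : 'rV[R]_L :=
  \row_(s < L) fine (\int[P]_w (cellsum N Y m (cell1 k) th w ord0 s)%:E).

Definition Hmat {d} {T : measurableType d} (P : probability T R)
  (k l p L : nat) (N : cell k -> T -> nat) (Y : cell k -> nat -> T -> 'rV[R]_l)
  (m : 'rV[R]_l -> 'rV[R]_p -> 'rV[R]_L) (lam : 'I_k -> R) (th0 : 'rV[R]_p)
  : 'M[R]_L :=
  \matrix_(s < L, t < L) \sum_(i < k) lam i *
     fine (\int[P]_w (cellsum N Y m (cell1 k) th0 w ord0 s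
                      * cellsum N Y m (cell2 i) th0 w ord0 t)%:E).

Definition sandwich (L p : nat) (J : 'M[R]_(L, p)) (Xi H : 'M[R]_L) : 'M[R]_p :=
  invmx (J^T *m Xi *m J) *m (J^T *m Xi *m H *m Xi *m J) *m invmx (J^T *m Xi *m J).

(* W ~ N(0, V) on R^p, via its characteristic function
   E exp(i t'W) = exp(-t'Vt/2) *)
Definition is_centered_gaussian {d'} {T' : measurableType d'}
  (P' : probability T' R) (p : nat) (W : T' -> 'rV[R]_p) (V : 'M[R]_p) : Prop :=
  (forall s, measurable_fun setT (fun w => W w ord0 s)) /\
  forall t : 'rV[R]_p,
    (\int[P']_w (cos ((W w *m t^T) ord0 ord0))%:E
      = (expR (- ((t *m V *m t^T) ord0 ord0) / 2))%:E)%E /\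
    (\int[P']_w (sin ((W w *m t^T) ord0 ord0))%:E = 0)%E.

Definition cvg_dist_gaussian {d} {T : measurableType d} (P : probability T R)
  (p : nat) (Z : nat -> T -> 'rV[R]_p) (V : 'M[R]_p) : Prop :=
  forall d' (T' : measurableType d') (P' : probability T' R) (W : T' -> 'rV[R]_p),
    is_centered_gaussian P' W V ->
    forall f : 'rV[R]_p -> R, continuous f -> (exists M, forall x, `|f x| <= M) ->
      ((\int[P]_w (f (Z n w))%:E) @[n --> \oo] --> \int[P']_w (f (W w))%:E)%E.

End GMMDefs.

(* Main.v *)
(** Averages over the grid of cells are handled without a representation theorem
    for exchangeable arrays.  For the central limit theorem, exchangeability
    moves the cells of the i-th Hajek projection to groups of cells that agree in
    the i-th coordinate only and lie in successive diagonal blocks; such groups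
    are independent by the block independence, and a second-moment computation
    with the overlap patterns of two cells shows that the sum over groups has the
    same limit as the grid average.  For the maximal inequality, Hoeffding's
    averaging writes the grid average as a mean of averages over shifted
    diagonals, which are i.i.d.; symmetrization by swapping diagonal cells and
    Rademacher exponential bounds give a finite maximal inequality, and chaining
    along the covers of (A3') gives boundedness and asymptotic equicontinuity of
    the empirical process for the L2 distance, hence, by (G')(3), for the
    Euclidean one.  The same covers show that the cell sums are almost surely
    continuous in the parameter, so that suprema over the parameter space reduce
    to countable ones and minimizers exist almost surely.

    On an event of large probability the minimization is deterministic: the
    positive definite quadratic form forces sqrt(C) |Gamma(thetahat)| to be
    bounded, which gives consistency and the rate, and comparing the objective at
    thetahat and at theta0 + h / sqrt(C), with h the minimizer of the linearized
    objective, identifies sqrt(C) (thetahat - theta0) with h up to o(1).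
    Characteristic functions converge, and Levy's continuity theorem is obtained
    from tightness and a Bernstein-type approximation of continuous functions by
    trigonometric polynomials. *)
Require Import Defs.
From HB Require Import structures.
From mathcomp Require Import all_boot all_order all_algebra.
From mathcomp Require Import all_classical all_reals all_analysis.
From mathcomp Require Import measurable_realfun.
From mathcomp Require Import ring lra zify.
Set Implicit Arguments. Unset Strict Implicit. Unset Printing Implicit Defensive.
Import Order.TTheory GRing.Theory Num.Theory.
Import numFieldNormedType.Exports.
Local Open Scope classical_set_scope.
Local Open Scope ring_scope.

(** * Moments *)

(** Averaging M cells of the same infinite array that share a single coordinate imitates it, with an
    excess variance of order 1/M: this is the reason for a double limit in which M comes last. The
    grid is moved inside the array as well, which leaves the law of its average unchanged, so that
    each of its cells meets each group in at most one coordinate. Two measurability obstacles shape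
    the rest. The moment functions are Borel on [Ycal] only, so the array carries a sigma-algebra
    that sees sets through their trace on arrays with values in [Ycal]. Suprema over the parameter
    space need not be measurable, so maximal inequalities are stated for finite lists of parameters
    with bounds independent of the list, and reach a countable dense set by monotone limits of
    events. Covers in a weighted sup norm give bounds valid for every outcome, so chaining needs no
    random distances. *)

Definition intg {R : realType} {d} {T : measurableType d} (P : probability T R)
  (f : T -> R) := P.-integrable setT (EFin \o f).
Definition Ex {R : realType} {d} {T : measurableType d} (P : probability T R)
  (f : T -> R) : R := \int[P]_w f w.
Definition L2 {R : realType} {d} {T : measurableType d} (P : probability T R)
  (f : T -> R) := measurable_fun setT f /\ intg P (fun w => f w ^+ 2).

Section Expectation.
Context {R : realType} {d} {T : measurableType d} (P : probability T R).
Implicit Types f g : T -> R.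

Lemma intg_meas f : intg P f -> measurable_fun setT f.
Proof. by move=> /measurable_int /measurable_EFinP. Qed.

Lemma intg_le f g : measurable_fun setT f -> intg P g ->
  (forall w, `|f w| <= g w) -> intg P f.
Proof.
move=> mf ig fg; apply: (le_integrable measurableT _ _ ig).
  exact/measurable_EFinP.
move=> x _ /=; rewrite lee_fin; apply: (le_trans (fg x)); exact: ler_norm.
Qed.

Lemma eq_intg f g : f =1 g -> intg P f -> intg P g.
Proof. by move=> /funext ->. Qed.

Lemma eq_L2 f g : f =1 g -> L2 P f -> L2 P g.
Proof. by move=> /funext ->. Qed.

Lemma intg_cst c : intg P (fun=> c).
Proof. by apply: finite_measure_integrable_cst. Qed.

Lemma intg_bnd f M : measurable_fun setT f -> (forall w, `|f w| <= M) -> intg P f.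
Proof. by move=> mf fM; apply: (intg_le mf (intg_cst M)). Qed.

Lemma intgD f g : intg P f -> intg P g -> intg P (fun w => f w + g w).
Proof. by move=> f1 g1; have := integrableD measurableT f1 g1. Qed.

Lemma intgZ c f : intg P f -> intg P (fun w => c * f w).
Proof. by move=> f1; have := integrableZl measurableT c f1. Qed.

Lemma intgN f : intg P f -> intg P (fun w => - f w).
Proof.
move=> f1; rewrite (_ : (fun w => - f w) = (fun w => (-1) * f w)); first exact: intgZ.
by apply/funext => w; rewrite mulN1r.
Qed.

Lemma intgB f g : intg P f -> intg P g -> intg P (fun w => f w - g w).
Proof. by move=> f1 g1; apply: intgD => //; apply: intgN. Qed.

Lemma intg_norm f : intg P f -> intg P (fun w => `|f w|).
Proof. exact: integrable_norm. Qed.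

Lemma intg_sum (I : Type) (s : seq I) (Q : pred I) (h : I -> T -> R) :
  (forall i, Q i -> intg P (h i)) -> intg P (fun w => \sum_(i <- s | Q i) h i w).
Proof.
move=> ih; elim: s => [|i s IH].
  by apply: eq_intg (intg_cst 0) => w; rewrite big_nil.
apply: (@eq_intg (fun w => if Q i then h i w + \sum_(j <- s | Q j) h j w
  else \sum_(j <- s | Q j) h j w)); first by move=> w; rewrite big_cons.
case Qi: (Q i) => //.
by apply: intgD => //; apply: ih.
Qed.

Lemma eq_Ex f g : f =1 g -> Ex P f = Ex P g.
Proof. by move=> fg; apply: eq_Rintegral => w _; rewrite fg. Qed.

Lemma ExD f g : intg P f -> intg P g -> Ex P (fun w => f w + g w) = Ex P f + Ex P g.
Proof. by move=> f1 g1; rewrite /Ex RintegralD. Qed.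

Lemma ExZ c f : intg P f -> Ex P (fun w => c * f w) = c * Ex P f.
Proof. by move=> f1; rewrite /Ex RintegralZl. Qed.

Lemma ExB f g : intg P f -> intg P g -> Ex P (fun w => f w - g w) = Ex P f - Ex P g.
Proof. by move=> f1 g1; rewrite /Ex RintegralB. Qed.

Lemma Ex_cst c : Ex P (fun=> c) = c.
Proof.
have := Rintegral_cst P measurableT c; rewrite -/(Ex P (fun=> c)) => ->.
have -> : fine (P setT) = 1 by rewrite probability_setT.
by rewrite mulr1.
Qed.

Lemma Ex_sum (I : Type) (s : seq I) (Q : pred I) (h : I -> T -> R) :
  (forall i, Q i -> intg P (h i)) ->
  Ex P (fun w => \sum_(i <- s | Q i) h i w) = \sum_(i <- s | Q i) Ex P (h i).
Proof.
move=> ih; elim: s => [|i s IH].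
  by under eq_Ex do rewrite big_nil; rewrite Ex_cst big_nil.
under eq_Ex do rewrite big_cons; rewrite big_cons.
case: ifPn => Qi //; rewrite -IH -ExD//; [exact: ih|exact: intg_sum].
Qed.

Lemma Ex_ge0 f : (forall w, 0 <= f w) -> 0 <= Ex P f.
Proof. by move=> f0; apply: Rintegral_ge0. Qed.

Lemma le_Ex f g : intg P f -> intg P g -> (forall w, f w <= g w) -> Ex P f <= Ex P g.
Proof. by move=> f1 g1 fg; apply: le_Rintegral. Qed.

Lemma Ex_norm f : intg P f -> `|Ex P f| <= Ex P (fun w => `|f w|).
Proof. by move=> f1; apply: le_normr_Rintegral. Qed.

Lemma ExE f : intg P f -> ((Ex P f)%:E = \int[P]_w (f w)%:E)%E.
Proof. by move=> f1; rewrite /Ex /Rintegral fineK//; apply: integrable_fin_num. Qed.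

Lemma L2M f g : L2 P f -> L2 P g -> intg P (fun w => f w * g w).
Proof.
move=> [mf f2] [mg g2]; apply: (intg_le _ (intgD f2 g2)).
  exact: measurable_funM.
by move=> w; rewrite normrM -[f w ^+ 2]real_normK ?num_real// -[g w ^+ 2]real_normK ?num_real//; have := sqr_ge0 (`|f w| - `|g w|); have := sqr_ge0 (`|f w| + `|g w|); nra.
Qed.

Lemma L2_cst c : L2 P (fun=> c).
Proof. by split; [exact: measurable_cst|exact: intg_cst]. Qed.

Lemma L2_intg f : L2 P f -> intg P f.
Proof.
move=> f2; have := L2M f2 (L2_cst 1); congr (intg P _).
by apply/funext => w; rewrite mulr1.
Qed.

Lemma L2_le f g : measurable_fun setT f -> L2 P g ->
  (forall w, `|f w| <= `|g w|) -> L2 P f.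
Proof.
move=> mf [mg g2] fg; split => //; apply: (intg_le _ g2); first exact: measurable_funX.
by move=> w; rewrite normrX -[g w ^+ 2]real_normK ?num_real// lerXn2r// nnegrE.
Qed.

Lemma L2_bnd f M : measurable_fun setT f -> (forall w, `|f w| <= M) -> L2 P f.
Proof.
move=> mf fM; apply: (L2_le mf (L2_cst M)) => w.
by apply: (le_trans (fM w)); exact: ler_norm.
Qed.

Lemma L2D f g : L2 P f -> L2 P g -> L2 P (fun w => f w + g w).
Proof.
move=> [mf f2] [mg g2]; split; first exact: measurable_funD.
apply: (intg_le _ (intgZ 2 (intgD f2 g2))).
  by apply: measurable_funX; exact: measurable_funD.
by move=> w; rewrite ger0_norm ?sqr_ge0//; have := sqr_ge0 (f w - g w); nra.
Qed.

Lemma L2Z c f : L2 P f -> L2 P (fun w => c * f w).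
Proof.
move=> [mf f2]; split; first exact: measurable_funM.
by apply: eq_intg (intgZ (c ^+ 2) f2) => w; rewrite exprMn.
Qed.

Lemma L2N f : L2 P f -> L2 P (fun w => - f w).
Proof. by move=> f2; apply: eq_L2 (L2Z (-1) f2) => w; rewrite mulN1r. Qed.

Lemma L2B f g : L2 P f -> L2 P g -> L2 P (fun w => f w - g w).
Proof. by move=> f1 g1; apply: L2D => //; apply: L2N. Qed.

Lemma L2_norm f : L2 P f -> L2 P (fun w => `|f w|).
Proof.
move=> f2; apply: (L2_le _ f2); first by apply: measurableT_comp => //; exact: f2.1.
by move=> w; rewrite normr_id.
Qed.

Lemma L2_sum (I : Type) (s : seq I) (Q : pred I) (h : I -> T -> R) :
  (forall i, Q i -> L2 P (h i)) -> L2 P (fun w => \sum_(i <- s | Q i) h i w).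
Proof.
move=> ih; elim: s => [|i s IH].
  by apply: eq_L2 (L2_cst 0) => w; rewrite big_nil.
apply: (@eq_L2 (fun w => if Q i then h i w + \sum_(j <- s | Q j) h j w
  else \sum_(j <- s | Q j) h j w)); first by move=> w; rewrite big_cons.
case Qi: (Q i) => //.
by apply: L2D => //; apply: ih.
Qed.

(** The polynomial [Ex (f + t g)^2] is non-negative in [t]; its value at the minimizer [- c / b]
    gives the claim. For [b = 0] it is affine and takes the value -1 unless [c = 0]. *)
Lemma Ex_CS f g : L2 P f -> L2 P g ->
  (Ex P (fun w => f w * g w)) ^+ 2 <= Ex P (fun w => f w ^+ 2) * Ex P (fun w => g w ^+ 2).
Proof.
move=> f2 g2; set a := Ex P (fun w => f w ^+ 2); set b := Ex P (fun w => g w ^+ 2).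
set c := Ex _ _.
have a0 : 0 <= a by apply: Ex_ge0 => w; exact: sqr_ge0.
have b0 : 0 <= b by apply: Ex_ge0 => w; exact: sqr_ge0.
have key t : 0 <= a + 2 * t * c + t ^+ 2 * b.
  have -> : a + 2 * t * c + t ^+ 2 * b = Ex P (fun w => (f w + t * g w) ^+ 2).
    rewrite /a /b /c -!ExZ; [|exact: g2.2|exact: L2M].
    rewrite -!ExD; [|by apply: intgD; [exact: f2.2|apply: intgZ; exact: L2M]
      |apply: intgZ; exact: g2.2|exact: f2.2|apply: intgZ; exact: L2M].
    by apply: eq_Ex => w; ring.
  by apply: Ex_ge0 => w; exact: sqr_ge0.
have [b_eq0|bn0] := eqVneq b 0.
  have : forall t, 0 <= a + 2 * t * c by move=> t; have := key t; rewrite b_eq0 mulr0 addr0.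
  have [->|cn0] := eqVneq c 0; first by rewrite expr0n/= mulr_ge0.
  move=> /(_ (- (a + 1) / (2 * c))).
  rewrite (_ : 2 * (- (a + 1) / (2 * c)) * c = - (a + 1)); last by field.
  by move=> h; exfalso; move: h; rewrite opprD addrA subrr add0r lerNr oppr0 ler10.
have bp : 0 < b by rewrite lt_neqAle eq_sym bn0.
have := key (- c / b).
rewrite (_ : a + 2 * (- c / b) * c + (- c / b) ^+ 2 * b = (a * b - c ^+ 2) / b); last by field.
by rewrite pmulr_lge0 ?invr_gt0// subr_ge0.
Qed.

Lemma Ex_sqr f : L2 P f -> (Ex P f) ^+ 2 <= Ex P (fun w => f w ^+ 2).
Proof.
move=> f2; have := Ex_CS f2 (L2_cst 1).
under [in X in X <= _]eq_Ex do rewrite mulr1.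
by under [X in _ <= _ * X]eq_Ex do rewrite expr1n; rewrite Ex_cst mulr1.
Qed.

Lemma Ex_norm_le f a : 0 <= a -> L2 P f -> Ex P (fun w => f w ^+ 2) <= a ^+ 2 ->
  Ex P (fun w => `|f w|) <= a.
Proof.
move=> a0 f2 fa; rewrite -(@ler_pXn2r _ 2)// ?nnegrE//; last by apply: Ex_ge0.
apply: le_trans (Ex_sqr (L2_norm f2)) _; apply: le_trans fa.
by under eq_Ex do rewrite real_normK ?num_real//.
Qed.

Lemma markovEx f (A : set T) a : 0 < a -> intg P f -> measurable A ->
  (forall w, 0 <= f w) -> (forall w, A w -> a <= f w) ->
  (P A <= (Ex P f / a)%:E)%E.
Proof.
move=> a0 f1 mA f0 fA.
have : a * Ex P (\1_A) <= Ex P f.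
  rewrite -ExZ; last exact: integrable_indic.
  apply: le_Ex => //; first by apply: intgZ; exact: integrable_indic.
  move=> w; rewrite indicE; case: (asboolP (A w)) => Aw.
    by rewrite mem_set// mulr1; exact: fA.
  by rewrite memNset// mulr0.
have -> : P A = (Ex P (\1_A))%:E.
  by rewrite ExE ?integral_indic ?setIT//; exact: integrable_indic.
by rewrite lee_fin ler_pdivlMr// mulrC.
Qed.

End Expectation.

(** * Equality in law and independence of random elements *)

Section Laws.
Context {R : realType} {d} {T : measurableType d} (P : probability T R).
Context {d'} {E : measurableType d'}.

Definition same_law (X X' : T -> E) :=
  forall A, measurable A -> P (X @^-1` A) = P (X' @^-1` A).

Lemma same_law_Ex (X X' : T -> E) (g : E -> R) :
  measurable_fun setT X -> measurable_fun setT X' -> same_law X X' ->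
  measurable_fun setT g -> intg P (g \o X) ->
  intg P (g \o X') /\ Ex P (g \o X') = Ex P (g \o X).
Proof.
move=> mX mX' XX' mg iX.
have eqm (f : E -> \bar R) :
    (\int[pushforward P X]_y f y = \int[pushforward P X']_y f y)%E.
  by apply: eq_measure_integral => A mA _; exact: XX'.
have mgE : measurable_fun setT (EFin \o g) by exact/measurable_EFinP.
have iX' : intg P (g \o X').
  apply/integrableP; split.
    by apply/measurable_EFinP; apply: measurableT_comp.
  have /integrableP[_] := iX; apply: le_lt_trans.
  have := eqm (fun y => `|(EFin \o g) y|)%E.
  rewrite !ge0_integral_pushforward//; try exact: measurableT_comp.
  by move=> <-.
split=> //; rewrite /Ex /Rintegral; congr fine.
have := eqm (EFin \o g).
by rewrite !integral_pushforward// => ->.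
Qed.

End Laws.

Section Independence.
Context {R : realType} {d} {T : measurableType d} (P : probability T R).

Definition indep {d1 d2} {E1 : measurableType d1} {E2 : measurableType d2}
    (X1 : T -> E1) (X2 : T -> E2) :=
  forall A B, measurable A -> measurable B ->
    P (X1 @^-1` A `&` X2 @^-1` B) = (P (X1 @^-1` A) * P (X2 @^-1` B))%E.

Lemma indep_comp {d1 d2 d3 d4} {E1 : measurableType d1} {E2 : measurableType d2}
    {E3 : measurableType d3} {E4 : measurableType d4}
    (X1 : T -> E1) (X2 : T -> E2) (f : E1 -> E3) (g : E2 -> E4) :
  measurable_fun setT f -> measurable_fun setT g -> indep X1 X2 ->
  indep (f \o X1) (g \o X2).
Proof.
move=> mf mg X12 A B mA mB.
have mfA : measurable (f @^-1` A) by rewrite -[X in measurable X]setTI; exact: mf.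
have mgB : measurable (g @^-1` B) by rewrite -[X in measurable X]setTI; exact: mg.
exact: (X12 _ _ mfA mgB).
Qed.

(** Independence makes the law of the pair agree with the product law on rectangles, hence
    everywhere; Fubini then factors the integral. *)
Lemma indep_ExM (U V : T -> R) : L2 P U -> L2 P V -> indep U V ->
  Ex P (fun w => U w * V w) = Ex P U * Ex P V.
Proof.
move=> U2 V2 UV.
have mU := U2.1; have mV := V2.1.
have mp : measurable_fun setT (fun w => (U w, V w)) by exact: measurable_fun_pair.
pose mUf : {mfun T >-> R} := HB.pack U (isMeasurableFun.Build _ _ _ _ _ mU).
pose mVf : {mfun T >-> R} := HB.pack V (isMeasurableFun.Build _ _ _ _ _ mV).
pose p1 := distribution P mUf; pose p2 := distribution P mVf.
pose mpf : {mfun T >-> (R * R)%type} :=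
  HB.pack (fun w => (U w, V w)) (isMeasurableFun.Build _ _ _ _ _ mp).
pose j := distribution P mpf.
have eqm (A : set (R * R)) : measurable A -> (p1 \x p2)%E A = j A.
  apply: product_measure_unique => B C mB mC.
  rewrite /j /= /pushforward /=.
  exact: (UV B C mB mC).
pose h : R * R -> \bar R := fun z => (z.1 * z.2)%:E.
have mh : measurable_fun setT h.
  by apply/measurable_EFinP; apply: measurable_funM.
have ih : P.-integrable setT (h \o (fun w => (U w, V w))) by exact: L2M.
have ihp : (p1 \x p2)%E.-integrable setT h.
  apply/integrableP; split => //.
  rewrite (eq_measure_integral j); last by move=> A mA _; exact: eqm.
  by have /integrableP[] := integrable_pushforward mp mh ih measurableT.
have E1 : (\int[P]_w (U w * V w)%:E = \int[p1 \x p2]_z h z)%E.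
  rewrite (eq_measure_integral j); last by move=> A mA _; exact: eqm.
  by rewrite /j integral_pushforward.
rewrite /Ex /Rintegral E1 -integral12_prod_meas1// /fubini_F /h /=.
have iV := L2_intg V2; have iU := L2_intg U2.
have e2 (x : R) : (\int[p2]_y (x * y)%:E = x%:E * (Ex P V)%:E)%E.
  rewrite -EFinM -(ExZ x iV) ExE; last exact: intgZ.
  rewrite /p2 /distribution; apply: (@integral_pushforward _ _ _ _ _ _ mV P setT
    (fun y => (x * y)%:E)) => //; last exact: (intgZ x iV).
  by apply/measurable_EFinP; apply: measurable_funM.
under eq_integral do rewrite e2.
have e1 : (\int[p1]_x (x%:E * (Ex P V)%:E) = (Ex P V * Ex P U)%:E)%E.
  rewrite -(ExZ (Ex P V) iU) [RHS]ExE; last exact: intgZ.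
  under eq_integral do rewrite -EFinM mulrC.
  rewrite /p1 /distribution; apply: (@integral_pushforward _ _ _ _ _ _ mU P setT
    (fun y => (Ex P V * y)%:E)) => //; last exact: (intgZ (Ex P V) iU).
  by apply/measurable_EFinP; apply: measurable_funM.
by rewrite e1 mulrC.
Qed.

End Independence.

(** * Measurability of random row vectors *)

Section BorelRow.
Context {R : realType} {d} {T : measurableType d} (l : nat).

(** Measurability of a random row is asked coordinatewise. An open set is the union of the countably
    many cubes [bq a], with rational centre and inverse integer radius, that it contains. *)
Lemma open_row_measurable (X : T -> 'rV[R]_l) (O : set 'rV[R]_l) :
  (forall s, measurable_fun setT (fun w => X w ord0 s)) -> open O ->
  measurable (X @^-1` O).
Proof.
move=> mX oO.
pose bq (a : 'rV[rat]_l * nat) : set 'rV[R]_l :=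
  [set y | forall s, `|ratr (a.1 ord0 s) - y ord0 s| < a.2.+1%:R^-1].
have -> : X @^-1` O = \bigcup_(a in [set a | bq a `<=` O]) (X @^-1` bq a).
  apply/seteqP; split => [w /= Ow|w [a /= aO] /aO//].
  have /nbhs_ballP[e /= e0 eO] : nbhs (X w) O by exact: open_nbhs_nbhs.
  have [r re] : exists r : nat, r.+1%:R^-1 < e / 2.
    exists (Num.truncn (e / 2)^-1).
    rewrite -[X in _ < X]invrK ltf_pV2 ?posrE ?invr_gt0 ?divr_gt0//.
    exact: truncnS_gt.
  have q_ s : exists q : rat, `|ratr q - X w ord0 s| < r.+1%:R^-1.
    have [] := @rat_in_itvoo R (X w ord0 s - r.+1%:R^-1) (X w ord0 s + r.+1%:R^-1).
      by rewrite ltrBlDr -addrA ltrDl addr_gt0// invr_gt0.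
    move=> q; rewrite in_itv/= => /andP[q1 q2]; exists q.
    rewrite ltr_norml ltrBlDl q2 andbT; move: q1; rewrite ltrBlDr => q1.
    by rewrite ltrNl opprB ltrBlDl.
  have [q qP] := choice q_.
  exists (\row_s q s, r) => /=; last by move=> s; rewrite mxE.
  move=> y yq; apply: eO; split => // i s; rewrite (ord1 i) /ball/=.
  have := yq s; rewrite /= mxE => ys; have := qP s => qs.
  apply: (le_lt_trans (ler_distD (ratr (q s)) _ _)).
  by rewrite distrC [e](splitr e); apply: ltrD; apply: lt_trans re.
rewrite bigcup_mkcond; apply: countable_bigcupT_measurable; first exact: countableP.
move=> a; case: ifP => // _.
rewrite (_ : _ @^-1` _ = \bigcap_(s in [set: 'I_l])
  (fun w => `|ratr (a.1 ord0 s) - X w ord0 s|) @^-1` `]-oo, a.2.+1%:R^-1[); last first.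
  apply/seteqP; split => w /=; first by move=> h s _; rewrite /= in_itv/=.
  by move=> h s; have := h s I; rewrite /= in_itv.
apply: fin_bigcap_measurable => //= s _.
rewrite -[X in measurable X]setTI.
have : measurable_fun setT (fun w => `|ratr (a.1 ord0 s) - X w ord0 s|).
  by apply: measurableT_comp => //; apply: measurable_funB.
by apply.
Qed.

Lemma borel_row_measurable (X : T -> 'rV[R]_l) (A : set 'rV[R]_l) :
  (forall s, measurable_fun setT (fun w => X w ord0 s)) -> borel_rV A ->
  measurable (X @^-1` A).
Proof.
move=> mX; pose S := [set A | measurable (X @^-1` A)].
suff : <<s [set O : set 'rV[R]_l | open O] >> `<=` S by apply.
apply: smallest_sub; last by move=> O /= oO; exact: open_row_measurable.
split; rewrite /S/=.
- by rewrite preimage_set0.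
- by move=> B mB; rewrite setTD preimage_setC; exact: measurableC.
- by move=> F mF; rewrite preimage_bigcup; exact: bigcupT_measurable.
Qed.

Lemma continuous_row_measurable (X : T -> 'rV[R]_l) (f : 'rV[R]_l -> R) :
  (forall s, measurable_fun setT (fun w => X w ord0 s)) -> continuous f ->
  measurable_fun setT (fun w => f (X w)).
Proof.
move=> mX /continuousP cf; apply: (measurability _ (RGenOpens.measurableE R)).
move=> _ [_ [a [b ->] <-]]; rewrite setTI.
exact: (open_row_measurable mX (cf _ (interval_open _ _))).
Qed.

End BorelRow.

(** * The data array: exchangeability and block independence *)

Section ArrayType.
Context {R : realType} (l : nat).

Definition aval (I : Type) := I -> (nat * (nat -> 'rV[R]_l))%type.

Definition acoord (I : Type) (x : aval I) (i : I) (o : Defs.coord l) : R :=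
  match o with None => ((x i).1)%:R | Some (ell, s) => (x i).2 ell ord0 s end.

Definition acyl (I : Type) n (c : 'I_n -> I) (o : 'I_n -> Defs.coord l)
    (B : 'I_n -> set R) : set (aval I) :=
  [set x | forall t, B t (acoord x (c t) (o t))].

Definition arange (Ycal : set 'rV[R]_l) (I : Type) : set (aval I) :=
  [set x | forall i ell, Ycal ((x i).2 ell)].

(* Only the trace on [arange] matters: this is what makes a function which is
   Borel on Ycal alone a measurable function of the array. *)
Definition agen (Ycal : set 'rV[R]_l) (I : Type) : set (set (aval I)) :=
  [set S | exists n c o B, (forall t : 'I_n, measurable (B t)) /\
    S `&` arange Ycal (I := I) = acyl c o B `&` arange Ycal (I := I)].

Definition arr (Ycal : set 'rV[R]_l) (I : Type) :=
  g_sigma_algebraType (agen Ycal (I := I)).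

HB.instance Definition _ Ycal I := Measurable.on (arr Ycal I).

Definition cfun (u : 'rV[R]_l -> R) (v : nat * (nat -> 'rV[R]_l)) : R :=
  \sum_(e < v.1) u (v.2 e).

Lemma agenT Ycal (I : Type) : agen Ycal (I := I) setT.
Proof.
exists 0%N, (fun i : 'I_0 => False_rect I (notF (ltn_ord i))),
  (fun i : 'I_0 => None), (fun=> setT); split => //.
by congr (_ `&` _); apply/seteqP; split => x //= _ [].
Qed.

Lemma agenI Ycal (I : Type) : setI_closed (agen Ycal (I := I)).
Proof.
move=> S1 S2 [n1 [c1 [q1 [B1 [m1 e1]]]]] [n2 [c2 [q2 [B2 [m2 e2]]]]].
pose j A (f1 : 'I_n1 -> A) (f2 : 'I_n2 -> A) (t : 'I_(n1 + n2)) :=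
  match fintype.split t with inl i => f1 i | inr i => f2 i end.
exists (n1 + n2)%N, (j _ c1 c2), (j _ q1 q2), (j _ B1 B2); split.
  by move=> t; rewrite /j; case: (fintype.split t).
have -> : acyl (j I c1 c2) (j _ q1 q2) (j _ B1 B2) = acyl c1 q1 B1 `&` acyl c2 q2 B2.
  apply/seteqP; split => x /=.
    move=> h; split=> t.
      by have := h (lshift n2 t); rewrite /j (unsplitK (inl t)).
    by have := h (rshift n1 t); rewrite /j (unsplitK (inr t)).
  by move=> [h1 h2] t; rewrite /j; case: (fintype.split t) => i.
by rewrite -[X in _ `&` X]setIid setIACA e1 e2 setIACA setIid.
Qed.

Lemma arr_coord_measurable Ycal (I : Type) (i : I) (o : Defs.coord l) :
  measurable_fun setT (fun x : arr Ycal I => acoord x i o).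
Proof.
move=> _ B mB; rewrite setTI; apply: sub_sigma_algebra.
exists 1%N, (fun=> i), (fun=> o), (fun=> B); split => //.
by congr (_ `&` _); apply/seteqP; split => x /= h; [move=> t; exact: h|exact: (h ord0)].
Qed.

(** Such a set has the same trace as the empty cylinder, so it is itself a generator. The index [i]
    serves to write the empty set as a cylinder with constraint [set0]. *)
Lemma arr_outside_measurable Ycal (I : Type) (i : I) (S : set (arr Ycal I)) :
  S `&` arange Ycal (I := I) = set0 -> measurable S.
Proof.
move=> S0; apply: sub_sigma_algebra.
exists 1%N, (fun=> i), (fun=> None), (fun=> set0); split => //.
rewrite S0; apply/esym/seteqP; split => x //= [h _]; exact: (h ord0).
Qed.

Lemma arange_measurable Ycal (I : Type) :
  measurable (arange Ycal (I := I) : set (arr Ycal I)).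
Proof.
apply: sub_sigma_algebra; have [n [c [q [B [mB e]]]]] := @agenT Ycal I.
by exists n, c, q, B; split => //; rewrite setIid -e setTI.
Qed.

Lemma arr_borel_measurable Ycal (I : Type) (i : I) (ell : nat) u :
  borel_fun_on Ycal u -> measurable_fun setT (fun x : arr Ycal I => u ((x i).2 ell)).
Proof.
move=> bu _ B mB; rewrite setTI; have [A [bA uA]] := bu B mB.
set S := _ @^-1` _.
(* Inside [arange] the preimage is that of a genuine Borel set [A]; the rest lies outside [arange]
   and is measurable for free. *)
have -> : S = ((fun x : arr Ycal I => (x i).2 ell) @^-1` A `&` arange Ycal (I := I))
    `|` (S `\` arange Ycal (I := I)).
  apply/seteqP; split => x.
    move=> Sx; have [xE|xE] := pselect (arange Ycal x); last by right.
    left; split => //=; suff : (Ycal `&` A) ((x i).2 ell) by case.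
    by rewrite -uA; split => //; exact: xE.
  move=> [[/= Ax xE]|[]//].
  have : (Ycal `&` A) ((x i).2 ell) by split => //; exact: xE.
  by rewrite -uA => -[].
apply: measurableU.
  apply: measurableI; last exact: arange_measurable.
  apply: borel_row_measurable => // s.
  exact: (arr_coord_measurable i (Some (ell, s))).
by apply: (arr_outside_measurable i); rewrite setDE -setIA setICl setI0.
Qed.

Lemma arr_cfun_measurable Ycal (I : Type) (i : I) u :
  borel_fun_on Ycal u -> measurable_fun setT (fun x : arr Ycal I => cfun u (x i)).
Proof.
move=> bu _ B mB; rewrite setTI.
(* The number of summands is random: split along its value. *)
rewrite (_ : _ @^-1` _ = \bigcup_n
  ((fun x : arr Ycal I => acoord x i None) @^-1` [set n%:R] `&`
   (fun x : arr Ycal I => \sum_(e < n) u ((x i).2 e)) @^-1` B)); last first.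
  apply/seteqP; split => x /=; first by move=> h; exists (x i).1.
  by move=> [n _ [/= /eqP]]; rewrite eqr_nat => /eqP <-.
apply: bigcupT_measurable => n; apply: measurableI.
  by rewrite -[X in measurable X]setTI; apply: arr_coord_measurable.
rewrite -[X in measurable X]setTI.
have : measurable_fun setT (fun x : arr Ycal I => \sum_(e < n) u ((x i).2 e)).
  by apply: measurable_sum => e; exact: arr_borel_measurable.
exact.
Qed.

End ArrayType.

Section Array.
Context {R : realType} {d} {T : measurableType d} (P : probability T R).
Context {k l : nat} (Ycal : set 'rV[R]_l).
Context (N : cell k -> T -> nat) (Y : cell k -> nat -> T -> 'rV[R]_l).
Hypothesis mN : forall j n, measurable [set w | N j w = n].
Hypothesis mY : forall j ell s, measurable_fun setT (fun w => Y j ell w ord0 s).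
Hypothesis YY : forall j ell w, Ycal (Y j ell w).

(** The family of cells [c] as a single random element. Exchangeability becomes equality in law of
    two pulls and block independence the independence of two pulls, so that measurable functionals
    of many cells inherit both. *)
Definition pull (I : Type) (c : I -> cell k) (w : T) : arr Ycal I :=
  fun i => (N (c i) w, fun ell => Y (c i) ell w).

Lemma pull_arange (I : Type) (c : I -> cell k) w : arange Ycal (pull c w).
Proof. by move=> i ell; exact: YY. Qed.

Lemma pull_agen (I : Type) (c : I -> cell k) S n (c' : 'I_n -> I) o B :
  S `&` arange Ycal (I := I) = acyl c' o B `&` arange Ycal (I := I) ->
  pull c @^-1` S = cyl N Y (fun t => c (c' t)) o B.
Proof.
move=> e.
have -> : pull c @^-1` S = pull c @^-1` (acyl c' o B).
  apply/seteqP; split => w /= h.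
    suff : (acyl c' o B `&` arange Ycal (I := I)) (pull c w) by case.
    by rewrite -e; split => //; exact: pull_arange.
  suff : (S `&` arange Ycal (I := I)) (pull c w) by case.
  by rewrite e; split => //; exact: pull_arange.
rewrite /cyl; apply/seteqP; split => w /= h t.
  by move=> _ /=; have := h t; rewrite /arr_val/acoord; case: (o t) => [[]|].
by have := h t Logic.I; rewrite /= /arr_val/acoord; case: (o t) => [[]|].
Qed.

Lemma arr_val_measurable j o : measurable_fun setT (arr_val N Y j o : T -> R).
Proof.
case: o => [[ell s]|] /=; first exact: mY.
move=> _ B mB; rewrite setTI.
rewrite (_ : _ @^-1` _ = \bigcup_(n in [set n | B n%:R]) [set w | N j w = n]); last first.
  apply/seteqP; split => w /=; first by move=> h; exists (N j w).
  by move=> [n /= Bn ->].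
by apply: bigcup_measurable => n _.
Qed.

Lemma cyl_measurable n (c : 'I_n -> cell k) o B :
  (forall t, measurable (B t)) -> measurable (cyl N Y c o B).
Proof.
move=> mB; apply: fin_bigcap_measurable => // t _.
rewrite -[X in measurable X]setTI.
exact: (arr_val_measurable (c t) (o t) measurableT (mB t)).
Qed.

Lemma pull_measurable (I : Type) (c : I -> cell k) : measurable_fun setT (pull c).
Proof.
apply: (@measurability _ _ T (arr Ycal I) setT (pull c) (agen Ycal (I := I)) erefl).
move=> _ [S [n [c' [q [B [mB e]]]]] <-]; rewrite setTI (pull_agen c e).
exact: cyl_measurable.
Qed.

(** At each step the permutation is followed by the transposition of [pi b] and [tau b], which
    leaves the values already fixed untouched because [tau] is injective. *)
Lemma extend_inj (tau : nat -> nat) (b : nat) : injective tau ->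
  exists pi, bijective pi /\ forall a, (a < b)%N -> pi a = tau a.
Proof.
move=> itau; elim: b => [|b [pi [bpi pitau]]].
  by exists id; split => //; exists id.
pose sw x := if x == pi b then tau b else if x == tau b then pi b else x.
have swK : involutive sw.
  move=> x; rewrite /sw; case: (eqVneq x (pi b)) => [->|xb].
    by rewrite eqxx; case: eqVneq.
  case: (eqVneq x (tau b)) => [->|xt]; first by rewrite eqxx.
  by rewrite (negbTE xb) (negbTE xt).
exists (sw \o pi); split; first by apply: bij_comp => //; exists sw.
move=> a; rewrite ltnS leq_eqVlt => /predU1P[->|ab] /=.
  by rewrite /sw eqxx.
have ipi := bij_inj bpi.
rewrite /sw pitau// -(pitau _ ab) (inj_eq ipi) ltn_eqF// pitau//.
by rewrite (inj_eq itau) ltn_eqF.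
Qed.

Hypothesis exch : sep_exchangeable P N Y.

Lemma law_exch (I : Type) (c : I -> cell k) (tau : 'I_k -> nat -> nat) :
  (forall i, injective (tau i)) ->
  same_law P (pull c) (pull (fun i t => tau t (c i t))).
Proof.
move=> itau A mA.
pose c2 : I -> cell k := fun i t => tau t (c i t).
pose f1 : {mfun T >-> arr Ycal I} :=
  HB.pack (pull c) (isMeasurableFun.Build _ _ _ _ _ (pull_measurable c)).
pose f2 : {mfun T >-> arr Ycal I} :=
  HB.pack (pull c2) (isMeasurableFun.Build _ _ _ _ _ (pull_measurable c2)).
suff : distribution P f1 A = distribution P f2 A by [].
apply: (@measure_unique _ R (arr Ycal I) (agen Ycal (I := I)) (fun=> setT)
  erefl _ _ _ (distribution P f1) (distribution P f2)) => //.
- exact: agenI.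
- by move=> _; exact: agenT.
- by rewrite bigcup_const.
- move=> S [n [c' [q [B [mB e]]]]].
  change (P (pull c @^-1` S) = P (pull c2 @^-1` S)).
  rewrite (pull_agen c e) (pull_agen c2 e).
  (* Strict bound on all coordinates in the cylinder: a permutation agreeing with [tau s] below [b]
     has the same effect on it. *)
  pose b := (\max_(t < n) \max_(s < k) c (c' t) s).+1.
  have /choice[pi piP] : forall s, exists p, bijective p /\
      forall a, (a < b)%N -> p a = tau s a by move=> s; exact: extend_inj.
  rewrite (@exch pi)//; last by move=> s; exact: (piP s).1.
  suff -> : (fun t => c2 (c' t)) = (fun t s => pi s (c (c' t) s)) by [].
  apply/funext => t; apply/funext => s.
  have cb : (c (c' t) s < b)%N.
    rewrite ltnS; apply: leq_trans (leq_bigmax (F := fun t => (\max_(s < k) c (c' t) s)%N) t).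
    exact: (leq_bigmax (F := fun s => c (c' t) s)).
  by have [_ /(_ _ cb)] := piP s.
- by move=> _; apply: (@le_lt_trans _ _ 1%E); [exact: probability_le1|rewrite ltry].
Qed.

Hypothesis bind : block_independent P N Y.

(** Two passes of uniqueness of measures on a pi-system. With the second event a fixed generator,
    [P] restricted to it and [P] scaled by its probability have the same image under [pull c1]; then
    the first event is an arbitrary fixed measurable set and the second one varies. *)
Lemma block_indep (cc : cell k) (I1 I2 : Type) (c1 : I1 -> cell k) (c2 : I2 -> cell k) :
  (forall i s, (c1 i s <= cc s)%N) -> (forall i s, (cc s < c2 i s)%N) ->
  indep P (pull c1) (pull c2).
Proof.
move=> le1 lt2.
pose f1 : {mfun T >-> arr Ycal I1} :=
  HB.pack (pull c1) (isMeasurableFun.Build _ _ _ _ _ (pull_measurable c1)).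
pose f2 : {mfun T >-> arr Ycal I2} :=
  HB.pack (pull c2) (isMeasurableFun.Build _ _ _ _ _ (pull_measurable c2)).
have mf1 A : measurable A -> measurable (pull c1 @^-1` A).
  by move=> mA; rewrite -[X in measurable X]setTI; exact: pull_measurable.
have mf2 A : measurable A -> measurable (pull c2 @^-1` A).
  by move=> mA; rewrite -[X in measurable X]setTI; exact: pull_measurable.
have Pfin B : measurable B -> (P B < +oo)%E.
  by move=> mB; apply: (@le_lt_trans _ _ 1%E); [exact: probability_le1|rewrite ltry].
have PB_ge0 (B : set T) : 0 <= fine (P B) by exact: fine_ge0.
have step1 A2 : agen Ycal A2 -> forall A1, measurable A1 ->
    P (pull c1 @^-1` A1 `&` pull c2 @^-1` A2) =
    (P (pull c1 @^-1` A1) * P (pull c2 @^-1` A2))%E.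
  move=> gA2 A1 mA1.
  have mA2 : measurable (pull c2 @^-1` A2) by apply: mf2; exact: sub_sigma_algebra.
  have pE : P (pull c2 @^-1` A2) = (fine (P (pull c2 @^-1` A2)))%:E.
    by rewrite fineK// ge0_fin_numE// Pfin.
  pose p := NngNum (PB_ge0 (pull c2 @^-1` A2)).
  pose m1 := (pushforward (mrestr P mA2) (pull c1) : {measure set (arr Ycal I1) -> \bar R}).
  have := @measure_unique _ R (arr Ycal I1) (agen Ycal (I := I1)) (fun=> setT)
     erefl _ _ _
     (m1 (pull_measurable c1)) (mscale p (distribution P f1)).
  move=> h; rewrite pE muleC; apply: h => //.
  - exact: agenI.
  - by move=> _; exact: agenT.
  - by rewrite bigcup_const.
  - move=> S [n1 [c1' [q1 [B1 [mB1 e1]]]]]; have [n2 [c2' [q2 [B2 [mB2 e2]]]]] := gA2.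
    change (P (pull c1 @^-1` S `&` pull c2 @^-1` A2) =
      ((fine (P (pull c2 @^-1` A2)))%:E * P (pull c1 @^-1` S))%E).
    rewrite -pE muleC (pull_agen c1 e1) (pull_agen c2 e2).
    exact: (@bind cc n1 (fun t => c1 (c1' t)) q1 B1 n2 (fun t => c2 (c2' t)) q2 B2
      mB1 mB2 (fun t => le1 _) (fun t => lt2 _)).
  - by move=> _; apply: Pfin; rewrite preimage_setT setTI.
move=> S1 S2 mS1 mS2.
have mD : measurable (pull c1 @^-1` S1) by exact: mf1.
have pE : P (pull c1 @^-1` S1) = (fine (P (pull c1 @^-1` S1)))%:E.
  by rewrite fineK// ge0_fin_numE// Pfin.
pose p := NngNum (PB_ge0 (pull c1 @^-1` S1)).
pose m2 := (pushforward (mrestr P mD) (pull c2) : {measure set (arr Ycal I2) -> \bar R}).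
have := @measure_unique _ R (arr Ycal I2) (agen Ycal (I := I2)) (fun=> setT)
     erefl _ _ _
   (m2 (pull_measurable c2)) (mscale p (distribution P f2)).
move=> h; rewrite pE setIC; apply: h => //.
- exact: agenI.
- by move=> _; exact: agenT.
- by rewrite bigcup_const.
- move=> S gS.
  change (P (pull c2 @^-1` S `&` pull c1 @^-1` S1) =
    ((fine (P (pull c1 @^-1` S1)))%:E * P (pull c2 @^-1` S))%E).
  rewrite -pE setIC.
  exact: step1.
- by move=> _; apply: Pfin; rewrite preimage_setT setTI.
Qed.

End Array.

(** * Second moments of cell sums and overlap patterns *)

Section CellFunctionals.
Context {R : realType} {d} {T : measurableType d} (P : probability T R).
Context {k l : nat} (Ycal : set 'rV[R]_l).
Context (N : cell k -> T -> nat) (Y : cell k -> nat -> T -> 'rV[R]_l).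
Hypothesis mN : forall j n, measurable [set w | N j w = n].
Hypothesis mY : forall j ell s, measurable_fun setT (fun w => Y j ell w ord0 s).
Hypothesis YY : forall j ell w, Ycal (Y j ell w).
Hypothesis exch : sep_exchangeable P N Y.
Hypothesis bind : block_independent P N Y.

Definition cellf (u : 'rV[R]_l -> R) (j : cell k) (w : T) : R :=
  \sum_(e < N j w) u (Y j e w).

Local Notation pull := (pull Ycal N Y).

Lemma cellf_measurable u j : borel_fun_on Ycal u -> measurable_fun setT (cellf u j).
Proof.
move=> bu; pose c := fun _ : unit => j.
have -> : cellf u j = (fun x : arr Ycal unit => cfun u (x tt)) \o pull c by [].
apply: measurableT_comp; [exact: arr_cfun_measurable|exact: pull_measurable].
Qed.

(* Injections suffice in place of permutations: a cylinder involves finitely many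
   cells, and on these an injection agrees with a permutation. *)
Lemma exch_Ex (I : Type) (c c' : I -> cell k) (tau : 'I_k -> nat -> nat)
    (g : arr Ycal I -> R) :
  (forall i, injective (tau i)) -> (forall i t, c' i t = tau t (c i t)) ->
  measurable_fun setT g -> intg P (g \o pull c) ->
  intg P (g \o pull c') /\ Ex P (g \o pull c') = Ex P (g \o pull c).
Proof.
move=> itau cc' mg ig.
have -> : c' = (fun i t => tau t (c i t)).
  by apply/funext => i; apply/funext => t; exact: cc'.
apply: same_law_Ex => //; try exact: pull_measurable.
exact: law_exch.
Qed.

Section OneFunctional.
Variable u : 'rV[R]_l -> R.
Hypothesis bu : borel_fun_on Ycal u.
Hypothesis u2 : L2 P (cellf u (cell1 k)).
Let Z := cellf u.

Lemma cellf_law1 j (g : R -> R) : measurable_fun setT g -> intg P (g \o Z (cell1 k)) ->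
  intg P (g \o Z j) /\ Ex P (g \o Z j) = Ex P (g \o Z (cell1 k)).
Proof.
move=> mg ig.
apply: (@exch_Ex unit (fun=> cell1 k) (fun=> j) (fun i a => j i + a)%N
  (fun x => g (cfun u (x tt)))) => //.
- by move=> i; exact: addnI.
- by move=> _ t; rewrite addn0.
- by apply: measurableT_comp => //; exact: arr_cfun_measurable.
Qed.

Lemma cellf_L2 j : L2 P (Z j).
Proof.
split; first exact: cellf_measurable.
by have [] := @cellf_law1 j (fun x => x ^+ 2) (@exprn_measurable R setT 2) u2.2.
Qed.

Lemma cellf_Ex j : Ex P (Z j) = Ex P (Z (cell1 k)).
Proof. by have [] := @cellf_law1 j id (@measurable_id _ _ _) (L2_intg u2). Qed.

Lemma cellf_Ex2 j : Ex P (fun w => Z j w ^+ 2) = Ex P (fun w => Z (cell1 k) w ^+ 2).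
Proof. by have [] := @cellf_law1 j (fun x => x ^+ 2) (@exprn_measurable R setT 2) u2.2. Qed.

(** By exchangeability the mixed moment of two cells depends only on the set of coordinates where
    they agree. The representative pair is the first cell and the cell with 0 on [A] and 1
    elsewhere; singletons give the pairs of [Hmat]. *)
Definition cov_pattern (A : {set 'I_k}) : R :=
  Ex P (fun w => Z (cell1 k) w * Z (fun i => if i \in A then 0 else 1)%N w).

Lemma cov_patternE j j' :
  Ex P (fun w => Z j w * Z j' w) = cov_pattern [set i | j i == j' i]%SET.
Proof.
set A := [set i | _]%SET.
pose c (b : bool) : cell k := if b then cell1 k else (fun i => if i \in A then 0 else 1)%N.
(* [tau i] sends 0 to [j i] and 1 to [j' i]; when these coincide, and for all later arguments, fresh
   values beyond both keep it injective. *)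
pose tau (i : 'I_k) (a : nat) : nat :=
  (if a == 0 then j i else if a == 1 then
   (if j i == j' i then j i + j' i + 1 else j' i) else j i + j' i + a)%N.
have itau i : injective (tau i).
  move=> [|[|a]] [|[|b]] //; rewrite /tau /=; case: (eqVneq (j i) (j' i)); lia.
have [|||_] := @exch_Ex bool c (fun b => if b then j else j') tau
  (fun x => cfun u (x true) * cfun u (x false)) itau.
- by move=> [] t; rewrite /tau /c //= inE; case: (eqVneq (j t) (j' t)) => [->|_].
- by apply: measurable_funM; exact: arr_cfun_measurable.
- by apply: L2M; apply: cellf_L2.
exact.
Qed.

Lemma cov_pattern_set1 i : cov_pattern [set i]%SET = Ex P (fun w => Z (cell1 k) w * Z (cell2 i) w).
Proof.
apply: eq_Ex => w; congr (_ * Z _ _).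
by apply/funext => t; rewrite /cell2 finset.in_set1.
Qed.

Lemma cov_pattern_setT : cov_pattern [set: 'I_k]%SET = Ex P (fun w => Z (cell1 k) w ^+ 2).
Proof.
apply: eq_Ex => w; rewrite expr2; congr (_ * Z _ _).
by apply/funext => t; rewrite finset.in_setT.
Qed.

Lemma cov_pattern_set0 : Ex P (Z (cell1 k)) = 0 -> cov_pattern finset.set0 = 0.
Proof.
move=> Z0; rewrite /cov_pattern indep_ExM ?Z0 ?mul0r//.
- exact: cellf_L2.
- pose c2 : unit -> cell k := fun=> (fun i => if i \in finset.set0 then 0 else 1)%N.
  have h : indep P (pull (fun _ : unit => cell1 k)) (pull c2).
    apply: (block_indep mN mY YY bind (cc := cell1 k)) => // i s.
    by rewrite /c2 finset.in_set0.
  pose g (x : arr Ycal unit) := cfun u (x tt).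
  have mg : measurable_fun setT g by exact: arr_cfun_measurable.
  exact: (indep_comp mg mg h).
Qed.

Lemma cov_pattern_le A : `|cov_pattern A| <= cov_pattern [set: 'I_k]%SET.
Proof.
rewrite cov_pattern_setT -(@ler_pXn2r _ 2) ?nnegrE//; last by apply: Ex_ge0 => w; exact: sqr_ge0.
rewrite real_normK ?num_real//.
apply: le_trans (Ex_CS (cellf_L2 _) (cellf_L2 _)) _.
by rewrite cellf_Ex2 -expr2.
Qed.

End OneFunctional.
End CellFunctionals.

(** * Grid averages *)

Section Grid.
Context {R : realType} {k : nat}.
Implicit Types C s : cell k.

Definition gcell C (j : {dffun forall i : 'I_k, 'I_(C i)}) : cell k := fun i => j i.
Definition gmean C (f : cell k -> R) : R := (PiC C)%:R^-1 * \sum_j f (gcell (C := C) j).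
Definition cshift C s (j : cell k) : cell k := fun i => ((s i + j i) %% C i)%N.

Lemma PiC_gt0 C : (forall i, 0 < C i)%N -> (0 < PiC C)%N.
Proof. by move=> C0; apply: prodn_gt0. Qed.

Lemma gmean_cst C (c : R) : (forall i, 0 < C i)%N -> gmean C (fun=> c) = c.
Proof.
move=> C0; rewrite /gmean sumr_const card_dep_ffun -[c *+ _]mulr_natl mulrA.
rewrite (_ : foldr _ _ _ = PiC C) ?mulVf ?mul1r//.
  by rewrite pnatr_eq0 -lt0n PiC_gt0.
rewrite /PiC foldrE big_map big_enum /=.
by apply: eq_bigr => i _; rewrite card_ord.
Qed.

Lemma gmeanD C f g : gmean C (fun j => f j + g j) = gmean C f + gmean C g.
Proof. by rewrite /gmean big_split mulrDr. Qed.

Lemma gmeanZ C c f : gmean C (fun j => c * f j) = c * gmean C f.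
Proof. by rewrite /gmean -mulr_sumr mulrCA. Qed.

Lemma gmean_sum (I : Type) (r : seq I) (Q : pred I) C (f : I -> cell k -> R) :
  gmean C (fun j => \sum_(i <- r | Q i) f i j) = \sum_(i <- r | Q i) gmean C (f i).
Proof. by rewrite /gmean exchange_big mulr_sumr. Qed.

Lemma le_gmean C f g : (forall j, f j <= g j) -> gmean C f <= gmean C g.
Proof.
by move=> fg; rewrite /gmean ler_wpM2l ?invr_ge0//; apply: ler_sum => j _.
Qed.

Lemma le_gmean_in C f g : (forall j, (forall i, j i < C i)%N -> f j <= g j) ->
  gmean C f <= gmean C g.
Proof.
move=> fg; rewrite /gmean ler_wpM2l ?invr_ge0//; apply: ler_sum => j _.
by apply: fg => i; exact: ltn_ord.
Qed.

Lemma eq_gmean C f g : (forall j, (forall i, j i < C i)%N -> f j = g j) -> gmean C f = gmean C g.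
Proof.
move=> fg; rewrite /gmean; congr (_ * _); apply: eq_bigr => j _.
by apply: fg => i; exact: ltn_ord.
Qed.

Lemma gmean_shift C s f : (forall i, 0 < C i)%N ->
  gmean C (fun j => f (cshift C s j)) = gmean C f.
Proof.
move=> C0; rewrite /gmean; congr (_ * _).
pose h (j : {dffun forall i : 'I_k, 'I_(C i)}) : {dffun forall i : 'I_k, 'I_(C i)} :=
  finfun (fun i => Ordinal (ltn_pmod (s i + j i) (C0 i))).
have hinj : injective h.
  move=> j j' /ffunP hh; apply/ffunP => i; apply/val_inj.
  have := congr1 val (hh i); rewrite /h !ffunE /= => /eqP.
  by rewrite eqn_modDl !modn_small ?ltn_ord// => /eqP.
rewrite [RHS](reindex_inj hinj); apply: eq_bigr => j _; congr f.
by apply/funext => i; rewrite /cshift /gcell /h ffunE.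
Qed.

(* Hoeffding's averaging: the cells of a shifted diagonal are independent. *)
Lemma gmean_diag C n f : (forall i, 0 < C i)%N -> (0 < n)%N ->
  gmean C f = gmean C (fun s => n%:R^-1 * \sum_(r < n) f (fun i => (r + s i) %% C i)%N).
Proof.
move=> C0 n0; rewrite gmeanZ gmean_sum.
rewrite (eq_bigr (fun=> gmean C f)); last first.
  by move=> r _; apply: (gmean_shift (fun=> r) f C0).
by rewrite sumr_const card_ord -[X in _ * X]mulr_natl mulKf// pnatr_eq0 -lt0n.
Qed.

(** Cyclic shifts make all values of the coordinate equally frequent, and the frequencies sum to
    one. *)
Lemma gmean_coord1 C i a : (forall i, 0 < C i)%N -> (a < C i)%N ->
  gmean C (fun j => (j i == a)%:R) = (C i)%:R^-1.
Proof.
move=> C0.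
have all0 b : (b < C i)%N -> gmean C (fun j => (j i == b)%:R) = gmean C (fun j => (j i == 0)%:R)%N.
  move=> bC; rewrite -[LHS](gmean_shift (fun=> b) _ C0); apply: eq_gmean => j jC.
  rewrite /cshift -[in X in _ == X](modn_small bC) -[X in (_ %% _ == X %% _)%N]addn0.
  by rewrite eqn_modDl !modn_small.
have : \sum_(b < C i) gmean C (fun j => (j i == b :> nat)%:R) = 1.
  rewrite -gmean_sum -[RHS](@gmean_cst C)//; apply: eq_gmean => j jC.
  rewrite (bigD1 (Ordinal (jC i)))//= eqxx big1 ?addr0// => b /eqP bj.
  by case: eqP => // e; case: bj; apply: val_inj.
rewrite (eq_bigr (fun=> gmean C (fun j => (j i == 0)%:R)%N)); last first.
  by move=> b _; apply: all0.
rewrite sumr_const card_ord => h aC; rewrite all0//.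
have Ci0 : (C i)%:R != 0 :> R by rewrite pnatr_eq0 -lt0n.
by apply: (mulfI Ci0); rewrite mulfV// mulr_natl.
Qed.

Lemma gmean_coord2 C i i' a a' : i != i' -> (forall i, 0 < C i)%N ->
  (a < C i)%N -> (a' < C i')%N ->
  gmean C (fun j => ((j i == a) && (j i' == a'))%:R) = (C i)%:R^-1 * (C i')%:R^-1.
Proof.
move=> ii' C0.
pose f b b' (j : cell k) : R := ((j i == b) && (j i' == b'))%:R.
have all0 b b' : (b < C i)%N -> (b' < C i')%N -> gmean C (f b b') = gmean C (f b 0%N).
  move=> bC bC'; rewrite -[LHS](gmean_shift (fun t => if t == i' then b' else 0%N) _ C0).
  apply: eq_gmean => j jC; rewrite /f /cshift eqxx (negbTE ii') add0n modn_small//.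
  rewrite -[in X in _ && (_ == X)](modn_small bC') -[X in (_ %% _ == X %% _)%N]addn0.
  by rewrite eqn_modDl !modn_small.
move=> aC aC'; rewrite -/(f a a') all0//.
have : \sum_(b < C i') gmean C (f a b) = (C i)%:R^-1.
  rewrite -gmean_sum -(gmean_coord1 C0 aC); apply: eq_gmean => j jC.
  rewrite (bigD1 (Ordinal (jC i')))//= big1 ?addr0 => [|b /eqP bj].
    by rewrite /f eqxx andbT.
  by rewrite /f; case: (j i' =P b) => [e|]; rewrite ?andbF//; case: bj; apply: val_inj.
rewrite (eq_bigr (fun=> gmean C (f a 0%N))); last by move=> b _; apply: all0.
rewrite sumr_const card_ord => <-.
by rewrite -[X in X * _]mulr_natr mulfK// pnatr_eq0 -lt0n.
Qed.

End Grid.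

(** * Characteristic functions *)

Section TrigBounds.
Context {R : realType}.
Implicit Types x y : R.

Lemma lip1 (f df : R -> R) : (forall x, is_derive x 1 f (df x)) ->
  (forall x, `|df x| <= 1) -> forall x y, `|f x - f y| <= `|x - y|.
Proof.
move=> fd df1; suff key x y : x <= y -> `|f y - f x| <= `|y - x|.
  move=> x y; case: (leP x y) => [xy|/ltW yx]; last exact: key.
  by rewrite distrC [leRHS]distrC; exact: key.
move=> xy; have [|c _ ->] := @MVT_segment R f df x y xy (fun z _ => fd z).
  apply: continuous_subspaceT => z; apply: differentiable_continuous.
  by apply/derivable1_diffP; have := fd z; case.
by rewrite normrM ler_piMl.
Qed.

Lemma sin_lip x y : `|sin x - sin y| <= `|x - y|.
Proof.
apply: (@lip1 sin cos) => z.
by rewrite ler_norml cos_geN1 cos_le1.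
Qed.

Lemma cos_lip x y : `|cos x - cos y| <= `|x - y|.
Proof.
apply: (@lip1 cos (fun z => - sin z)) => z.
by rewrite normrN ler_norml sin_geN1 sin_le1.
Qed.

Lemma norm_sin_le x : `|sin x| <= `|x|.
Proof. by have := sin_lip x 0; rewrite sin0 !subr0. Qed.

Lemma norm_cos_le1 x : `|cos x| <= 1.
Proof. by rewrite ler_norml cos_geN1 cos_le1. Qed.

Lemma norm_sin_le1 x : `|sin x| <= 1.
Proof. by rewrite ler_norml sin_geN1 sin_le1. Qed.

Lemma one_sub_cos x : 1 - cos x = 2 * sin (x / 2) ^+ 2.
Proof.
by rewrite [in cos x](_ : x = (x / 2) *+ 2) ?cos_mulr2n ?cos2sin2; first ring;
  rewrite -mulr_natr divfK.
Qed.

Lemma sub_sin_le x : `|x - sin x| <= x ^+ 2 /\ `|x - sin x| <= `|x| ^+ 3.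
Proof.
have key y : 0 <= y -> `|y - sin y| <= y ^+ 2 /\ `|y - sin y| <= y ^+ 3.
  move=> y0.
  have [|c /[!in_itv]/= /andP[c0 cy]] := @MVT_segment R (fun z => z - sin z)
      (fun z => 1 - cos z) 0 y y0 (fun z _ => _).
    apply: continuous_subspaceT => z; apply: continuousB; first exact: cvg_id.
    exact: continuous_sin.
  rewrite sin0 subrr !subr0 => ->.
  have s2 : 0 <= sin (c / 2) ^+ 2 by exact: sqr_ge0.
  have sc : `|sin (c / 2)| <= c / 2.
    by apply: le_trans (norm_sin_le _) _; rewrite ger0_norm// divr_ge0.
  have s1 := norm_sin_le1 (c / 2).
  have sn := normr_ge0 (sin (c / 2)).
  have s22 : 0 <= 2 * sin (c / 2) ^+ 2 by lra.
  rewrite one_sub_cos normrM (ger0_norm y0) (ger0_norm s22).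
  rewrite -(real_normK (num_real (sin (c / 2)))).
  set s := `|sin (c / 2)| in sc s1 sn *.
  have h1 : 2 * s ^+ 2 <= y by nra.
  have h2 : 2 * s ^+ 2 <= y ^+ 2 by nra.
  by rewrite [y ^+ 2]expr2 [y ^+ 3]exprSr; split; apply: ler_wpM2r.
have [x0|/ltW x0] := leP 0 x.
  by have := key x x0; rewrite [`|x|]ger0_norm.
have := key (- x); rewrite oppr_ge0 sinN opprK => /(_ x0).
rewrite (_ : - x + sin x = - (x - sin x)); last by ring.
by rewrite normrN sqrrN [`|x|](ler0_norm x0).
Qed.

(** The remainder is cubic near 0 but only quadratic at infinity, so it is integrable under a second
    moment: a Lindeberg argument without third moments. *)
Lemma cos_taylor2 x : `|cos x - (1 - x ^+ 2 / 2)| <= 2 * (x ^+ 2 * Num.min 1 `|x|).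
Proof.
have [h2 h3] := sub_sin_le (x / 2).
have hs := norm_sin_le (x / 2).
have -> : cos x - (1 - x ^+ 2 / 2) = 2 * ((x / 2 - sin (x / 2)) * (x / 2 + sin (x / 2))).
  have -> : cos x = 1 - 2 * sin (x / 2) ^+ 2 by have := one_sub_cos x; lra.
  by field.
rewrite !normrM (ger0_norm (@ler0n R 2)) ler_pM2l//.
have e1 : `|x / 2| = `|x| / 2 by rewrite normrM (@ger0_norm _ 2^-1).
have h4 : `|x / 2 + sin (x / 2)| <= `|x|.
  by apply: le_trans (ler_normD _ _) _; move: hs; rewrite e1; lra.
have h2' : `|x / 2 - sin (x / 2)| <= `|x|.
  by apply: le_trans (ler_normB _ _) _; move: hs; rewrite e1; lra.
have n0 := normr_ge0 (x / 2 - sin (x / 2)).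
have n1 := normr_ge0 (x / 2 + sin (x / 2)).
have x0 := normr_ge0 x.
rewrite -(real_normK (num_real x)).
have e2 : (x / 2) ^+ 2 = `|x| ^+ 2 / 4 by rewrite real_normK ?num_real//; field.
rewrite e1 in hs h3; rewrite e2 in h2.
move: h2 h3 n0 h4 n1 h2' x0.
set a := `|x / 2 - _|; set b := `|x / 2 + _|; set t := `|x| => h2 h3 n0 h4 n1 h2' x0.
by have [t1|t1] := leP 1 t; nra.
Qed.

Lemma sin_taylor1 x : `|sin x - x| <= x ^+ 2 * Num.min 1 `|x|.
Proof.
have [h2 h3] := sub_sin_le x; rewrite distrC.
case: (leP 1 `|x|) => _; first by rewrite mulr1.
by rewrite -(real_normK (num_real x)) -exprSr.
Qed.

Lemma expR_taylor1 x : 0 <= x -> `|expR (- x) - (1 - x)| <= x ^+ 2.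
Proof.
move=> x0; have h1 := expR_ge1Dx (- x); have h2 := expR_ge1Dx x.
have h3 : expR (- x) <= 1 - x + x ^+ 2.
  have p : 0 < 1 + x by lra.
  have : expR (- x) <= (1 + x)^-1 by rewrite expRN lef_pV2 ?posrE ?expR_gt0.
  move=> h; apply: le_trans h _.
  rewrite -[leLHS]mul1r ler_pdivrMr//.
  by have := exprn_ge0 3 x0; nra.
rewrite ger0_norm; lra.
Qed.

End TrigBounds.

(** * Characteristic functions of sums of small independent variables *)

Section SmallSum.
Context {R : realType} {d} {T : measurableType d} (P : probability T R).

Lemma cos_intg (f : T -> R) : measurable_fun setT f -> intg P (fun w => cos (f w)).
Proof.
move=> mf; apply: (@intg_bnd _ _ _ _ _ 1) => [|w]; last exact: norm_cos_le1.
by apply: measurableT_comp mf; apply: continuous_measurable_fun; exact: continuous_cos.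
Qed.

Lemma sin_intg (f : T -> R) : measurable_fun setT f -> intg P (fun w => sin (f w)).
Proof.
move=> mf; apply: (@intg_bnd _ _ _ _ _ 1) => [|w]; last exact: norm_sin_le1.
by apply: measurableT_comp mf; apply: continuous_measurable_fun; exact: continuous_sin.
Qed.

Lemma measurable_sin : measurable_fun setT (@sin R).
Proof. by apply: continuous_measurable_fun; exact: continuous_sin. Qed.

Lemma measurable_cos : measurable_fun setT (@cos R).
Proof. by apply: continuous_measurable_fun; exact: continuous_cos. Qed.

Lemma cos_L2 (f : T -> R) : measurable_fun setT f -> L2 P (fun w => cos (f w)).
Proof.
move=> mf; apply: (@L2_bnd _ _ _ _ _ 1) => [|w]; last exact: norm_cos_le1.
exact: measurableT_comp measurable_cos mf.
Qed.

Lemma sin_L2 (f : T -> R) : measurable_fun setT f -> L2 P (fun w => sin (f w)).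
Proof.
move=> mf; apply: (@L2_bnd _ _ _ _ _ 1) => [|w]; last exact: norm_sin_le1.
exact: measurableT_comp measurable_sin mf.
Qed.

(** Lindeberg-type functional that controls, up to the factor [s ^+ 2], the Taylor remainders of
    both parts of the characteristic function of [s * f]. *)
Definition small_moment (f : T -> R) (s : R) : R :=
  Ex P (fun w => f w ^+ 2 * Num.min 1 `|s * f w|).

Lemma small_momentP (f : T -> R) s : L2 P f ->
  intg P (fun w => f w ^+ 2 * Num.min 1 `|s * f w|).
Proof.
move=> [mf f2]; apply: intg_le f2 _.
  apply: measurable_funM; first exact: measurable_funX.
  by apply: measurable_minr => //; apply: measurableT_comp => //; exact: measurable_funM.
move=> w; rewrite normrM (ger0_norm (sqr_ge0 _)) ler_piMr ?sqr_ge0// ger0_norm ?ge_min ?lexx//.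
Qed.

(** Dominated convergence, with majorant [f ^+ 2], along [s = 1 / (n + 1)]; monotonicity in [|s|]
    covers the other values. *)
Lemma small_moment_cvg (f : T -> R) : L2 P f -> forall e, 0 < e ->
  exists2 s0, 0 < s0 & forall s, `|s| <= s0 -> small_moment f s <= e.
Proof.
move=> f2 e e0.
pose h n w := f w ^+ 2 * Num.min 1 `|n.+1%:R^-1 * f w|.
have hc : (\int[P]_w (h n w)%:E)%E @[n --> \oo] --> (\int[P]_w 0)%E.
  have mh n : measurable_fun setT (h n).
    by apply: intg_meas; exact: small_momentP.
  apply: (@dominated_cvg _ _ _ P setT measurableT (fun n w => (h n w)%:E) (cst 0%E)
     (fun w => (f w ^+ 2)%:E)) => //.
  - by move=> n; exact/measurable_EFinP.
  - move=> w _; apply: cvg_EFin; first exact: nearW.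
    rewrite -(mulr0 (f w ^+ 2)); apply: cvgM; first exact: cvg_cst.
    apply: (@squeeze_cvgr _ _ _ _ (cst 0) (fun n => n.+1%:R^-1 * `|f w|)).
    + apply: nearW => n; rewrite le_min ler01 normr_ge0 /= ge_min; apply/orP; right.
      by rewrite normrM ger0_norm.
    + exact: cvg_cst.
    + rewrite -[X in _ --> X](mul0r `|f w|).
      by apply: cvgM; [exact: cvg_harmonic|exact: cvg_cst].
  - exact: f2.2.
  - move=> n w _; rewrite /= lee_fin normrM (ger0_norm (sqr_ge0 _)) ler_piMr ?sqr_ge0//.
    by rewrite ger0_norm ?ge_min ?lexx// le_min ler01/=.
rewrite integral0 in hc.
have /fine_cvgP[_ /cvgrPdist_le/(_ e e0)[n _ /(_ n (leqnn _)) hn]] := hc.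
exists n.+1%:R^-1 => // s sn.
have hn' : small_moment f n.+1%:R^-1 <= e.
  by apply: le_trans hn; rewrite /= sub0r normrN; exact: ler_norm.
apply: le_trans hn'; rewrite /small_moment.
apply: le_Ex => [||w]; [exact: small_momentP|exact: small_momentP|].
apply: ler_wpM2l; first exact: sqr_ge0.
rewrite le_min ge_min lexx/= ge_min; apply/orP; right.
by rewrite !normrM ler_wpM2r// (@ger0_norm _ (_^-1)).
Qed.

Lemma charf_taylor (f : T -> R) s : L2 P f -> Ex P f = 0 ->
  let v := Ex P (fun w => f w ^+ 2) in let e := s ^+ 2 * (2 * small_moment f s + s ^+ 2 * v ^+ 2) in
  `|Ex P (fun w => cos (s * f w)) - expR (- (s ^+ 2 * v / 2))| <= e /\
  `|Ex P (fun w => sin (s * f w))| <= e.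
Proof.
move=> f2 f0 v e.
have mf := f2.1.
have msf : measurable_fun setT (fun w => s * f w) by exact: measurable_funM.
have v0 : 0 <= v by apply: Ex_ge0 => w; exact: sqr_ge0.
have sm0 : 0 <= small_moment f s.
  by apply: Ex_ge0 => w; rewrite mulr_ge0 ?sqr_ge0// le_min ler01 normr_ge0.
have s0 := sqr_ge0 s.
have fi := L2_intg f2.
have ismall := small_momentP s f2.
have b1 : `|Ex P (fun w => cos (s * f w)) - (1 - s ^+ 2 * v / 2)| <= s ^+ 2 * (2 * small_moment f s).
  have -> : 1 - s ^+ 2 * v / 2 = Ex P (fun w => 1 - s ^+ 2 / 2 * f w ^+ 2).
    rewrite ExB; [|exact: intg_cst|apply: intgZ; exact: f2.2].
    by rewrite Ex_cst ExZ ?/v; [congr (_ - _); ring|exact: f2.2].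
  have ib : intg P (fun w => 1 - s ^+ 2 / 2 * f w ^+ 2).
    by apply: intgB; [exact: intg_cst|apply: intgZ; exact: f2.2].
  rewrite -ExB//; last exact: cos_intg.
  apply: le_trans (Ex_norm _) _; first by apply: intgB => //; exact: cos_intg.
  rewrite mulrA -ExZ//; apply: le_Ex => [||w].
  - by apply: intg_norm; apply: intgB => //; exact: cos_intg.
  - exact: intgZ.
  - have := cos_taylor2 (s * f w); rewrite exprMn.
    rewrite (_ : s ^+ 2 * f w ^+ 2 / 2 = s ^+ 2 / 2 * f w ^+ 2); last by ring.
    by move=> h; apply: (le_trans h); rewrite le_eqVlt; apply/orP; left; apply/eqP; ring.
split.
  have b2 := @expR_taylor1 R (s ^+ 2 * v / 2) _.
  have {}b2 := b2 (divr_ge0 (mulr_ge0 s0 v0) (ler0n _ _)).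
  rewrite /e mulrDr.
  rewrite (_ : Ex P _ - _ = (Ex P (fun w => cos (s * f w)) - (1 - s ^+ 2 * v / 2)) -
    (expR (- (s ^+ 2 * v / 2)) - (1 - s ^+ 2 * v / 2))); last by ring.
  apply: le_trans (ler_normB _ _) _; apply: lerD => //; apply: le_trans b2 _.
  rewrite (_ : (_ / 2) ^+ 2 = (s ^+ 2 * (s ^+ 2 * v ^+ 2)) / 4); last by field.
  by have := mulr_ge0 s0 (mulr_ge0 s0 (sqr_ge0 v)); lra.
have -> : Ex P (fun w => sin (s * f w)) = Ex P (fun w => sin (s * f w) - s * f w).
  by rewrite ExB ?ExZ ?f0 ?mulr0 ?subr0//; [exact: sin_intg|exact: intgZ].
have ii : intg P (fun w => sin (s * f w) - s * f w).
  by apply: intgB; [exact: sin_intg|exact: intgZ].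
apply: le_trans (Ex_norm ii) _.
apply: (@le_trans _ _ (s ^+ 2 * small_moment f s)).
  rewrite -ExZ//; apply: le_Ex => [||w]; [exact: intg_norm|exact: intgZ|].
  by have := sin_taylor1 (s * f w); rewrite exprMn mulrA.
rewrite /e ler_wpM2l//.
by have := mulr_ge0 s0 (sqr_ge0 v); lra.
Qed.

(* A real form of the product formula for characteristic functions: keeping an
   arbitrary phase [b] avoids complex numbers. *)
Lemma charf_indep_sum (X : nat -> T -> R) (v e : nat -> R) (G : nat) :
  (forall g, measurable_fun setT (X g)) ->
  (forall g, (g < G)%N -> indep P (fun w => \sum_(h < g) X h w) (X g)) ->
  (forall g, 0 <= v g) ->
  (forall g, (g < G)%N -> `|Ex P (fun w => cos (X g w)) - expR (- v g)| <= e g) ->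
  (forall g, (g < G)%N -> `|Ex P (fun w => sin (X g w))| <= e g) ->
  forall b, `|Ex P (fun w => cos (b + \sum_(g < G) X g w)) - cos b * expR (- \sum_(g < G) v g)|
    <= 2 * \sum_(g < G) e g.
Proof.
move=> mX; elim: G => [|G IH] iX v0 hc hs b.
  under eq_Ex do rewrite big_ord0 addr0.
  by rewrite Ex_cst !big_ord0 oppr0 expR0 mulr1 subrr normr0 mulr0.
have {}IH := IH (fun g gG => iX g (ltnW gG)) v0 (fun g gG => hc g (ltnW gG)) (fun g gG => hs g (ltnW gG)).
have mS : measurable_fun setT (fun w => \sum_(g < G) X g w) by apply: measurable_sum.
have mSb c : measurable_fun setT (fun w => c + \sum_(g < G) X g w) by apply: measurable_funD.
have e0 : 0 <= e G := le_trans (normr_ge0 _) (hs G (ltnSn G)).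
set S := fun w => \sum_(g < G) X g w.
have ind := iX G (ltnSn G).
have mtr (f : R -> R) : measurable_fun setT f -> measurable_fun setT (fun s => f (b + s)).
  by move=> mf; apply: measurableT_comp mf _; apply: measurable_funD.
have e1 : Ex P (fun w => cos (b + S w) * cos (X G w)) =
    Ex P (fun w => cos (b + S w)) * Ex P (fun w => cos (X G w)).
  apply: indep_ExM; [exact: cos_L2|exact: cos_L2|].
  exact: (indep_comp (mtr _ measurable_cos) measurable_cos ind).
have e2 : Ex P (fun w => sin (b + S w) * sin (X G w)) =
    Ex P (fun w => sin (b + S w)) * Ex P (fun w => sin (X G w)).
  apply: indep_ExM; [exact: sin_L2|exact: sin_L2|].
  exact: (indep_comp (mtr _ measurable_sin) measurable_sin ind).
have -> : Ex P (fun w => cos (b + \sum_(g < G.+1) X g w)) =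
    Ex P (fun w => cos (b + S w)) * Ex P (fun w => cos (X G w)) -
    Ex P (fun w => sin (b + S w)) * Ex P (fun w => sin (X G w)).
  rewrite -e1 -e2 -ExB; [|apply: L2M; exact: cos_L2|apply: L2M; exact: sin_L2].
  by apply: eq_Ex => w; rewrite big_ord_recr/= addrA cosD.
rewrite !big_ord_recr/= opprD expRD.
have {IH} := IH b; set A := Ex P _; set E := expR (- \sum_(_ < _) _) => IH.
have := hc G (ltnSn G); set B := Ex P _; set F := expR _ => hB.
have := hs G (ltnSn G); set D := Ex P _ => hD.
set A' := Ex P (fun w => sin _).
have A1 : `|A| <= 1.
  apply: le_trans (Ex_norm (cos_intg (mSb b))) _; rewrite -[leRHS](Ex_cst P).
  by apply: le_Ex => [||w]; [exact: intg_norm (cos_intg (mSb b))|exact: intg_cst|exact: norm_cos_le1].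
have A'1 : `|A'| <= 1.
  apply: le_trans (Ex_norm (sin_intg (mSb b))) _; rewrite -[leRHS](Ex_cst P).
  by apply: le_Ex => [||w]; [exact: intg_norm (sin_intg (mSb b))|exact: intg_cst|exact: norm_sin_le1].
have F1 : `|F| <= 1.
  by rewrite ger0_norm ?expR_ge0// -expR0 ler_expR lerNl oppr0.
(* The new factor contributes its cosine error through [A] and its sine error through [A'], both at
   most 1 in modulus: hence the factor 2 in front of the errors. *)
have -> : A * B - A' * D - cos b * (E * F) = A * (B - F) - A' * D + (A - cos b * E) * F by ring.
apply: le_trans (ler_normD _ _) _; rewrite [leRHS]mulrDr [leRHS]addrC; apply: lerD; last first.
  by rewrite normrM; apply: le_trans IH; rewrite ler_piMr.
apply: le_trans (ler_normB _ _) _; rewrite !normrM.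
have := normr_ge0 (B - F); have := normr_ge0 D; have := normr_ge0 A; have := normr_ge0 A'.
nra.
Qed.

End SmallSum.

(** * Central limit theorem for grid averages *)

Lemma sum_nat_mul {R : realType} (m k : nat) (f : nat -> R) :
  \sum_(g < m * k) f g = \sum_(a < m) \sum_(i < k) f (a * k + i)%N.
Proof.
elim: m => [|m IH]; first by rewrite mul0n !big_ord0.
rewrite big_ord_recr/= -IH -(big_mkord xpredT f) mulSn addnC.
rewrite (@big_cat_nat _ _ _ (m * k))//= ?leq_addr// big_mkord; congr (_ + _).
by rewrite -{1}[(m * k)%N]add0n big_addn addKn big_mkord; apply: eq_bigr => i _; rewrite addnC.
Qed.

Section CLT.
Context {R : realType} {d} {T : measurableType d} (P : probability T R).
Context {k l : nat} (Ycal : set 'rV[R]_l).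
Context (N : cell k -> T -> nat) (Y : cell k -> nat -> T -> 'rV[R]_l).
Hypothesis mN : forall j n, measurable [set w | N j w = n].
Hypothesis mY : forall j ell s, measurable_fun setT (fun w => Y j ell w ord0 s).
Hypothesis YY : forall j ell w, Ycal (Y j ell w).
Hypothesis exch : sep_exchangeable P N Y.
Hypothesis bind : block_independent P N Y.
Hypothesis k0 : (0 < k)%N.
Variable u : 'rV[R]_l -> R.
Hypothesis bu : borel_fun_on Ycal u.
Let Z := cellf N Y u.
Hypothesis u2 : L2 P (Z (cell1 k)).
Hypothesis u0 : Ex P (Z (cell1 k)) = 0.

Local Notation cov := (cov_pattern P N Y u).
Local Notation pull := (pull Ycal N Y).
Let V := cov [set: 'I_k]%SET.
Let H i := cov [set i]%SET.

Let ZL2 j : L2 P (Z j). Proof. exact (cellf_L2 mN mY YY exch bu u2 j). Qed.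
Let covE j j' : Ex P (fun w => Z j w * Z j' w) = cov [set i | j i == j' i]%SET.
Proof. exact (cov_patternE mN mY YY exch bu u2 j j'). Qed.
Let cov0 : cov finset.set0 = 0. Proof. exact (cov_pattern_set0 mN mY YY exch bind bu u2 u0). Qed.
Let cov_le A : `|cov A| <= V. Proof. exact (cov_pattern_le mN mY YY exch bu u2 A). Qed.
Let V0 : 0 <= V. Proof. exact: le_trans (normr_ge0 _) (cov_le finset.set0). Qed.

Section FixedBlock.
Variable M : nat.
Hypothesis M0 : (0 < M)%N.

Definition gidx (g : nat) : 'I_k := Ordinal (ltn_pmod g k0).

(* The cells of group g all share the coordinate g * M + 1 in direction [gidx g]
   and have otherwise distinct coordinates in ]g * M, (g + 1) * M]. *)
Definition gcells (g m : nat) : cell k :=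
  fun t => if t == gidx g then (g * M + 1)%N else (g * M + 1 + m)%N.

(** Substitute for the projection in direction [gidx g]: averaging cells that agree in this
    direction only leaves the part of a cell due to the shared coordinate, up to a term of variance
    of order [1 / M]. *)
Definition zeta (g : nat) (w : T) : R := M%:R^-1 * \sum_(m < M) Z (gcells g m) w.

(** Groups are numbered [g = a * k + i], for level [a] in direction [i]. Moving the grid by [spread]
    puts the slice of level [a] in direction [i] on the coordinate shared by that group. *)
Definition spread (i : 'I_k) (a : nat) : nat := ((a * k + i) * M + 1)%N.

Let zetaL2 g : L2 P (zeta g).
Proof. by apply: L2Z; apply: L2_sum. Qed.

Lemma zeta_Ex g : Ex P (zeta g) = 0.
Proof.
rewrite /zeta ExZ; last by apply: intg_sum => m _; exact: L2_intg.
rewrite Ex_sum => [|m _]; last exact: L2_intg.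
rewrite big1 ?mulr0// => m _.
by have := cellf_Ex mN mY YY exch bu u2 (gcells g m); rewrite u0.
Qed.

Lemma spread_inj i : injective (spread i).
Proof.
move=> a b /eqP; rewrite eqn_add2r eqn_pmul2r// eqn_add2r eqn_pmul2r//.
by move/eqP.
Qed.

Lemma block_div g g' m m' : (m < M)%N -> (m' < M)%N ->
  (g * M + m = g' * M + m')%N -> g = g'.
Proof.
by move=> mM mM' /(congr1 (divn^~ M)); rewrite !divnMDl// !divn_small// !addn0.
Qed.

Lemma cov_zeta_zeta g m m' : (m < M)%N -> (m' < M)%N ->
  Ex P (fun w => Z (gcells g m) w * Z (gcells g m') w) = if m == m' then V else H (gidx g).
Proof.
move=> mM mM'; rewrite covE; case: eqVneq => [->|mm].
  by rewrite /V; congr cov; apply/setP => t; rewrite !inE eqxx.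
rewrite /H; congr cov; apply/setP => t; rewrite !inE /gcells.
have [_|_] := eqVneq t (gidx g); first by rewrite eqxx.
by rewrite eqn_add2l (negbTE mm).
Qed.

Lemma cov_zeta_cross g g' m m' : (m < M)%N -> (m' < M)%N -> g != g' ->
  Ex P (fun w => Z (gcells g m) w * Z (gcells g' m') w) = 0.
Proof.
move=> mM mM' gg; rewrite covE -[RHS]cov0; congr cov; apply/setP => t; rewrite !inE /gcells.
apply/negbTE/eqP => e; move/eqP : gg; apply.
by move: e; case: ifP => _; case: ifP => _ e;
  [apply: (@block_div _ _ 0%N 0%N)|apply: (@block_div _ _ 0%N m')|
   apply: (@block_div _ _ m 0%N)|apply: (@block_div _ _ m m')] => //; lia.
Qed.

(** Coordinates can only coincide inside one block, so a moved cell meets group [g] at most in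
    direction [gidx g], and there exactly when its level is [g %/ k]; the pattern is then a
    singleton, otherwise empty. *)
Lemma cov_grid_zeta j g m : (m < M)%N ->
  Ex P (fun w => Z (fun t => spread t (j t)) w * Z (gcells g m) w) =
  H (gidx g) * (j (gidx g) == g %/ k)%N%:R.
Proof.
move=> mM; rewrite covE.
have eg := divn_eq g k.
have [e|ne] := eqVneq (j (gidx g)) (g %/ k)%N; rewrite ?mulr1 ?mulr0.
  rewrite /H; congr cov; apply/setP => t; rewrite !inE /gcells /spread.
  have [->|tg] := eqVneq t (gidx g); first by rewrite e /= -eg eqxx.
  apply/negbTE/eqP => e1; move/eqP: tg; apply; apply/val_inj => /=.
  have {}e1 : (j t * k + t)%N = g by apply: (@block_div _ _ 0%N m) => //; lia.
  by rewrite -e1 modnMDl modn_small.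
rewrite -[RHS]cov0; congr cov; apply/setP => t; rewrite !inE /gcells /spread.
apply/negbTE/eqP => e1.
have {}e1 : (j t * k + t)%N = g.
  by move: e1; case: eqP => _ e1; [apply: (@block_div _ _ 0%N 0%N)|apply: (@block_div _ _ 0%N m)] => //; lia.
have tE : t = gidx g by apply/val_inj => /=; rewrite -e1 modnMDl modn_small.
by move/eqP: ne; apply; rewrite -tE -e1 divnMDl// divn_small ?addn0.
Qed.

(** Among the [M ^ 2] pairs of cells of a group, [M] consist of equal cells and contribute [V]; the
    others agree in one direction and contribute [H i]. *)
Definition zvar (i : 'I_k) : R := H i + (V - H i) / M%:R.

Let Mn0 : M%:R != 0 :> R. Proof. by rewrite pnatr_eq0 -lt0n. Qed.

Lemma zeta_Ex2 g : Ex P (fun w => zeta g w ^+ 2) = zvar (gidx g).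
Proof.
have -> : Ex P (fun w => zeta g w ^+ 2) =
    Ex P (fun w => M%:R^-1 ^+ 2 * \sum_(m < M) \sum_(m' < M) (Z (gcells g m) w * Z (gcells g m') w)).
  apply: eq_Ex => w; rewrite /zeta exprMn; congr (_ * _).
  by rewrite expr2 big_distrlr.
rewrite ExZ; last by apply: intg_sum => m _; apply: intg_sum => m' _; exact: L2M.
rewrite Ex_sum; last by move=> m _; apply: intg_sum => m' _; exact: L2M.
rewrite (eq_bigr (fun=> V + M.-1%:R * H (gidx g))).
  rewrite sumr_const card_ord /zvar.
  have -> : M.-1%:R = M%:R - 1 :> R by rewrite -[in RHS](prednK M0) -natr1 addrK.
  by rewrite -[_ *+ _]mulr_natl; field.
move=> m _; rewrite Ex_sum => [|m' _]; last exact: L2M.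
rewrite (bigD1 m)//= cov_zeta_zeta// eqxx; congr (_ + _).
rewrite (eq_bigr (fun=> H (gidx g))) => [|m' mm]; last first.
  by rewrite cov_zeta_zeta// ifN_eqC.
by rewrite sumr_const cardC1 card_ord mulr_natl.
Qed.

Lemma zvar_ge0 i : 0 <= zvar i.
Proof.
have -> : i = gidx i by apply: val_inj; rewrite /= modn_small.
by rewrite -zeta_Ex2; apply: Ex_ge0 => w; exact: sqr_ge0.
Qed.

Lemma zeta_cross g g' : g != g' -> Ex P (fun w => zeta g w * zeta g' w) = 0.
Proof.
move=> gg.
have -> : Ex P (fun w => zeta g w * zeta g' w) =
    Ex P (fun w => M%:R^-1 ^+ 2 * \sum_(m < M) \sum_(m' < M) (Z (gcells g m) w * Z (gcells g' m') w)).
  apply: eq_Ex => w; rewrite /zeta mulrACA -expr2; congr (_ * _).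
  by rewrite big_distrlr.
rewrite ExZ; last by apply: intg_sum => m _; apply: intg_sum => m' _; exact: L2M.
rewrite Ex_sum; last by move=> m _; apply: intg_sum => m' _; exact: L2M.
rewrite big1 ?mulr0// => m _; rewrite Ex_sum => [|m' _]; last exact: L2M.
by rewrite big1// => m' _; rewrite cov_zeta_cross.
Qed.

(** A translation by whole turns of [k] blocks sends group [gidx g] to group [g], so only [k]
    different Lindeberg terms occur. *)
Lemma zeta_small g s : small_moment P (zeta g) s = small_moment P (zeta (gidx g)) s.
Proof.
pose h (x : arr Ycal 'I_M) : R :=
  let z := M%:R^-1 * \sum_(m < M) cfun u (x m) in z ^+ 2 * Num.min 1 `|s * z|.
have mz : measurable_fun setT (fun x : arr Ycal 'I_M => M%:R^-1 * \sum_(m < M) cfun u (x m)).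
  by apply: measurable_funM => //; apply: measurable_sum => m; exact: arr_cfun_measurable.
have [||||_] := @exch_Ex _ _ _ P k l Ycal N Y mN mY YY exch 'I_M (fun m => gcells (gidx g) m)
   (fun m => gcells g m) (fun t a => (g %/ k * k * M + a)%N) h.
- by move=> i; exact: addnI.
- move=> m t; rewrite /gcells (_ : gidx (gidx g) = gidx g); last first.
    by apply: val_inj; rewrite /= modn_mod.
  by case: ifP => _; rewrite {1}(divn_eq g k) /= mulnDl ?addnA.
- apply: measurable_funM; first exact: measurable_funX.
  by apply: measurable_minr => //; apply: measurableT_comp => //; exact: measurable_funM.
- exact: small_momentP (zetaL2 (gidx g)).
exact.
Qed.

Section FixedGrid.
Variables (C : cell k) (n : nat).
Hypotheses (n0 : (0 < n)%N) (nC : forall i, (n <= C i)%N).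

Let C0 i : (0 < C i)%N. Proof. exact: leq_trans n0 (nC i). Qed.
Let Cn0 i : (C i)%:R != 0 :> R. Proof. by rewrite pnatr_eq0 -lt0n. Qed.

(** Zero weight for levels outside the grid lets all directions share the index range [G], although
    the sides [C i] differ. *)
Definition gweight (g : nat) : R := if (g %/ k < C (gidx g))%N then (C (gidx g))%:R^-1 else 0.
Let G : nat := ((\max_(i < k) C i) * k)%N.
Let S (w : T) : R := \sum_(g < G) gweight g * zeta g w.
Let Zbar (w : T) : R := gmean C (fun j => Z (fun t => spread t (j t)) w).

Lemma sum_gweight (F : 'I_k -> R) : \sum_(g < G) gweight g ^+ 2 * F (gidx g) = \sum_(i < k) F i / (C i)%:R.
Proof.
rewrite (sum_nat_mul _ _ (fun g => gweight g ^+ 2 * F (gidx g))) exchange_big; apply: eq_bigr => i _ /=.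
have gi a : gidx (a * k + i) = i by apply: val_inj; rewrite /= modnMDl modn_small.
have ga a : ((a * k + i) %/ k)%N = a by rewrite divnMDl// divn_small// addn0.
have le : (C i <= \max_(i < k) C i)%N by exact: (leq_bigmax (F := fun i => C i)).
under eq_bigr do rewrite /gweight gi ga.
rewrite -(big_mkord xpredT (fun a => (if (a < C i)%N then (C i)%:R^-1 else 0) ^+ 2 * F i)).
rewrite (@big_cat_nat _ _ _ (C i))//= [X in _ + X]big_nat_cond [X in _ + X]big1 => [|a /andP[/andP[ha _] _]]; last first.
  by rewrite ltnNge ha /= expr0n/= mul0r.
rewrite addr0 big_mkord (eq_bigr (fun=> (C i)%:R^-1 ^+ 2 * F i)) => [|a _]; last by rewrite ltn_ord.
by rewrite sumr_const card_ord -[_ *+ _]mulr_natl; field.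
Qed.

Lemma S_L2 : L2 P S.
Proof. by apply: L2_sum => g _; apply: L2Z. Qed.

Lemma Zbar_L2 : L2 P Zbar.
Proof. by apply: L2Z; apply: L2_sum => j _. Qed.

Lemma S_Ex2 : Ex P (fun w => S w ^+ 2) = \sum_(i < k) zvar i / (C i)%:R.
Proof.
rewrite -sum_gweight.
have -> : Ex P (fun w => S w ^+ 2) =
   Ex P (fun w => \sum_(g < G) \sum_(g' < G) (gweight g * gweight g') * (zeta g w * zeta g' w)).
  apply: eq_Ex => w; rewrite expr2 /S big_distrlr; apply: eq_bigr => g _.
  by apply: eq_bigr => g' _; rewrite mulrACA.
rewrite Ex_sum => [|g _]; last by apply: intg_sum => g' _; apply: intgZ; exact: L2M.
apply: eq_bigr => g _; rewrite Ex_sum => [|g' _]; last by apply: intgZ; exact: L2M.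
rewrite (bigD1 g)//= big1 ?addr0 => [|g' gg].
  rewrite ExZ; last exact: L2M.
  by rewrite -zeta_Ex2 [X in _ = X * _]expr2; congr (_ * _); apply: eq_Ex => w; rewrite expr2.
by rewrite ExZ ?zeta_cross ?mulr0//; [rewrite eq_sym|exact: L2M].
Qed.

Lemma ZbarS_Ex : Ex P (fun w => Zbar w * S w) = \sum_(i < k) H i / (C i)%:R.
Proof.
rewrite -sum_gweight.
have -> : Ex P (fun w => Zbar w * S w) =
   Ex P (fun w => \sum_(g < G) gweight g * (Zbar w * zeta g w)).
  by apply: eq_Ex => w; rewrite /S big_distrr; apply: eq_bigr => g _; rewrite /= mulrCA.
rewrite Ex_sum => [|g _]; last by apply: intgZ; apply: L2M => //; exact: Zbar_L2.
apply: eq_bigr => g _; rewrite ExZ; last by apply: L2M => //; exact: Zbar_L2.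
have -> : Ex P (fun w => Zbar w * zeta g w) = gmean C (fun j => H (gidx g) * (j (gidx g) == g %/ k)%N%:R).
  have -> : Ex P (fun w => Zbar w * zeta g w) = Ex P (fun w => (PiC C)%:R^-1 *
     \sum_(j : {dffun forall i : 'I_k, 'I_(C i)}) M%:R^-1 * \sum_(m < M)
        (Z (fun t => spread t (gcell j t)) w * Z (gcells g m) w)).
    apply: eq_Ex => w; rewrite /Zbar /gmean /zeta -mulrA; congr (_ * _).
    by rewrite big_distrl; apply: eq_bigr => j _ /=; rewrite mulrCA big_distrr.
  rewrite ExZ; last by apply: intg_sum => j _; apply: intgZ; apply: intg_sum => m _; exact: L2M.
  rewrite Ex_sum => [|j _]; last by apply: intgZ; apply: intg_sum => m _; exact: L2M.
  rewrite /gmean; congr (_ * _); apply: eq_bigr => j _.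
  rewrite ExZ; last by apply: intg_sum => m _; exact: L2M.
  rewrite Ex_sum => [|m _]; last exact: L2M.
  rewrite (eq_bigr (fun=> H (gidx g) * (gcell j (gidx g) == g %/ k)%N%:R)) => [|m _]; last exact: cov_grid_zeta.
  by rewrite sumr_const card_ord -[X in _ * X]mulr_natl mulKf.
rewrite gmeanZ /gweight; case: ifP => gC; last by rewrite expr0n/= !mul0r.
by rewrite gmean_coord1// mulrCA expr2 -mulrA mulrC -mulrA mulrCA mulrA mulrC.
Qed.

(** Only singletons matter to first order. Patterns with two or more coordinates are absorbed by
    counting their ordered pairs of distinct coordinates, which are rarer in the grid by a factor of
    at most [1 / n]. *)
Lemma cov_upper A : cov A <= \sum_(i < k) H i * (i \in A)%:R +
  2 * V * \sum_(i < k) \sum_(i' < k | i' != i) ((i \in A) && (i' \in A))%:R.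
Proof.
have HV i : - V <= H i by have := cov_le [set i]%SET; rewrite ler_norml => /andP[].
have dbl i : i \in A -> \sum_(i' < k | i' != i) ((i \in A) && (i' \in A))%:R = (#|A|.-1)%:R :> R.
  move=> iA; rewrite iA/= (cardsD1 i A) iA /= -sum1_card natr_sum big_mkcond [RHS]big_mkcond.
  by apply: eq_bigr => i' _; rewrite !inE; case: eqP => //= _; case: (i' \in A).
have -> : \sum_(i < k) H i * (i \in A)%:R = \sum_(i in A) H i.
  by rewrite [RHS]big_mkcond; apply: eq_bigr => i _; case: (i \in A); rewrite ?mulr1 ?mulr0.
have -> : \sum_(i < k) \sum_(i' < k | i' != i) ((i \in A) && (i' \in A))%:R = (#|A| * #|A|.-1)%:R :> R.
  rewrite (bigID (fun i => i \in A))/= [X in _ + X]big1 => [|i /negbTE iA]; last first.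
    by rewrite big1// => i' _; rewrite iA.
  by rewrite addr0 (eq_bigr _ dbl) sumr_const natrM mulr_natl.
have [A0|] := posnP #|A|.
  by rewrite (cards0_eq A0) cov0 big_set0 cards0 mulr0 addr0.
rewrite leq_eqVlt => /predU1P[/esym/eqP/cards1P[i ->]|A2].
  by rewrite big_set1 cards1 mulr0 addr0.
have l1 : - (V *+ #|A|) <= \sum_(i in A) H i.
  rewrite -sumr_const -sumrN; exact: ler_sum.
have l2 : cov A <= V := le_trans (ler_norm _) (cov_le A).
(* For [#|A| >= 2] the pair count pays both for [cov A <= V] and for the lower bound [- V #|A|] of
   the singleton terms. *)
have l3 : (#|A| + 1)%:R <= 2 * (#|A| * #|A|.-1)%:R :> R by rewrite -natrM ler_nat; nia.
have : V * (#|A| + 1)%:R <= V * (2 * (#|A| * #|A|.-1)%:R) by exact: ler_wpM2l.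
by move: l1; rewrite -mulr_natr natrD; lra.
Qed.

Lemma Zbar_Ex2 : Ex P (fun w => Zbar w ^+ 2) <= \sum_(i < k) H i / (C i)%:R +
  2 * V * \sum_(i < k) \sum_(i' < k | i' != i) (C i)%:R^-1 * (C i')%:R^-1.
Proof.
have -> : Ex P (fun w => Zbar w ^+ 2) = gmean C (fun j => gmean C (fun j' =>
    cov [set i | j i == j' i]%SET)).
  have -> : Ex P (fun w => Zbar w ^+ 2) = Ex P (fun w => (PiC C)%:R^-1 *
     \sum_(j : {dffun forall i : 'I_k, 'I_(C i)}) ((PiC C)%:R^-1 *
     \sum_(j' : {dffun forall i : 'I_k, 'I_(C i)})
        (Z (fun t => spread t (gcell j t)) w * Z (fun t => spread t (gcell j' t)) w))).
    apply: eq_Ex => w; rewrite expr2 /Zbar /gmean -mulrA; congr (_ * _).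
    by rewrite big_distrl; apply: eq_bigr => j _ /=; rewrite mulrCA big_distrr.
  rewrite ExZ; last by apply: intg_sum => j _; apply: intgZ; apply: intg_sum => m _; exact: L2M.
  rewrite Ex_sum => [|j _]; last by apply: intgZ; apply: intg_sum => m _; exact: L2M.
  rewrite [RHS]/gmean; congr (_ * _); apply: eq_bigr => j _.
  rewrite ExZ; last by apply: intg_sum => m _; exact: L2M.
  rewrite Ex_sum => [|m _]; last exact: L2M.
  rewrite /gmean; congr (_ * _); apply: eq_bigr => j' _.
  rewrite covE; congr cov; apply/setP => t; rewrite !inE.
  by apply/eqP/eqP => [|->//]; exact: spread_inj.
rewrite -[leRHS](@gmean_cst _ _ C)//; apply: le_gmean_in => j jC.
apply: (@le_trans _ _ (gmean C (fun j' => \sum_(i < k) H i * (j i == j' i)%:R +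
  2 * V * \sum_(i < k) \sum_(i' < k | i' != i) ((j i == j' i) && (j i' == j' i'))%:R))).
  apply: le_gmean => j'; apply: le_trans (cov_upper _) _.
  rewrite le_eqVlt; apply/orP; left; apply/eqP; congr (_ + _ * _).
    by apply: eq_bigr => i _; rewrite inE.
  by apply: eq_bigr => i _; apply: eq_bigr => i' _; rewrite !inE.
rewrite gmeanD gmean_sum gmeanZ gmean_sum le_eqVlt; apply/orP; left; apply/eqP; congr (_ + _ * _).
  apply: eq_bigr => i _; rewrite gmeanZ -(gmean_coord1 C0 (jC i)); congr (_ * _).
  by apply: eq_gmean => j' _; rewrite eq_sym.
apply: eq_bigr => i _; rewrite gmean_sum; apply: eq_bigr => i' ii.
rewrite -(gmean_coord2 _ C0 (jC i) (jC i')) 1?eq_sym//.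
by apply: eq_gmean => j' _; rewrite eq_sym [j i' == _]eq_sym.
Qed.

(** The terms [H i / C i] of the three moments cancel: what is left is the excess [(V - H i) / M] of
    [zvar] and the pairs of cells with two common coordinates. *)
Lemma Zbar_S_dist : Ex P (fun w => (Zbar w - S w) ^+ 2) <=
  2 * V * k%:R / (n%:R * M%:R) + 2 * V * k%:R ^+ 2 / n%:R ^+ 2.
Proof.
have -> : Ex P (fun w => (Zbar w - S w) ^+ 2) =
   Ex P (fun w => Zbar w ^+ 2) - 2 * Ex P (fun w => Zbar w * S w) + Ex P (fun w => S w ^+ 2).
  have i1 := Zbar_L2.2; have i2 := L2M Zbar_L2 S_L2; have i3 := S_L2.2.
  rewrite -ExZ// -ExB//; last exact: intgZ.
  rewrite -ExD//; last by apply: intgB => //; exact: intgZ.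
  by apply: eq_Ex => w; ring.
rewrite ZbarS_Ex S_Ex2.
apply: le_trans (lerD (lerD Zbar_Ex2 (lexx _)) (lexx _)) _.
have nn0 : 0 < n%:R :> R by rewrite ltr0n.
have Mp : 0 < M%:R :> R by rewrite ltr0n.
have Cinv i : (C i)%:R^-1 <= n%:R^-1 :> R by rewrite lef_pV2 ?posrE ?ltr0n ?ler_nat.
have h1 : \sum_(i < k) zvar i / (C i)%:R - \sum_(i < k) H i / (C i)%:R <= 2 * V * k%:R / (n%:R * M%:R).
  rewrite -sumrB; apply: (@le_trans _ _ (\sum_(i < k) 2 * V / M%:R / n%:R)).
    apply: ler_sum => i _; rewrite -mulrBl /zvar addrC addKr.
    have HV : V - H i <= 2 * V by have := cov_le [set i]%SET; rewrite ler_norml /H => /andP[]; lra.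
    have HV' : 0 <= V - H i by have := cov_le [set i]%SET; rewrite ler_norml /H => /andP[]; lra.
    apply: ler_pM; rewrite ?invr_ge0//; first by rewrite divr_ge0// ltW.
    by rewrite ler_pM2r// invr_gt0.
  rewrite sumr_const card_ord -[_ *+ _]mulr_natr le_eqVlt; apply/orP; left; apply/eqP.
  by field; rewrite !gt_eqF.
have h2 : 2 * V * \sum_(i < k) \sum_(i' < k | i' != i) (C i)%:R^-1 * (C i')%:R^-1 <= 2 * V * k%:R ^+ 2 / n%:R ^+ 2.
  rewrite -[leRHS]mulrA; apply: ler_wpM2l; first by rewrite mulr_ge0.
  apply: (@le_trans _ _ (\sum_(i < k) \sum_(i' < k) n%:R^-1 * n%:R^-1)).
    apply: ler_sum => i _; rewrite [leRHS](bigID (fun i' => i' != i))/= -[leLHS]addr0.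
    apply: lerD; last by apply: sumr_ge0 => i' _; rewrite mulr_ge0 ?invr_ge0.
    by apply: ler_sum => i' _; apply: ler_pM; rewrite ?invr_ge0.
  rewrite !sumr_const !card_ord -mulrnA -[X in X <= _]mulr_natl natrM le_eqVlt; apply/orP; left; apply/eqP.
  by field; rewrite gt_eqF.
lra.
Qed.

(** All coordinates of the groups before [g] are at most [g * M] and those of group [g] are larger:
    block independence applies at the corner [g * M]. *)
Lemma zeta_partial_indep g : indep P (fun w => \sum_(h < g) Num.sqrt n%:R * (gweight h * zeta h w))
  (fun w => Num.sqrt n%:R * (gweight g * zeta g w)).
Proof.
have ind := @block_indep _ _ _ P k l Ycal N Y mN mY YY bind (fun=> (g * M)%N)
  ('I_g * 'I_M)%type 'I_M (fun hm => gcells hm.1 hm.2) (fun m => gcells g m).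
pose f1 (x : arr Ycal ('I_g * 'I_M)%type) : R :=
  \sum_(h < g) Num.sqrt n%:R * (gweight h * (M%:R^-1 * \sum_(m < M) cfun u (x (h, m)))).
pose f2 (x : arr Ycal 'I_M) : R :=
  Num.sqrt n%:R * (gweight g * (M%:R^-1 * \sum_(m < M) cfun u (x m))).
have m1 : measurable_fun setT f1.
  apply: measurable_sum => h; do 3 apply: measurable_funM => //.
  by apply: measurable_sum => m; exact: arr_cfun_measurable.
have m2 : measurable_fun setT f2.
  do 3 apply: measurable_funM => //.
  by apply: measurable_sum => m; exact: arr_cfun_measurable.
apply: (indep_comp m1 m2 (ind _ _)).
- move=> [h m] t; rewrite /gcells /=; case: ifP => _; have := ltn_ord h; have := ltn_ord m; nia.
- by move=> m t; rewrite /gcells; case: ifP => _; lia.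
Qed.

Definition clt_err : R := \sum_(i < k) n%:R / (C i)%:R *
  (2 * small_moment P (zeta i) (Num.sqrt n%:R / (C i)%:R) + n%:R / (C i)%:R ^+ 2 * zvar i ^+ 2).

Lemma S_charf b : `|Ex P (fun w => cos (b + Num.sqrt n%:R * S w)) -
  cos b * expR (- \sum_(i < k) (n%:R / (C i)%:R) * zvar i / 2)| <= 2 * clt_err.
Proof.
have sqn : Num.sqrt n%:R ^+ 2 = n%:R :> R by rewrite sqr_sqrtr.
pose X g w := Num.sqrt n%:R * (gweight g * zeta g w).
pose s g : R := Num.sqrt n%:R * gweight g.
pose v g : R := s g ^+ 2 * zvar (gidx g) / 2.
pose e g : R := s g ^+ 2 * (2 * small_moment P (zeta g) (s g) + s g ^+ 2 * zvar (gidx g) ^+ 2).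
have Xs g : X g = (fun w => s g * zeta g w) by apply/funext => w; rewrite /X /s mulrA.
have := @charf_indep_sum _ _ _ P X v e G.
have -> : \sum_(g < G) v g = \sum_(i < k) (n%:R / (C i)%:R) * zvar i / 2.
  rewrite (eq_bigr (fun i : 'I_k => (n%:R * zvar i / 2) / (C i)%:R)); last by move=> i _; ring.
  rewrite -(sum_gweight (fun i : 'I_k => n%:R * zvar i / 2)); apply: eq_bigr => g _.
  by rewrite /v /s exprMn sqn; ring.
have -> : \sum_(g < G) e g = clt_err.
  rewrite /clt_err (eq_bigr (fun i : 'I_k => n%:R * (2 * small_moment P (zeta i) (Num.sqrt n%:R / (C i)%:R) +
      n%:R / (C i)%:R ^+ 2 * zvar i ^+ 2) / (C i)%:R)); last by move=> i _; ring.
  rewrite -(sum_gweight (fun i : 'I_k => n%:R * (2 * small_moment P (zeta i) (Num.sqrt n%:R / (C i)%:R) +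
      n%:R / (C i)%:R ^+ 2 * zvar i ^+ 2))); apply: eq_bigr => g _.
  rewrite /e /s !exprMn sqn zeta_small /gweight; case: ifP => _; last by rewrite expr0n/= !(mulr0, mul0r).
  by rewrite exprVn; ring.
move=> /(_ _ _ _ _ _ b) h.
have -> : (fun w => cos (b + Num.sqrt n%:R * S w)) = (fun w => cos (b + \sum_(g < G) X g w)).
  by apply/funext => w; rewrite /S mulr_sumr.
apply: h => [g|g _|g|g _|g _].
- by rewrite Xs; apply: measurable_funM => //; exact: (zetaL2 g).1.
- exact: zeta_partial_indep.
- by apply: divr_ge0 => //; apply: mulr_ge0; [exact: sqr_ge0|exact: zvar_ge0].
- by rewrite Xs /v /e -zeta_Ex2; have [] := charf_taylor (s g) (zetaL2 g) (zeta_Ex g).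
- by rewrite Xs /v /e -zeta_Ex2; have [] := charf_taylor (s g) (zetaL2 g) (zeta_Ex g).
Qed.

(** [n] times the squared distance between grid average and group sum keeps a term of order [1 / M]
    that does not vanish with [n]; this forces the separate parameter [M]. *)
Lemma clt_approx b : `|Ex P (fun w => cos (b + Num.sqrt n%:R * gmean C (fun j => Z j w))) -
  cos b * expR (- \sum_(i < k) (n%:R / (C i)%:R) * zvar i / 2)| <=
  Num.sqrt (2 * V * k%:R / M%:R + 2 * V * k%:R ^+ 2 / n%:R) + 2 * clt_err.
Proof.
have nn0 : 0 < n%:R :> R by rewrite ltr0n.
have Mp : 0 < M%:R :> R by rewrite ltr0n.
have mcb (f : T -> R) : measurable_fun setT f ->
    measurable_fun setT (fun w => b + Num.sqrt n%:R * f w).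
  by move=> mf; apply: measurable_funD => //; apply: measurable_funM.
(* Only the law of the grid average enters, and moving the cells by [spread] does not change it. *)
have -> : Ex P (fun w => cos (b + Num.sqrt n%:R * gmean C (fun j => Z j w))) =
   Ex P (fun w => cos (b + Num.sqrt n%:R * Zbar w)).
  pose I := {dffun forall i : 'I_k, 'I_(C i)}.
  pose g (x : arr Ycal I) : R := cos (b + Num.sqrt n%:R * ((PiC C)%:R^-1 * \sum_(j : I) cfun u (x j))).
  have [||||_] := @exch_Ex _ _ _ P k l Ycal N Y mN mY YY exch I (fun j => gcell j)
     (fun j => (fun t => spread t (gcell j t))) spread g.
  - exact: spread_inj.
  - by [].
  - apply: (measurableT_comp measurable_cos); apply: measurable_funD => //.
    do 2 apply: measurable_funM => //.
    by apply: measurable_sum => j; exact: arr_cfun_measurable.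
  - apply: cos_intg; apply: mcb; apply: measurable_funM => //.
    by apply: measurable_sum => j; exact: (ZL2 (gcell j)).1.
  exact: esym.
have mZ := Zbar_L2.1; have mS := S_L2.1.
rewrite (_ : _ - _ = (Ex P (fun w => cos (b + Num.sqrt n%:R * Zbar w)) -
   Ex P (fun w => cos (b + Num.sqrt n%:R * S w))) +
   (Ex P (fun w => cos (b + Num.sqrt n%:R * S w)) -
   cos b * expR (- \sum_(i < k) n%:R / (C i)%:R * zvar i / 2))); last by ring.
apply: le_trans (ler_normD _ _) _; apply: lerD; last exact: S_charf.
rewrite -ExB; [|exact: cos_intg (mcb _ mZ)|exact: cos_intg (mcb _ mS)].
have ib : intg P (fun w => cos (b + Num.sqrt n%:R * Zbar w) - cos (b + Num.sqrt n%:R * S w)).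
  by apply: intgB; apply: cos_intg; apply: mcb.
apply: le_trans (Ex_norm ib) _.
have dL2 : L2 P (fun w => Num.sqrt n%:R * (Zbar w - S w)).
  by apply: L2Z; apply: L2B; [exact: Zbar_L2|exact: S_L2].
apply: (@le_trans _ _ (Ex P (fun w => `|Num.sqrt n%:R * (Zbar w - S w)|))).
  apply: le_Ex => [||w]; [exact: intg_norm|exact: intg_norm (L2_intg dL2)|].
  apply: le_trans (cos_lip _ _) _.
  by rewrite (_ : _ - _ = Num.sqrt n%:R * (Zbar w - S w))//; ring.
apply: Ex_norm_le => //.
have sq0 : 0 <= 2 * V * k%:R / M%:R + 2 * V * k%:R ^+ 2 / n%:R.
  have V2 : 0 <= 2 * V by apply: mulr_ge0.
  by apply: addr_ge0; apply: divr_ge0 => //; apply: mulr_ge0 => //; exact: sqr_ge0.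
rewrite sqr_sqrtr//.
have -> : Ex P (fun w => (Num.sqrt n%:R * (Zbar w - S w)) ^+ 2) = n%:R * Ex P (fun w => (Zbar w - S w) ^+ 2).
  rewrite -ExZ; last by have [] : L2 P (fun w => Zbar w - S w) by apply: L2B; [exact: Zbar_L2|exact: S_L2].
  by apply: eq_Ex => w; rewrite exprMn sqr_sqrtr.
apply: le_trans (ler_wpM2l (ltW nn0) Zbar_S_dist) _.
rewrite le_eqVlt; apply/orP; left; apply/eqP; field.
by rewrite !gt_eqF.
Qed.

End FixedGrid.
End FixedBlock.
End CLT.

(** * Passage to the limit along the observed designs *)

Section NatLimits.
Context {R : realType}.

Lemma inv_nat_cvg0 (f : nat -> nat) : (forall M : nat, \forall n \near \oo, (M <= f n)%N) ->
  ((f n)%:R^-1 : R) @[n --> \oo] --> (0 : R).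
Proof.
move=> fy; apply/cvgrPdist_le => e e0.
have := fy (Num.truncn e^-1).+1; apply: filterS => n hn.
rewrite sub0r normrN ger0_norm ?invr_ge0// -[leRHS]invrK.
rewrite lef_pV2 ?posrE ?invr_gt0 ?ltr0n//; last exact: leq_trans hn.
by apply: (le_trans (ltW (truncnS_gt _))); rewrite ler_nat.
Qed.

Lemma cvg_sum (I : Type) (r : seq I) (Q : pred I) (U : Type) (F : set_system U)
    {FF : Filter F} (f : I -> U -> R) (a : I -> R) :
  (forall i, Q i -> f i x @[x --> F] --> a i) ->
  \sum_(i <- r | Q i) f i x @[x --> F] --> \sum_(i <- r | Q i) a i.
Proof. by move=> fa; apply: cvg_big => //; exact: add_continuous. Qed.

Lemma Cmin_le k (C : cell k) i : (Cmin C <= C i)%N.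
Proof.
rewrite /Cmin; move: (\max_(_ < _) _)%N => x.
suff : forall s : seq 'I_k, i \in s -> (\big[minn/x]_(i <- s) C i <= C i)%N.
  by apply; rewrite mem_index_enum.
elim=> // j s IH; rewrite inE big_cons => /predU1P[->|/IH]; first exact: geq_minl.
by move=> h; apply: leq_trans h; exact: geq_minr.
Qed.

End NatLimits.

Section CLTLimit.
Context {R : realType} {d} {T : measurableType d} (P : probability T R).
Context {k l : nat} (Ycal : set 'rV[R]_l).
Context (N : cell k -> T -> nat) (Y : cell k -> nat -> T -> 'rV[R]_l).
Hypothesis mN : forall j n, measurable [set w | N j w = n].
Hypothesis mY : forall j ell s, measurable_fun setT (fun w => Y j ell w ord0 s).
Hypothesis YY : forall j ell w, Ycal (Y j ell w).
Hypothesis exch : sep_exchangeable P N Y.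
Hypothesis bind : block_independent P N Y.
Hypothesis k0 : (0 < k)%N.
Variables (Cs : nat -> cell k) (lam : 'I_k -> R).
Hypothesis Cy : forall M : nat, \forall n \near \oo, (M <= Cmin (Cs n))%N.
Hypothesis Clam : forall i, ((Cmin (Cs n))%:R / (Cs n i)%:R : R) @[n --> \oo] --> lam i.

Lemma clt_limit (u : 'rV[R]_l -> R) (bu : borel_fun_on Ycal u)
    (u2 : L2 P (cellf N Y u (cell1 k))) (u0 : Ex P (cellf N Y u (cell1 k)) = 0) (b : R) :
  Ex P (fun w => cos (b + Num.sqrt (Cmin (Cs n))%:R * gmean (Cs n) (fun j => cellf N Y u j w)))
    @[n --> \oo] -->
  cos b * expR (- \sum_(i < k) lam i * Ex P (fun w => cellf N Y u (cell1 k) w * cellf N Y u (cell2 i) w) / 2).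
Proof.
pose V := cov_pattern P N Y u [set: 'I_k]%SET.
pose H i := cov_pattern P N Y u [set i]%SET.
pose c n : R := (Cmin (Cs n))%:R.
have Ciy i (M : nat) : \forall n \near \oo, (M <= Cs n i)%N.
  by apply: filterS (Cy M) => n h; apply: leq_trans h (Cmin_le _ _).
have ci0 : (c n)^-1 @[n --> \oo] --> (0 : R) by exact: inv_nat_cvg0.
have Cii0 i : ((Cs n i)%:R^-1 : R) @[n --> \oo] --> (0 : R) by exact: inv_nat_cvg0.
pose zv M i := zvar P N Y u M i.
pose target : R := cos b * expR (- \sum_(i < k) lam i * H i / 2).
have -> : cos b * expR (- \sum_(i < k) lam i * Ex P (fun w => cellf N Y u (cell1 k) w * cellf N Y u (cell2 i) w) / 2) = target.
  congr (_ * expR (- _)); apply: eq_bigr => i _; congr (_ * _ / _).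
  by rewrite -cov_pattern_set1.
pose mid M n : R := cos b * expR (- \sum_(i < k) (c n / (Cs n i)%:R) * zv M i / 2).
pose midM M : R := cos b * expR (- \sum_(i < k) lam i * zv M i / 2).
(* For fixed [M] the error [r M n] converges to [rM M], and [rM M] tends to 0: [M] is chosen before
   [n]. *)
pose r M n : R := Num.sqrt (2 * V * k%:R / M%:R + 2 * V * k%:R ^+ 2 / c n) +
   2 * clt_err P N Y k0 u M (Cs n) (Cmin (Cs n)) + `|mid M n - target|.
pose rM M : R := Num.sqrt (2 * V * k%:R / M%:R) + `|midM M - target|.
have expc : continuous (@expR R) by exact: continuous_expR.
have cvg_exp (U : Type) (F : set_system U) (FF : Filter F) (f : 'I_k -> U -> R) (g h : 'I_k -> R) :
    (forall i, f i x @[x --> F] --> g i) ->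
    cos b * expR (- \sum_(i < k) f i x) @[x --> F] --> cos b * expR (- \sum_(i < k) g i).
  move=> fg; apply: cvgM; first exact: cvg_cst.
  apply: (@continuous_cvg _ _ _ F FF (fun x => - \sum_(i < k) f i x) expR); first exact: expc.
  apply: cvgN; apply: cvg_sum => i _; exact: fg.
have midc M : mid M n @[n --> \oo] --> midM M.
  apply: cvg_exp => // i; apply: cvgM; last exact: cvg_cst.
  by apply: cvgM; [exact: Clam|exact: cvg_cst].
have rc M : (0 < M)%N -> r M n @[n --> \oo] --> rM M.
  move=> M0; rewrite /rM -[X in _ --> X + _]addr0; apply: cvgD; last first.
    by apply: cvg_norm; apply: cvgB; [exact: midc|exact: cvg_cst].
  apply: cvgD.
    apply: (@continuous_cvg _ _ _ _ _ (fun n => 2 * V * k%:R / M%:R + 2 * V * k%:R ^+ 2 / c n) (@Num.sqrt R)); first exact: sqrt_continuous.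
    rewrite -[X in _ --> X]addr0; apply: cvgD; first exact: cvg_cst.
    by rewrite -(mulr0 (2 * V * k%:R ^+ 2)); apply: cvgM; [exact: cvg_cst|exact: ci0].
  rewrite -[X in _ --> X](mulr0 2); apply: cvgM; first exact: cvg_cst.
  have -> : 0 = \sum_(i < k) lam i * (2 * 0 + (lam i * 0) * zv M i ^+ 2) :> R.
    by rewrite big1// => i _; rewrite !(mulr0, mul0r) addr0 mulr0.
  apply: cvg_sum => i _; apply: cvgM; first exact: Clam.
  apply: cvgD.
    apply: cvgM; first exact: cvg_cst.
    have zL : L2 P (zeta N Y k0 u M i).
      by apply: L2Z; apply: L2_sum => m _; exact (cellf_L2 mN mY YY exch bu u2 _).
    apply/cvgrPdist_le => e e0; have [s0 s00 hs0] := small_moment_cvg zL e0.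
    have /cvgrPdist_le/(_ (s0 ^+ 2) (exprn_gt0 _ s00)) := ci0.
    have := Cy 1; apply: filterS2 => n n0 hn.
    rewrite sub0r normrN ger0_norm; last first.
      by apply: Ex_ge0 => w; rewrite mulr_ge0 ?sqr_ge0// le_min ler01 normr_ge0.
    apply: hs0; rewrite ger0_norm ?divr_ge0//.
    have c0 : 0 < c n by rewrite ltr0n.
    have Ci0 : c n <= (Cs n i)%:R by rewrite ler_nat Cmin_le.
    (* As [c n <= C i], the scale [sqrt c / C i] of the Lindeberg term is at most [1 / sqrt c]. *)
    apply: (@le_trans _ _ (Num.sqrt (c n)^-1)).
      rewrite ler_pdivrMr; last exact: lt_le_trans Ci0.
      apply: (@le_trans _ _ (Num.sqrt (c n)^-1 * c n)); last by rewrite ler_wpM2l// sqrtr_ge0.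
      have e1 : Num.sqrt (c n)^-1 * c n = Num.sqrt (c n).
        rewrite sqrtrV ?ltW// -{2}(sqr_sqrtr (ltW c0)) expr2 mulKf//.
        by rewrite gt_eqF// sqrtr_gt0.
      by rewrite e1.
    rewrite -[leRHS](ger0_norm (ltW s00)) -sqrtr_sqr ler_wsqrtr//.
    by move: hn; rewrite sub0r normrN; apply: le_trans; exact: ler_norm.
  apply: cvgM; last exact: cvg_cst.
  rewrite (_ : (fun n => _) = (fun n => (c n / (Cs n i)%:R) * (Cs n i)%:R^-1)); last first.
    by apply/funext => n; rewrite expr2 invfM mulrA.
  by apply: cvgM; [exact: Clam|exact: Cii0].
have Minv : (M%:R^-1 : R) @[M --> \oo] --> (0 : R).
  by apply: (@inv_nat_cvg0 _ id) => M; exists M.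
have rMc : rM M @[M --> \oo] --> (0 : R).
  rewrite /rM -[X in _ --> X]addr0; apply: cvgD.
    rewrite -(sqrtr0 R) -[X in _ --> Num.sqrt X](mulr0 (2 * V * k%:R)).
    apply: (@continuous_cvg _ _ _ _ _ (fun M : nat => 2 * V * k%:R / M%:R) (@Num.sqrt R)); first exact: sqrt_continuous.
    by apply: cvgM; [exact: cvg_cst|exact: Minv].
  rewrite -[X in _ --> X](@normr0 _ R) -(subrr target); apply: cvg_norm; apply: cvgB; last exact: cvg_cst.
  apply: cvg_exp => // i; apply: cvgM; last exact: cvg_cst.
  apply: cvgM; first exact: cvg_cst.
  rewrite /zv /zvar -[X in _ --> X]addr0; apply: cvgD; first exact: cvg_cst.
  rewrite -(mulr0 (V - H i)); apply: cvgM; [exact: cvg_cst|exact: Minv].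
apply/cvgrPdist_le => e e0.
have /cvgrPdist_lt/(_ _ e0)[M0 _ hM] := rMc.
pose M := M0.+1.
have rMe : rM M < e.
  have := hM M (leqnSn _); rewrite /= sub0r normrN; apply: le_lt_trans; exact: ler_norm.
have /cvgrPdist_lt/(_ (e - rM M)) := rc M isT.
rewrite subr_gt0 => /(_ rMe) h.
near=> n.
have nr : r M n <= e.
  have : `|rM M - r M n| < e - rM M by near: n.
  rewrite distrC => /(le_lt_trans (ler_norm _)); lra.
apply: le_trans nr; rewrite distrC.
have n1 : (1 <= Cmin (Cs n))%N by near: n; exact: (Cy 1).
rewrite (_ : _ - target = (Ex P (fun w => cos (b + Num.sqrt (Cmin (Cs n))%:R * gmean (Cs n) (fun j => cellf N Y u j w))) - mid M n) + (mid M n - target)); last by ring.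
apply: le_trans (ler_normD _ _) _; apply: lerD => //.
exact: (clt_approx mN mY YY exch bind k0 bu u2 u0 (isT : 0 < M)%N n1 (Cmin_le (Cs n)) b).
Unshelve. all: by end_near.
Qed.

End CLTLimit.

(** * Maximal inequalities *)

Section FiniteMax.
Context {R : realType} {I : eqType}.
Implicit Types (s : seq I) (f g : I -> R).

(** Finite lists keep the maximum measurable; the initial value 0 settles the empty list. *)
Definition bmax s f : R := \big[Num.max/0]_(i <- s) `|f i|.

Lemma bmax_ge0 s f : 0 <= bmax s f.
Proof.
rewrite /bmax; elim: s => [|i s IH]; first by rewrite big_nil.
by rewrite big_cons le_max IH orbT.
Qed.

Lemma le_bmax s f i : i \in s -> `|f i| <= bmax s f.
Proof.
rewrite /bmax; elim: s => // j s IH; rewrite inE big_cons le_max => /predU1P[->|/IH ->].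
  by rewrite lexx.
by rewrite orbT.
Qed.

Lemma bmax_le s f c : 0 <= c -> (forall i, i \in s -> `|f i| <= c) -> bmax s f <= c.
Proof.
move=> c0; rewrite /bmax; elim: s => [|i s IH] fc; first by rewrite big_nil.
rewrite big_cons ge_max fc ?mem_head// IH// => j js.
by apply: fc; rewrite inE js orbT.
Qed.

Lemma bmax_sum s f : bmax s f <= \sum_(i <- s) `|f i|.
Proof.
apply: bmax_le => [|i si]; first by apply: sumr_ge0.
by rewrite (big_rem i)//= lerDl sumr_ge0.
Qed.

Lemma eq_bmax s f g : (forall i, i \in s -> f i = g i) -> bmax s f = bmax s g.
Proof. by move=> fg; apply: eq_big_seq => i si; rewrite fg. Qed.

Lemma bmaxD s f g : bmax s (fun i => f i + g i) <= bmax s f + bmax s g.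
Proof.
apply: bmax_le => [|i si]; first by rewrite addr_ge0 ?bmax_ge0.
by apply: le_trans (ler_normD _ _) _; apply: lerD; exact: le_bmax.
Qed.

Lemma bmaxZ s c f : bmax s (fun i => c * f i) <= `|c| * bmax s f.
Proof.
apply: bmax_le => [|i si]; first by rewrite mulr_ge0 ?bmax_ge0.
by rewrite normrM ler_wpM2l// le_bmax.
Qed.

Lemma bmax_bigsum (J : Type) (r : seq J) s (f : J -> I -> R) :
  bmax s (fun i => \sum_(j <- r) f j i) <= \sum_(j <- r) bmax s (f j).
Proof.
apply: bmax_le => [|i si]; first by apply: sumr_ge0 => j _; exact: bmax_ge0.
apply: le_trans (ler_norm_sum _ _ _) _; apply: ler_sum => j _; exact: le_bmax.
Qed.

Lemma bmax_measurable {d} {T : measurableType d} s (f : I -> T -> R) :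
  (forall i, i \in s -> measurable_fun setT (f i)) ->
  measurable_fun setT (fun w => bmax s (fun i => f i w)).
Proof.
elim: s => [|i s IH] mf.
  have -> : (fun w => bmax [::] (fun i => f i w)) = cst 0.
    by apply/funext => w; rewrite /bmax big_nil.
  exact: measurable_cst.
rewrite (_ : (fun w => _) = (fun w => Num.max `|f i w| (bmax s (fun i => f i w)))); last first.
  by apply/funext => w; rewrite /bmax big_cons.
apply: measurable_maxr.
  by apply: measurableT_comp => //; apply: mf; rewrite mem_head.
by apply: IH => j js; apply: mf; rewrite inE js orbT.
Qed.

Lemma bmax_L2 {d} {T : measurableType d} (P : probability T R) s (f : I -> T -> R) :
  (forall i, i \in s -> L2 P (f i)) -> L2 P (fun w => bmax s (fun i => f i w)).
Proof.
move=> f2; apply: (@L2_le _ _ _ P _ (fun w => \sum_(i <- s | i \in s) `|f i w|)).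
- by apply: bmax_measurable => i si; exact: (f2 i si).1.
- by apply: L2_sum => i si; apply: L2_norm; exact: f2.
- move=> w; rewrite -big_seq ger0_norm ?bmax_ge0// ger0_norm; first exact: bmax_sum.
  exact: sumr_ge0.
Qed.

End FiniteMax.

(** * Exponential bounds for random signs *)

Section Rademacher.
Context {R : realType}.

(** The constant 2 instead of the sharp 1/2 leaves room for elementary estimates: quadratic bounds
    of both exponentials for [x <= 1/2], and [x <= 2 x^2] beyond. *)
Lemma cosh_le (x : R) : (expR x + expR (- x)) / 2 <= expR (2 * x ^+ 2).
Proof.
wlog x0 : x / 0 <= x.
  move=> h; have [|/ltW x0] := leP 0 x; first exact: h.
  by have := h (- x); rewrite oppr_ge0 opprK sqrrN addrC; apply.
have e1 := expR_ge1Dx (2 * x ^+ 2).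
have [x2|x2] := leP x 2^-1; last first.
  have h1 : expR x <= expR (2 * x ^+ 2) by rewrite ler_expR; nra.
  have h2 : expR (- x) <= expR x by rewrite ler_expR; lra.
  lra.
have hN : expR (- x) <= 1 - x + x ^+ 2.
  have := @expR_taylor1 R x x0; rewrite ler_norml => /andP[_]; lra.
have hP : expR x <= 1 + x + 2 * x ^+ 2.
  have p : 0 < 1 - x by lra.
  have : expR x <= (1 - x)^-1.
    rewrite -[x in expR x]opprK expRN lef_pV2 ?posrE ?expR_gt0//.
    exact: expR_ge1Dx.
  move=> h; apply: le_trans h _; rewrite -[leLHS]mul1r ler_pdivrMr//.
  by have := sqr_ge0 x; nra.
have := sqr_ge0 x; lra.
Qed.

Lemma rademacher_exp (n : nat) (a : 'I_n -> R) :
  \sum_(e : {ffun 'I_n -> bool}) expR (\sum_(r < n) (-1) ^+ (e r) * a r)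
  <= 2 ^+ n * expR (2 * \sum_(r < n) a r ^+ 2).
Proof.
have -> : \sum_(e : {ffun 'I_n -> bool}) expR (\sum_(r < n) (-1) ^+ (e r) * a r) =
    \prod_(r < n) \sum_(b : bool) expR ((-1) ^+ b * a r).
  by rewrite bigA_distr_bigA; apply: eq_bigr => e _; rewrite expR_sum.
rewrite mulr_sumr expR_sum -[n in 2 ^+ n]card_ord -prodr_const -big_split /=.
apply: ler_prod => r _; rewrite sumr_ge0/= => [|b _]; last exact: expR_ge0.
rewrite big_bool/= expr1 expr0 mul1r mulN1r.
by have := cosh_le (a r); rewrite addrC ler_pdivrMr// mulrC.
Qed.

(** Since [1 + x <= expR x], [lm * |S| - lK + 1] is at most the sum [Ee] of all exponentials times
    [expR (- lK)], and [lK] is the logarithm of the bound on the mean of [Ee]. This stands in for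
    Jensen's inequality; [lm] stays free for later optimization. *)
Lemma rademacher_max {I : eqType} (s : seq I) (n : nat) (a : 'I_n -> I -> R)
    (b : 'I_n -> R) (lm : R) :
  (0 < size s)%N -> 0 < lm -> (forall r i, i \in s -> `|a r i| <= b r) ->
  \sum_(e : {ffun 'I_n -> bool}) bmax s (fun i => \sum_(r < n) (-1) ^+ (e r) * a r i)
  <= 2 ^+ n * (ln (2 * (size s)%:R) / lm + 2 * lm * \sum_(r < n) b r ^+ 2).
Proof.
move=> s0 lm0 ab; set B := \sum_(r < n) _.
set J : R := (size s)%:R; have J0 : 0 < J by rewrite ltr0n.
pose lK := ln (2 * J) + 2 * lm ^+ 2 * B.
pose S (e : {ffun 'I_n -> bool}) i := \sum_(r < n) (-1) ^+ (e r) * a r i.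
pose Ee e := \sum_(i <- s) (expR (lm * S e i) + expR (- (lm * S e i))).
have pointwise e i : i \in s -> `|S e i| <= lm^-1 * (lK + (Ee e * expR (- lK) - 1)).
  move=> si; rewrite ler_pdivlMl//.
  have h1 := expR_ge1Dx (lm * `|S e i| - lK).
  have h2 : expR (lm * `|S e i|) <= Ee e.
    rewrite /Ee (big_rem i)//=; apply: (@le_trans _ _ (expR (lm * S e i) + expR (- (lm * S e i)))).
      case: (leP 0 (S e i)) => Si; rewrite ?(ger0_norm Si) ?(ltr0_norm Si) ?mulrN.
        by rewrite lerDl expR_ge0.
      by rewrite lerDr expR_ge0.
    by rewrite lerDl; apply: sumr_ge0 => j _; rewrite addr_ge0 ?expR_ge0.
  have h3 : expR (lm * `|S e i| - lK) <= Ee e * expR (- lK).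
    by rewrite expRD ler_wpM2r// expR_ge0.
  lra.
have [i0 i0s] : exists i0, i0 \in s by case: (s) s0 => // i ? _; exists i; rewrite mem_head.
apply: (@le_trans _ _ (\sum_(e : {ffun 'I_n -> bool}) lm^-1 * (lK + (Ee e * expR (- lK) - 1)))).
  apply: ler_sum => e _; apply: bmax_le => [|i si]; last exact: pointwise.
  exact: le_trans (normr_ge0 _) (pointwise e i0 i0s).
have cardE : #|{ffun 'I_n -> bool}|%:R = 2 ^+ n :> R.
  by rewrite card_ffun card_bool card_ord natrX.
have sumE : \sum_(e : {ffun 'I_n -> bool}) Ee e <= 2 ^+ n * (2 * J * expR (2 * lm ^+ 2 * B)).
  rewrite /Ee exchange_big /=.
  have term i (c : R) : i \in s -> c ^+ 2 = lm ^+ 2 ->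
      \sum_(e : {ffun 'I_n -> bool}) expR (c * S e i) <= 2 ^+ n * expR (2 * lm ^+ 2 * B).
    move=> si c2; have := rademacher_exp (fun r => c * a r i).
    under eq_bigr => e _ do
      (under eq_bigr => r _ do rewrite mulrCA; rewrite -mulr_sumr).
    move=> h; apply: le_trans h _; rewrite ler_wpM2l// ler_expR -mulrA ler_wpM2l//.
    rewrite /B mulr_sumr; apply: ler_sum => r _; rewrite exprMn c2 ler_wpM2l ?sqr_ge0//.
    rewrite -(real_normK (num_real (a r i))) lerXn2r ?nnegrE//; last exact: ab.
    exact: le_trans (normr_ge0 _) (ab r i si).
  apply: (@le_trans _ _ (\sum_(i <- s) 2 * (2 ^+ n * expR (2 * lm ^+ 2 * B)))).
    rewrite big_seq [leRHS]big_seq; apply: ler_sum => i si; rewrite big_split/= mulr2n mulrDl mul1r.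
    apply: lerD; first exact: term.
    under eq_bigr => e _ do rewrite -mulNr.
    by apply: term => //; rewrite sqrrN.
  rewrite big_const_seq count_predT iter_addr_0 -mulr_natl -/J le_eqVlt; apply/orP; left.
  by apply/eqP; ring.
have KE : expR (2 * lm ^+ 2 * B) * expR (- lK) = (2 * J)^-1.
  rewrite -expRD /lK opprD addrCA subrr addr0 expRN lnK// posrE.
  exact: mulr_gt0.
rewrite -mulr_sumr big_split/= sumrB -mulr_suml !sumr_const.
rewrite -[lK *+ _]mulr_natl -[1 *+ _]mulr_natl mulr1 cardE.
have h : (\sum_(e : {ffun 'I_n -> bool}) Ee e) * expR (- lK) <= 2 ^+ n.
  apply: le_trans (ler_wpM2r (expR_ge0 _) sumE) _.
  rewrite (_ : _ * expR (- lK) = 2 ^+ n * (2 * J * (expR (2 * lm ^+ 2 * B) * expR (- lK)))); last by ring.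
  rewrite KE divff ?mulr1//.
  by rewrite gt_eqF//; exact: mulr_gt0.
have -> : 2 ^+ n * (ln (2 * J) / lm + 2 * lm * B) = lm^-1 * (2 ^+ n * lK).
  by rewrite /lK; field; rewrite gt_eqF.
by apply: ler_wpM2l; [rewrite invr_ge0 ltW|lra].
Qed.

End Rademacher.

(** * Averages along diagonals of the grid *)

Section Diagonals.
Context {R : realType} {d} {T : measurableType d} (P : probability T R).
Context {k l : nat} (Ycal : set 'rV[R]_l).
Context (N : cell k -> T -> nat) (Y : cell k -> nat -> T -> 'rV[R]_l).
Hypothesis mN : forall j n, measurable [set w | N j w = n].
Hypothesis mY : forall j ell s, measurable_fun setT (fun w => Y j ell w ord0 s).
Hypothesis YY : forall j ell w, Ycal (Y j ell w).
Hypothesis exch : sep_exchangeable P N Y.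
Hypothesis bind : block_independent P N Y.
Hypothesis k0 : (0 < k)%N.

Local Notation pull := (pull Ycal N Y).
Local Notation cval := (nat * (nat -> 'rV[R]_l))%type.
Implicit Types (phi psi : cval -> R).

(** Functionals of the content of one cell, more general than [cfun u]: centring subtracts one
    constant per cell, which is not a sum over the observations of the cell. *)
Definition cmeas phi := measurable_fun setT (fun x : arr Ycal unit => phi (x tt)).
Definition cf phi (j : cell k) (w : T) : R := phi (N j w, fun e => Y j e w).

Lemma cmeas_arr phi (I : Type) (i : I) : cmeas phi ->
  measurable_fun setT (fun x : arr Ycal I => phi (x i)).
Proof.
move=> mphi; pose pr (x : arr Ycal I) : arr Ycal unit := fun _ => x i.
have mpr : measurable_fun setT pr.
  apply: (@measurability _ _ (arr Ycal I) (arr Ycal unit) setT pr (agen Ycal (I := unit)) erefl).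
  move=> _ [S [n [c [q [B [mB e]]]]] <-]; rewrite setTI; apply: sub_sigma_algebra.
  exists n, (fun=> i), q, B; split => //.
  have prE (x : arr Ycal I) : arange Ycal x -> arange Ycal (pr x) by move=> xE t ell; exact: xE.
  have acE (x : arr Ycal I) : acyl c q B (pr x) = acyl (fun=> i) q B x.
    by rewrite /acyl /= /acoord /pr.
  apply/seteqP; split => x /= [Sx xE]; split => //.
    have : (S `&` arange Ycal (I := unit)) (pr x) by split => //; exact: prE.
    by rewrite e => -[]; rewrite acE.
  have : (acyl c q B `&` arange Ycal (I := unit)) (pr x).
    by split; [rewrite acE|exact: prE].
  by rewrite -e => -[].
exact: (measurableT_comp mphi mpr).
Qed.

Lemma cmeas_cfun u : borel_fun_on Ycal u -> cmeas (cfun u).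
Proof. exact: arr_cfun_measurable. Qed.

Lemma cmeasB phi psi : cmeas phi -> cmeas psi -> cmeas (fun v => phi v - psi v).
Proof. exact: measurable_funB. Qed.

Lemma cmeas_cst c : cmeas (fun=> c).
Proof. exact: measurable_cst. Qed.

Lemma cf_measurable phi j : cmeas phi -> measurable_fun setT (cf phi j).
Proof.
move=> mp; have : cf phi j = (fun x : arr Ycal unit => phi (x tt)) \o pull (fun _ : unit => j) by [].
by move=> ->; apply: measurableT_comp => //; exact: pull_measurable.
Qed.

Lemma cf_law phi j (g : R -> R) : cmeas phi -> measurable_fun setT g ->
  intg P (g \o cf phi (cell1 k)) ->
  intg P (g \o cf phi j) /\ Ex P (g \o cf phi j) = Ex P (g \o cf phi (cell1 k)).
Proof.
move=> mp mg ig.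
apply: (@exch_Ex _ _ _ P k l Ycal N Y mN mY YY exch unit (fun=> cell1 k) (fun=> j)
  (fun i a => j i + a)%N (fun x => g (phi (x tt)))) => //.
- by move=> i; exact: addnI.
- by move=> _ t; rewrite addn0.
- exact: (measurableT_comp mg mp).
Qed.

Lemma cf_L2 phi j : cmeas phi -> L2 P (cf phi (cell1 k)) -> L2 P (cf phi j).
Proof.
move=> mp p2; split; first exact: cf_measurable.
by have [] := @cf_law phi j (fun x => x ^+ 2) mp (@exprn_measurable R setT 2) p2.2.
Qed.

Lemma cf_Ex phi j : cmeas phi -> L2 P (cf phi (cell1 k)) -> Ex P (cf phi j) = Ex P (cf phi (cell1 k)).
Proof. by move=> mp p2; have [] := @cf_law phi j id mp (@measurable_id _ _ _) (L2_intg p2). Qed.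

Lemma cf_Ex2 phi j : cmeas phi -> L2 P (cf phi (cell1 k)) ->
  Ex P (fun w => cf phi j w ^+ 2) = Ex P (fun w => cf phi (cell1 k) w ^+ 2).
Proof.
by move=> mp p2; have [] := @cf_law phi j (fun x => x ^+ 2) mp (@exprn_measurable R setT 2) p2.2.
Qed.

Definition dg (r : nat) : cell k := fun=> r.

Lemma dg_indep phi psi r r' : (r < r')%N -> cmeas phi -> cmeas psi ->
  L2 P (cf phi (cell1 k)) -> L2 P (cf psi (cell1 k)) ->
  Ex P (fun w => cf phi (dg r) w * cf psi (dg r') w) = Ex P (cf phi (cell1 k)) * Ex P (cf psi (cell1 k)).
Proof.
move=> rr mp mq p2 q2.
have h : indep P (pull (fun _ : unit => dg r)) (pull (fun _ : unit => dg r')).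
  exact: (block_indep mN mY YY bind (cc := dg r)).
rewrite -(cf_Ex (dg r) mp p2) -(cf_Ex (dg r') mq q2).
apply: indep_ExM; [exact: cf_L2|exact: cf_L2|exact (indep_comp mp mq h)].
Qed.

Lemma diag_sum_sq phi m K : cmeas phi -> L2 P (cf phi (cell1 k)) -> Ex P (cf phi (cell1 k)) = 0 ->
  Ex P (fun w => (\sum_(q < K) cf phi (dg (m + q)) w) ^+ 2) = K%:R * Ex P (fun w => cf phi (cell1 k) w ^+ 2).
Proof.
move=> mp p2 p0.
have L j : L2 P (cf phi j) by exact: cf_L2.
have -> : Ex P (fun w => (\sum_(q < K) cf phi (dg (m + q)) w) ^+ 2) =
   Ex P (fun w => \sum_(q < K) \sum_(q' < K) cf phi (dg (m + q)) w * cf phi (dg (m + q')) w).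
  by apply: eq_Ex => w; rewrite expr2 big_distrlr.
rewrite Ex_sum => [|q _]; last by apply: intg_sum => q' _; exact: L2M.
rewrite (eq_bigr (fun=> Ex P (fun w => cf phi (cell1 k) w ^+ 2))).
  by rewrite sumr_const card_ord mulr_natl.
move=> q _; rewrite Ex_sum => [|q' _]; last exact: L2M.
rewrite (bigD1 q)//= big1 ?addr0 => [|q' qq].
  by rewrite -(cf_Ex2 (dg (m + q)) mp p2); apply: eq_Ex => w; rewrite expr2.
have [lt|lt|/val_inj e] := ltngtP q q'; last by rewrite e eqxx in qq.
  by rewrite dg_indep ?p0 ?mul0r// ltn_add2l.
rewrite (@eq_Ex _ _ _ P _ (fun w => cf phi (dg (m + q')) w * cf phi (dg (m + q)) w)).
  by rewrite dg_indep ?p0 ?mul0r// ltn_add2l.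
by move=> w; rewrite mulrC.
Qed.

Section GridOfDiagonals.
Variables (C : cell k) (n : nat).
Hypotheses (n0 : (0 < n)%N) (nC : forall i, (n <= C i)%N).

Let C0 i : (0 < C i)%N. Proof. exact: leq_trans n0 (nC i). Qed.
Let nn0 : 0 < n%:R :> R. Proof. by rewrite ltr0n. Qed.

Definition dshift (s : cell k) (r : nat) : cell k := fun i => ((r + s i) %% C i)%N.

Lemma dshift_law (g : arr Ycal 'I_n -> R) s : measurable_fun setT g ->
  intg P (g \o pull (fun r => dg r)) ->
  intg P (g \o pull (fun r => dshift s r)) /\
  Ex P (g \o pull (fun r => dshift s r)) = Ex P (g \o pull (fun r => dg r)).
Proof.
move=> mg ig.
(* On the first [n] integers this is the cyclic shift, injective there because [n <= C i]; the other
   integers are sent beyond the grid. *)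
pose tau (i : 'I_k) (a : nat) : nat := if (a < n)%N then ((a + s i) %% C i)%N else (a + C i)%N.
apply: (@exch_Ex _ _ _ P k l Ycal N Y mN mY YY exch 'I_n (fun r => dg r)
  (fun r => dshift s r) tau g) => //.
- move=> i a b; rewrite /tau.
  case: (ltnP a n) => an; case: (ltnP b n) => bn; last by move/addIn.
  + move/eqP; rewrite eqn_modDr !modn_small ?(leq_trans an)// ?(leq_trans bn)//.
    by move/eqP.
  + by have := ltn_pmod (a + s i) (C0 i) => h e; move: h; rewrite e ltnNge leq_addl.
  + by have := ltn_pmod (b + s i) (C0 i) => h e; move: h; rewrite -e ltnNge leq_addl.
- by move=> r t; rewrite /tau /dg ltn_ord.
Qed.

Lemma gmean_center (F : cell k -> R) mu :
  Num.sqrt n%:R * (gmean C F - mu) =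
  gmean C (fun s => Num.sqrt n%:R * n%:R^-1 * \sum_(r < n) (F (dshift s r) - mu)).
Proof.
rewrite gmeanZ -mulrA -gmeanZ; congr (_ * _).
rewrite (gmean_diag F C0 n0).
have -> : gmean C (fun s => n%:R^-1 * \sum_(r < n) (F (dshift s r) - mu)) =
    gmean C (fun s => n%:R^-1 * \sum_(r < n) F (dshift s r) + - mu).
  apply: eq_gmean => s _; rewrite sumrB sumr_const card_ord -[mu *+ _]mulr_natl.
  by rewrite mulrBr mulKf// gt_eqF.
by rewrite gmeanD gmean_cst.
Qed.

Lemma gmean_sqr_le (f : cell k -> R) : (gmean C f) ^+ 2 <= gmean C (fun j => f j ^+ 2).
Proof.
have h : 0 <= gmean C (fun j => (f j - gmean C f) ^+ 2).
  rewrite -[X in X <= _](@gmean_cst _ _ C 0)//; apply: le_gmean => j; exact: sqr_ge0.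
have e : gmean C (fun j => (f j - gmean C f) ^+ 2) = gmean C (fun j => f j ^+ 2) - (gmean C f) ^+ 2.
  rewrite (@eq_gmean _ _ C _ (fun j => f j ^+ 2 + ((- 2 * gmean C f) * f j + gmean C f ^+ 2))).
    by rewrite gmeanD gmeanD gmeanZ gmean_cst//; ring.
  by move=> j _; ring.
by rewrite e subr_ge0 in h.
Qed.

(** By convexity the square of a mean over shifted diagonals is at most the mean of the squares, and
    each diagonal is a normalized sum of [n] independent centred cells. *)
Lemma grid_var phi : cmeas phi -> L2 P (cf phi (cell1 k)) ->
  Ex P (fun w => (Num.sqrt n%:R * (gmean C (fun j => cf phi j w) - Ex P (cf phi (cell1 k)))) ^+ 2)
  <= Ex P (fun w => cf phi (cell1 k) w ^+ 2).
Proof.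
move=> mp p2; set mu := Ex P (cf phi (cell1 k)).
have L j : L2 P (cf phi j) by exact: cf_L2.
pose psi v := phi v - mu.
have mpsi : cmeas psi by apply: cmeasB => //; exact: cmeas_cst.
have psi2 : L2 P (cf psi (cell1 k)) by apply: L2B => //; exact: L2_cst.
have psi0 : Ex P (cf psi (cell1 k)) = 0.
  by rewrite ExB ?Ex_cst ?subrr//; [exact: L2_intg|exact: intg_cst].
have Lpsi j : L2 P (cf psi j) by exact: cf_L2.
pose D (s : cell k) w := Num.sqrt n%:R * n%:R^-1 * \sum_(r < n) cf psi (dshift s r) w.
have DL s : L2 P (D s) by apply: L2Z; apply: L2_sum.
have D2 s : Ex P (fun w => D s w ^+ 2) = Ex P (fun w => cf psi (cell1 k) w ^+ 2).
  pose g (x : arr Ycal 'I_n) : R := (Num.sqrt n%:R * n%:R^-1 * \sum_(r < n) psi (x r)) ^+ 2.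
  have [||_] := @dshift_law g s.
  - apply: measurable_funX; apply: measurable_funM => //.
    by apply: measurable_sum => r; exact: cmeas_arr.
  - have [] : L2 P (fun w => Num.sqrt n%:R * n%:R^-1 * \sum_(r < n) cf psi (dg r) w) by apply: L2Z; apply: L2_sum.
    by [].
  move=> e; transitivity (Ex P (g \o pull (fun r : 'I_n => dg r))); first exact: e.
  have -> : Ex P (g \o pull (fun r : 'I_n => dg r)) =
    Ex P (fun w => (Num.sqrt n%:R * n%:R^-1) ^+ 2 * (\sum_(q < n) cf psi (dg (0 + q)) w) ^+ 2).
    by apply: eq_Ex => w; rewrite -exprMn.
  rewrite ExZ; last by have [] : L2 P (fun w => \sum_(q < n) cf psi (dg (0 + q)) w) by apply: L2_sum.
  rewrite diag_sum_sq// exprMn sqr_sqrtr ?ler0n// mulrA.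
  by rewrite (_ : _ * _ * n%:R = 1) ?mul1r//; field; rewrite gt_eqF.
apply: (@le_trans _ _ (Ex P (fun w => cf psi (cell1 k) w ^+ 2))).
  apply: (@le_trans _ _ (Ex P (fun w => gmean C (fun s => D s w ^+ 2)))).
    apply: le_Ex => [||w].
    - have [] : L2 P (fun w => Num.sqrt n%:R * (gmean C (fun j => cf phi j w) - mu)); last by [].
      by apply: L2Z; apply: L2B; [apply: L2Z; apply: L2_sum|exact: L2_cst].
    - by apply: intgZ; apply: intg_sum => j _; exact: (DL _).2.
    - by rewrite gmean_center; exact: gmean_sqr_le.
  rewrite ExZ; last by apply: intg_sum => j _; exact: (DL _).2.
  rewrite Ex_sum => [|j _]; last exact: (DL _).2.
  by rewrite (eq_bigr _ (fun j _ => D2 _)) -[X in X <= _]/(gmean C (fun=> Ex P (fun w => cf psi (cell1 k) w ^+ 2))) gmean_cst.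
have -> : Ex P (fun w => cf psi (cell1 k) w ^+ 2) = Ex P (fun w => cf phi (cell1 k) w ^+ 2) - mu ^+ 2.
  have i1 := L2_intg p2.
  rewrite (@eq_Ex _ _ _ P _ (fun w => cf phi (cell1 k) w ^+ 2 - 2 * mu * cf phi (cell1 k) w + mu ^+ 2)); last first.
    by move=> w; rewrite /cf /psi; ring.
  rewrite ExD; [|by apply: intgB; [exact: p2.2|exact: intgZ]|exact: intg_cst].
  rewrite ExB; [|exact: p2.2|exact: intgZ].
  by rewrite ExZ// Ex_cst -/mu; ring.
by rewrite gerBl sqr_ge0.
Qed.

Section MaxInequality.
Context {I : eqType}.
Variables (s : seq I) (f : I -> cval -> R) (W : cval -> R) (a : R).
Hypotheses (s0 : (0 < size s)%N) (a0 : 0 < a).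
Hypothesis mf : forall i, i \in s -> cmeas (f i).
Hypothesis f2 : forall i, i \in s -> L2 P (cf (f i) (cell1 k)).
Hypotheses (mW : cmeas W) (W2 : L2 P (cf W (cell1 k))).
Hypothesis fW : forall i j w, i \in s -> `|cf (f i) j w| <= a * cf W j w.

Let F i j := cf (f i) j.
Let FL i j : i \in s -> L2 P (F i j). Proof. by move=> si; apply: cf_L2; [exact: mf|exact: f2]. Qed.
Let WL j : L2 P (cf W j). Proof. exact: cf_L2. Qed.
Let om := Ex P (fun w => cf W (cell1 k) w ^+ 2).
Let D := Ex P (fun w => bmax s (fun i => \sum_(r < n) (F i (dg r) w - F i (dg (n + r)) w))).
Let Lg := ln (2 * (size s)%:R) : R.

(** Swapping the diagonal cells [r] and [n + r] where [e r] holds is the same injection applied in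
    every direction, so each choice of signs has the same expectation [D]. Averaged over all signs,
    the deterministic bound applies outcome by outcome. *)
Lemma sym_diff_bound lm : 0 < lm -> D <= Lg / lm + 8 * lm * a ^+ 2 * n%:R * om.
Proof.
move=> lm0.
pose sg (e : {ffun 'I_n -> bool}) w :=
  bmax s (fun i => \sum_(r < n) (-1) ^+ (e r) * (F i (dg r) w - F i (dg (n + r)) w)).
have sgL e : L2 P (sg e).
  apply: bmax_L2 => i si; apply: L2_sum => r _; apply: L2Z.
  by apply: L2B; exact: FL.
have sgE e : Ex P (sg e) = D.
  pose c (rb : 'I_n * bool) : cell k := dg (if rb.2 then n + rb.1 else rb.1)%N.
  pose c' (rb : 'I_n * bool) : cell k := dg (if rb.2 (+) e rb.1 then n + rb.1 else rb.1)%N.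
  pose eb (x : nat) : bool := if insub x is Some r then e r else false.
  have ebE (r : 'I_n) : eb r = e r by rewrite /eb valK.
  pose tau (i : 'I_k) (x : nat) : nat := (if x < n then (if eb x then n + x else x)
    else if x < n + n then (if eb (x - n) then x - n else x) else x)%N.
  pose g (x : arr Ycal ('I_n * bool)%type) : R :=
    bmax s (fun i => \sum_(r < n) (f i (x (r, false)) - f i (x (r, true)))).
  have tauK i : involutive (tau i).
    move=> x; rewrite /tau; case: (ltnP x n) => xn.
      case Eb: (eb x); last by rewrite xn Eb.
      by rewrite ltnNge leq_addr /= ltn_add2l xn addKn Eb.
    case: (ltnP x (n + n)) => xnn; last by rewrite ltnNge xn /= ltnNge xnn.
    case Eb: (eb (x - n)%N).
      have h : (x - n < n)%N by rewrite ltn_subLR.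
      by rewrite h Eb subnKC.
    by rewrite ltnNge xn /= xnn Eb.
  have [||||_ eqE] := @exch_Ex _ _ _ P k l Ycal N Y mN mY YY exch ('I_n * bool)%type c c' tau g.
  - by move=> i; exact: inv_inj.
  - move=> [r b] t; rewrite /c /c' /tau /dg /=; case: b => /=.
      rewrite ltnNge leq_addr /= ltn_add2l ltn_ord addKn ebE.
      by case: (e r).
    by rewrite ltn_ord ebE.
  - by apply: bmax_measurable => i si; apply: measurable_sum => r; apply: measurable_funB;
      apply: cmeas_arr; exact: mf.
  - apply: L2_intg; apply: bmax_L2 => i si; apply: L2_sum => r _.
    by apply: L2B; exact: (FL (dg _) si).
  transitivity (Ex P (g \o pull c)); last by [].
  rewrite -eqE; apply: eq_Ex => w.
  apply: eq_bmax => i si; apply: eq_bigr => r _; rewrite /F /cf /pull /c' /=.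
  by case: (e r) => /=; rewrite ?expr1 ?expr0 ?mul1r// mulN1r opprB.
pose b (r : 'I_n) w := a * (cf W (dg r) w + cf W (dg (n + r)) w).
have bL r : L2 P (b r) by apply: L2Z; apply: L2D.
have pw w : \sum_(e : {ffun 'I_n -> bool}) sg e w <=
    2 ^+ n * (Lg / lm + 2 * lm * \sum_(r < n) b r w ^+ 2).
  apply: rademacher_max => // r i si.
  apply: le_trans (ler_normB _ _) _; rewrite /b mulrDr.
  by apply: lerD; exact: fW.
have cardE : #|{ffun 'I_n -> bool}|%:R = 2 ^+ n :> R.
  by rewrite card_ffun card_bool card_ord natrX.
have sumE : 2 ^+ n * D = Ex P (fun w => \sum_(e : {ffun 'I_n -> bool}) sg e w).
  rewrite Ex_sum => [|e _]; last exact: L2_intg.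
  by rewrite (eq_bigr _ (fun e _ => sgE e)) sumr_const -cardE mulr_natl.
have ibs : intg P (fun w => \sum_(r < n) b r w ^+ 2) by apply: intg_sum => r _; exact: (bL r).2.
have p2 : 0 < 2 ^+ n :> R by rewrite exprn_gt0.
rewrite -(ler_pM2l p2) sumE.
apply: (@le_trans _ _ (Ex P (fun w => 2 ^+ n * (Lg / lm + 2 * lm * \sum_(r < n) b r w ^+ 2)))).
  apply: le_Ex => //; first by apply: intg_sum => e _; exact: L2_intg.
  by apply: intgZ; apply: intgD; [exact: intg_cst|exact: intgZ].
rewrite ExZ; last by apply: intgD; [exact: intg_cst|exact: intgZ].
rewrite ler_pM2l// ExD; [|exact: intg_cst|exact: intgZ].
rewrite Ex_cst lerD2l ExZ// Ex_sum => [|r _]; last exact: (bL r).2.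
(* The factor 4 comes from [(x + y)^2 <= 2 (x^2 + y^2)] and from the two cells of each pair. *)
apply: (@le_trans _ _ (2 * lm * \sum_(r < n) 4 * a ^+ 2 * om)).
  apply: ler_wpM2l; first by apply: mulr_ge0 => //; exact: ltW.
  apply: ler_sum => r _.
  have -> : 4 * a ^+ 2 * om = Ex P (fun w => 2 * a ^+ 2 * (cf W (dg r) w ^+ 2 + cf W (dg (n + r)) w ^+ 2)).
    rewrite ExZ ?ExD ?cf_Ex2//; [rewrite -/om; ring|exact: (WL _).2|exact: (WL _).2|].
    by apply: intgD; exact: (WL _).2.
  apply: le_Ex => [||w]; first exact: (bL r).2.
    by apply: intgZ; apply: intgD; exact: (WL _).2.
  rewrite /b.
  have := mulr_ge0 (sqr_ge0 a) (sqr_ge0 (cf W (dg r) w - cf W (dg (n + r)) w)); lra.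
rewrite sumr_const card_ord -[_ *+ n]mulr_natl le_eqVlt; apply/orP; left; apply/eqP; ring.
Qed.

(** Instead of integrating out a ghost sample conditionally, the mean is approximated by the average
    over [M] further blocks of [n] diagonal cells. Each block gives the same [D], and the error
    tends to 0 in L2 by independence, so its crude dependence on the list is harmless. *)
Lemma diag_center_bound : Ex P (fun w => bmax s (fun i => \sum_(r < n) (F i (dg r) w - Ex P (F i (cell1 k))))) <= D.
Proof.
set X := Ex _ _.
pose mu i := Ex P (F i (cell1 k)).
pose psi i v := f i v - mu i.
pose c := \sum_(i <- s | i \in s) Num.sqrt (n%:R * Ex P (fun w => cf (psi i) (cell1 k) w ^+ 2)).
have mpsi i : i \in s -> cmeas (psi i) by move=> si; apply: cmeasB; [exact: mf|exact: cmeas_cst].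
have psi2 i : i \in s -> L2 P (cf (psi i) (cell1 k)).
  by move=> si; apply: L2B; [exact: f2|exact: L2_cst].
have psi0 i : i \in s -> Ex P (cf (psi i) (cell1 k)) = 0.
  move=> si; rewrite ExB ?Ex_cst ?subrr//; last exact: intg_cst.
  exact: L2_intg (f2 si).
have c0 : 0 <= c by apply: sumr_ge0 => i _; exact: sqrtr_ge0.
have key K : (0 < K)%N -> X <= D + c / K%:R.
  (* A square number of blocks makes the standard deviations proportional to [1 / K]. *)
  move=> K0; pose M := (K * K)%N.
  have M0 : (0 < M)%N by rewrite muln_gt0 K0.
  have Mn0 : M%:R != 0 :> R by rewrite pnatr_eq0 -lt0n.
  pose B m w := bmax s (fun i => \sum_(r < n) (F i (dg r) w - F i (dg (n + (m * n + r))) w)).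
  have BL m : L2 P (B m).
    by apply: bmax_L2 => i si; apply: L2_sum => r _; apply: L2B; exact: FL.
  have BE m : Ex P (B m) = D.
    pose cc (rb : 'I_n * bool) : cell k := dg (if rb.2 then n + rb.1 else rb.1)%N.
    pose c' (rb : 'I_n * bool) : cell k := dg (if rb.2 then n + (m * n + rb.1) else rb.1)%N.
    (* Keeps the first diagonal block and moves the block after it to the m-th ghost block. *)
    pose tau (i : 'I_k) (x : nat) : nat := (if x < n then x else x + m * n)%N.
    pose g (x : arr Ycal ('I_n * bool)%type) : R :=
      bmax s (fun i => \sum_(r < n) (f i (x (r, false)) - f i (x (r, true)))).
    have [||||_ eqE] := @exch_Ex _ _ _ P k l Ycal N Y mN mY YY exch ('I_n * bool)%type cc c' tau g.
    - by move=> i x y; rewrite /tau; case: (ltnP x n); case: (ltnP y n); lia.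
    - move=> [r b] t; rewrite /cc /c' /tau /dg /=; case: b => /=; last by rewrite ltn_ord.
      by rewrite ltnNge leq_addr /=; lia.
    - by apply: bmax_measurable => i si; apply: measurable_sum => r; apply: measurable_funB;
        apply: cmeas_arr; exact: mf.
    - apply: L2_intg; apply: bmax_L2 => i si; apply: L2_sum => r _.
      by apply: L2B; exact: (FL (dg _) si).
    exact: eqE.
  pose Q w := bmax s (fun i => M%:R^-1 * \sum_(q < M * n) cf (psi i) (dg (n + q)) w).
  have psiL i j : i \in s -> L2 P (cf (psi i) j) by move=> si; apply: cf_L2; [exact: mpsi|exact: psi2].
  have QiL i : i \in s -> L2 P (fun w => M%:R^-1 * \sum_(q < M * n) cf (psi i) (dg (n + q)) w).
    by move=> si; apply: L2Z; apply: L2_sum => q _; exact: psiL.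
  have QL : L2 P Q by exact: bmax_L2.
  have QE : Ex P Q <= c / K%:R.
    apply: (@le_trans _ _ (Ex P (fun w => \sum_(i <- s | i \in s) `|M%:R^-1 * \sum_(q < M * n) cf (psi i) (dg (n + q)) w|))).
      apply: le_Ex; first exact: L2_intg.
        by apply: intg_sum => i si; apply: intg_norm; apply: L2_intg; exact: QiL.
      by move=> w; rewrite -big_seq; exact: bmax_sum.
    rewrite Ex_sum => [|i si]; last by apply: intg_norm; apply: L2_intg; exact: QiL.
    rewrite /c mulr_suml; apply: ler_sum => i si; apply: Ex_norm_le.
    - by rewrite divr_ge0 ?sqrtr_ge0.
    - exact: QiL.
    rewrite (@eq_Ex _ _ _ P _ (fun w => M%:R^-1 ^+ 2 * (\sum_(q < M * n) cf (psi i) (dg (n + q)) w) ^+ 2)); last first.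
      by move=> w; rewrite exprMn.
    rewrite ExZ; last by have [] : L2 P (fun w => \sum_(q < M * n) cf (psi i) (dg (n + q)) w) by apply: L2_sum => q _; exact: psiL.
    rewrite diag_sum_sq ?psi0//; [|exact: mpsi|exact: psi2].
    rewrite exprMn sqr_sqrtr; last by rewrite mulr_ge0 ?ler0n//; apply: Ex_ge0 => w; exact: sqr_ge0.
    rewrite le_eqVlt; apply/orP; left; apply/eqP; rewrite /M !natrM; field.
    by rewrite pnatr_eq0 -lt0n.
  have pw w : bmax s (fun i => \sum_(r < n) (F i (dg r) w - mu i)) <= M%:R^-1 * \sum_(m < M) B m w + Q w.
    rewrite (@eq_bmax _ _ s _ (fun i => M%:R^-1 * \sum_(m < M) \sum_(r < n) (F i (dg r) w - F i (dg (n + (m * n + r))) w)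
      + M%:R^-1 * \sum_(q < M * n) cf (psi i) (dg (n + q)) w)); last first.
      move=> i si; rewrite (sum_nat_mul M n (fun q => cf (psi i) (dg (n + q)) w)) -mulrDr -big_split/=.
      rewrite [X in _ = _ * X](eq_bigr (fun=> \sum_(r < n) (F i (dg r) w - mu i))) => [|m _].
        by rewrite sumr_const card_ord -[X in _ * X]mulr_natl mulKf.
      by rewrite -big_split; apply: eq_bigr => r _; rewrite /F /psi /cf /=; ring.
    apply: le_trans (bmaxD _ _ _) _; apply: lerD => //.
    apply: le_trans (bmaxZ _ _ _) _; rewrite ger0_norm ?invr_ge0// ler_wpM2l ?invr_ge0//.
    exact: bmax_bigsum.
  apply: (@le_trans _ _ (Ex P (fun w => M%:R^-1 * \sum_(m < M) B m w + Q w))).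
    apply: le_Ex => //.
      apply: L2_intg; apply: bmax_L2 => i si; apply: L2_sum => r _.
      by apply: L2B; [exact: FL|exact: L2_cst].
    apply: intgD; last exact: L2_intg.
    by apply: intgZ; apply: intg_sum => m _; exact: L2_intg.
  rewrite ExD; [|by apply: intgZ; apply: intg_sum => m _; exact: L2_intg|exact: L2_intg].
  rewrite ExZ; last by apply: intg_sum => m _; exact: L2_intg.
  rewrite Ex_sum => [|m _]; last exact: L2_intg.
  apply: lerD => //; rewrite (eq_bigr (fun=> D)) => [|m _]; last exact: BE.
  by rewrite sumr_const card_ord -[X in _ * X]mulr_natl mulKf.
rewrite leNgt; apply/negP => DX.
have := key (Num.truncn (c / (X - D))).+1 isT; apply/negP; rewrite -ltNge.
rewrite -ltrBrDl ltr_pdivrMr ?ltr0n// mulrC -ltr_pdivrMr ?subr_gt0//.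
exact: truncnS_gt.
Qed.

Lemma grid_max : Ex P (fun w => bmax s (fun i =>
    Num.sqrt n%:R * (gmean C (fun j => F i j w) - Ex P (F i (cell1 k))))) <=
  2 * a * Num.sqrt (8 * (om + 1)) * Num.sqrt Lg.
Proof.
pose mu i := Ex P (F i (cell1 k)).
have om0 : 0 <= om by apply: Ex_ge0 => w; exact: sqr_ge0.
have om1 : 0 < om + 1 by lra.
have Lg0 : 0 < Lg.
  rewrite ln_gt0// (@lt_le_trans _ _ 2%:R) ?ltr1n// -natrM ler_nat.
  by rewrite -[X in (X <= _)%N]muln1 leq_mul2l s0.
have nsq : Num.sqrt n%:R ^+ 2 = n%:R :> R by rewrite sqr_sqrtr.
have nsq0 : 0 < Num.sqrt n%:R :> R by rewrite sqrtr_gt0.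
set S := fun sh w => bmax s (fun i => \sum_(r < n) (F i (dshift sh r) w - mu i)).
have SL sh : L2 P (S sh).
  by apply: bmax_L2 => i si; apply: L2_sum => r _; apply: L2B; [exact: FL|exact: L2_cst].
have SE sh : Ex P (S sh) <= D.
  apply: le_trans diag_center_bound.
  pose g (x : arr Ycal 'I_n) : R := bmax s (fun i => \sum_(r < n) (f i (x r) - mu i)).
  have [||_ eqE] := @dshift_law g sh.
  - apply: bmax_measurable => i si; apply: measurable_sum => r; apply: measurable_funB => //.
    by apply: cmeas_arr; exact: mf.
  - apply: L2_intg; apply: bmax_L2 => i si; apply: L2_sum => r _.
    by apply: L2B; [exact: (FL (dg r) si)|exact: L2_cst].
  by rewrite le_eqVlt; apply/orP; left; apply/eqP; exact: eqE.
have sc0 : 0 <= Num.sqrt n%:R * n%:R^-1 :> R by rewrite mulr_ge0 ?ltW// invr_gt0.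
apply: (@le_trans _ _ (Num.sqrt n%:R * n%:R^-1 * D)).
  apply: (@le_trans _ _ (Ex P (fun w => gmean C (fun sh => Num.sqrt n%:R * n%:R^-1 * S sh w)))).
    apply: le_Ex => [||w].
    - apply: L2_intg; apply: bmax_L2 => i si; apply: L2Z; apply: L2B; last exact: L2_cst.
      by apply: L2Z; apply: L2_sum => j _; exact: FL.
    - by apply: intgZ; apply: intg_sum => j _; apply: intgZ; exact: L2_intg.
    rewrite (@eq_bmax _ _ s _ (fun i => gmean C (fun sh => Num.sqrt n%:R * n%:R^-1 * \sum_(r < n) (F i (dshift sh r) w - mu i)))); last first.
      by move=> i _; rewrite gmean_center.
    apply: le_trans (bmaxZ _ _ _) _; rewrite ger0_norm ?invr_ge0// ler_wpM2l ?invr_ge0//.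
    apply: le_trans (bmax_bigsum _ _ _) _; apply: ler_sum => j _.
    by apply: le_trans (bmaxZ _ _ _) _; rewrite ger0_norm.
  rewrite ExZ; last by apply: intg_sum => j _; apply: intgZ; exact: L2_intg.
  rewrite Ex_sum => [|j _]; last by apply: intgZ; exact: L2_intg.
  rewrite -[X in _ <= X](@gmean_cst _ _ C)//; rewrite /gmean ler_wpM2l ?invr_ge0//.
  apply: ler_sum => j _; rewrite ExZ; last exact: L2_intg.
  exact: ler_wpM2l.
(* [lm = p / q] balances the two terms of the bound; [om + 1] instead of [om] keeps [q] positive. *)
pose p := Num.sqrt Lg; pose q := Num.sqrt (8 * (om + 1)) * a * Num.sqrt n%:R.
have p0 : 0 < p by rewrite sqrtr_gt0.
have q0 : 0 < q by rewrite !mulr_gt0// sqrtr_gt0 mulr_gt0.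
have h := sym_diff_bound (divr_gt0 p0 q0).
have pE : p ^+ 2 = Lg by rewrite sqr_sqrtr// ltW.
have qE : q ^+ 2 = 8 * (om + 1) * a ^+ 2 * n%:R.
  by rewrite !exprMn nsq sqr_sqrtr// mulr_ge0// ltW.
have {}h : D <= 2 * p * q.
  apply: le_trans h _.
  have -> : 8 * (p / q) * a ^+ 2 * n%:R * om = p / q * (8 * om * a ^+ 2 * n%:R) by ring.
  have le : 8 * om * a ^+ 2 * n%:R <= q ^+ 2.
    rewrite qE; apply: ler_wpM2r => //; apply: ler_wpM2r; [exact: sqr_ge0|lra].
  apply: le_trans (lerD (lexx _) (ler_wpM2l (ltW (divr_gt0 p0 q0)) le)) _.
  rewrite -pE le_eqVlt; apply/orP; left; apply/eqP; field.
  by rewrite !gt_eqF.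
apply: le_trans (ler_wpM2l sc0 h) _.
rewrite /q /p le_eqVlt; apply/orP; left; apply/eqP.
rewrite -[X in _ / X]nsq; field; rewrite gt_eqF//.
Qed.

End MaxInequality.
End GridOfDiagonals.
End Diagonals.

(** * Chaining *)

Section Chaining.
Context {R : realType} {d} {T : measurableType d} (P : probability T R).
Context {k l : nat} (Ycal : set 'rV[R]_l).
Context (N : cell k -> T -> nat) (Y : cell k -> nat -> T -> 'rV[R]_l).
Hypothesis mN : forall j n, measurable [set w | N j w = n].
Hypothesis mY : forall j ell s, measurable_fun setT (fun w => Y j ell w ord0 s).
Hypothesis YY : forall j ell w, Ycal (Y j ell w).
Hypothesis exch : sep_exchangeable P N Y.
Hypothesis bind : block_independent P N Y.
Hypothesis k0 : (0 < k)%N.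

Local Notation cval := (nat * (nat -> 'rV[R]_l))%type.
Local Notation cf := (cf N Y).
Context {Th : eqType} (Theta : set Th) (u : Th -> cval -> R) (W : cval -> R) (b : R).
Hypothesis mu : forall th, Theta th -> cmeas Ycal (u th).
Hypotheses (mW : cmeas Ycal W) (W2 : L2 P (cf W (cell1 k))).
Hypothesis b0 : 0 <= b.
Hypothesis uW : forall th j w, Theta th -> `|cf (u th) j w| <= b * cf W j w.
Variables (Tq : nat -> seq Th) (pi : nat -> Th -> Th) (eps : nat -> R).
Hypothesis eps0 : forall q, 0 < eps q.
Hypothesis epsS : forall q, eps q.+1 <= eps q.
Hypothesis eps_cvg : forall e, 0 < e -> exists q, eps q <= e.
Hypothesis piT : forall q th, Theta th -> pi q th \in Tq q.
Hypothesis TT : forall q th, th \in Tq q -> Theta th.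
Hypothesis pi_close : forall q th j w, Theta th ->
  `|cf (u th) j w - cf (u (pi q th)) j w| <= eps q * cf W j w.

Definition chain_term q : R :=
  eps q * Num.sqrt (ln (2 * (size (Tq q.+1) * size (Tq q))%:R)).
Hypothesis chain_sum : exists B, forall Q, \sum_(q < Q) chain_term q <= B.

Let om := Ex P (fun w => cf W (cell1 k) w ^+ 2).
Let kap := 2 * Num.sqrt (8 * (om + 1)).

Lemma u_L2 th j : Theta th -> L2 P (cf (u th) j).
Proof.
move=> hth.
have c2 : L2 P (cf (u th) (cell1 k)).
  apply: (@L2_le _ _ _ P _ (fun w => b * cf W (cell1 k) w)).
  - exact (cf_measurable mN mY YY _ (mu hth)).
  - exact: L2Z.
  - by move=> w; apply: le_trans (uW _ _ hth) _; exact: ler_norm.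
exact (cf_L2 mN mY YY exch j (mu hth) c2).
Qed.

Definition dist2 th th' : R := Ex P (fun w => (cf (u th) (cell1 k) w - cf (u th') (cell1 k) w) ^+ 2).

Definition emp (C : cell k) (n : nat) th w : R :=
  Num.sqrt n%:R * (gmean C (fun j => cf (u th) j w) - Ex P (cf (u th) (cell1 k))).

Lemma emp_L2 C n th : Theta th -> L2 P (emp C n th).
Proof.
move=> hth; apply: L2Z; apply: L2B; last exact: L2_cst.
by apply: L2Z; apply: L2_sum => j _; exact: u_L2.
Qed.

Lemma empB C n th th' w : Theta th -> Theta th' ->
  emp C n th w - emp C n th' w =
  Num.sqrt n%:R * (gmean C (fun j => cf (fun v => u th v - u th' v) j w) -
    Ex P (cf (fun v => u th v - u th' v) (cell1 k))).
Proof.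
move=> h h'; rewrite /emp -mulrBr; congr (_ * _).
have -> : Ex P (cf (fun v => u th v - u th' v) (cell1 k)) =
  Ex P (cf (u th) (cell1 k)) - Ex P (cf (u th') (cell1 k)).
  by rewrite -ExB//; [exact: L2_intg (u_L2 _ h)|exact: L2_intg (u_L2 _ h')].
have -> : gmean C (fun j => cf (fun v => u th v - u th' v) j w) =
   gmean C (fun j => cf (u th) j w) - gmean C (fun j => cf (u th') j w).
  rewrite -[X in _ = _ - X]mul1r -mulNr -gmeanZ -gmeanD; apply: eq_gmean => j _.
  by rewrite mulN1r.
by ring.
Qed.

Section FixedGrid.
Variables (C : cell k) (n : nat).
Hypotheses (n0 : (0 < n)%N) (nC : forall i, (n <= C i)%N).

Lemma emp_pairs_max (s : seq (Th * Th)) (a : R) : (0 < size s)%N -> 0 < a ->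
  (forall p, p \in s -> Theta p.1 /\ Theta p.2) ->
  (forall p j w, p \in s -> `|cf (u p.1) j w - cf (u p.2) j w| <= a * cf W j w) ->
  Ex P (fun w => bmax s (fun p => emp C n p.1 w - emp C n p.2 w)) <=
  a * kap * Num.sqrt (ln (2 * (size s)%:R)).
Proof.
move=> s0 a0 sT sa.
pose f (p : Th * Th) v := u p.1 v - u p.2 v.
have mf p : p \in s -> cmeas Ycal (f p).
  by move=> /sT[h1 h2]; apply: cmeasB; exact: mu.
have f2 p : p \in s -> L2 P (cf (f p) (cell1 k)).
  by move=> /sT[h1 h2]; apply: L2B; exact: u_L2.
have := grid_max mN mY YY exch bind k0 n0 nC s0 a0 mf f2 mW W2 sa.
rewrite -/om (_ : 2 * a * _ = a * kap); last by rewrite /kap; ring.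
apply: le_trans; rewrite le_eqVlt; apply/orP; left; apply/eqP.
by apply: eq_Ex => w; apply: eq_bmax => p /sT[h1 h2]; rewrite empB.
Qed.

Lemma emp_var th th' : Theta th -> Theta th' ->
  Ex P (fun w => (emp C n th w - emp C n th' w) ^+ 2) <= dist2 th th'.
Proof.
move=> h h'.
have mf : cmeas Ycal (fun v => u th v - u th' v) by apply: cmeasB; exact: mu.
have f2 : L2 P (cf (fun v => u th v - u th' v) (cell1 k)) by apply: L2B; exact: u_L2.
have := grid_var mN mY YY exch bind n0 nC mf f2.
by apply: le_trans; rewrite le_eqVlt; apply/orP; left; apply/eqP; apply: eq_Ex => w; rewrite empB.
Qed.

Lemma emp_norm_le th : Theta th -> Ex P (fun w => `|emp C n th w|) <= b * Num.sqrt om.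
Proof.
move=> h; have om0 : 0 <= om by apply: Ex_ge0 => w; exact: sqr_ge0.
apply: Ex_norm_le; [by rewrite mulr_ge0 ?sqrtr_ge0|exact: emp_L2|].
apply: le_trans (grid_var mN mY YY exch bind n0 nC (mu h) (u_L2 _ h)) _.
rewrite exprMn sqr_sqrtr// -ExZ; last exact: W2.2.
apply: le_Ex => [||w]; [exact: (u_L2 _ h).2|apply: intgZ; exact: W2.2|].
rewrite -exprMn -(real_normK (num_real (cf (u th) (cell1 k) w))).
by rewrite lerXn2r ?nnegrE//; [exact: le_trans (normr_ge0 _) (uW _ _ h)|exact: uW].
Qed.

Variable F : seq Th.
Hypothesis F0 : (0 < size F)%N.
Hypothesis FT : forall th, th \in F -> Theta th.

Let piTh q th : Theta th -> Theta (pi q th).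
Proof. by move=> h; apply: TT (piT q h). Qed.

Lemma emp_diff_bmax_L2 q : L2 P (fun w => bmax F (fun th => emp C n th w - emp C n (pi q th) w)).
Proof. by apply: bmax_L2 => th /FT h; apply: L2B; apply: emp_L2 => //; exact: piTh. Qed.

(** Whatever [F] is, its links [(pi q.+1 th, pi q th)] take at most as many values as there are
    pairs of cover points; removing repetitions makes the bound independent of [F]. Both ends are
    close to [th], whence the mesh [2 * eps q]. *)
Lemma chain_step q : Ex P (fun w => bmax F (fun th => emp C n (pi q.+1 th) w - emp C n (pi q th) w))
  <= 2 * kap * chain_term q.
Proof.
pose s := undup [seq (pi q.+1 th, pi q th) | th <- F].
have memE p : p \in s -> exists2 th, Theta th & p = (pi q.+1 th, pi q th).
  by rewrite mem_undup => /mapP[th /FT h ->]; exists th.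
have s0 : (0 < size s)%N.
  have [th thF] : exists th, th \in F by case: (F) F0 => // th ? _; exists th; rewrite mem_head.
  have : (pi q.+1 th, pi q th) \in s by rewrite mem_undup; apply/mapP; exists th.
  by case: (s).
have sT p : p \in s -> Theta p.1 /\ Theta p.2 by move=> /memE[th h ->]; split; exact: piTh.
have sz : (size s <= size (Tq q.+1) * size (Tq q))%N.
  rewrite -(size_allpairs (fun x y => (x, y))); apply: uniq_leq_size; first exact: undup_uniq.
  by move=> p /memE[th h ->]; apply/allpairsP; exists (pi q.+1 th, pi q th); split => //; exact: piT.
have sa p j w : p \in s -> `|cf (u p.1) j w - cf (u p.2) j w| <= 2 * eps q * cf W j w.
  move=> /memE[th h -> /=].
  have h1 := pi_close q.+1 j w h; have h2 := pi_close q j w h.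
  have W0 : 0 <= cf W j w.
    by have := le_trans (normr_ge0 _) h1; rewrite pmulr_rge0.
  have h3 : eps q.+1 * cf W j w <= eps q * cf W j w by rewrite ler_wpM2r.
  rewrite (_ : _ - _ = (cf (u th) j w - cf (u (pi q th)) j w) - (cf (u th) j w - cf (u (pi q.+1 th)) j w)); last by ring.
  by apply: le_trans (ler_normB _ _) _; lra.
have := emp_pairs_max s0 (mulr_gt0 (ltr0n _ 2) (eps0 q)) sT sa.
move=> h; apply: le_trans (le_trans h _).
  apply: le_Ex => [||w].
  - by apply: L2_intg; apply: bmax_L2 => th /FT hth; apply: L2B; apply: emp_L2; exact: piTh.
  - by apply: L2_intg; apply: bmax_L2 => p /sT[h1 h2]; apply: L2B; exact: emp_L2.
  apply: bmax_le => [|th thF]; first exact: bmax_ge0.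
  by apply: (le_bmax (fun p => emp C n p.1 w - emp C n p.2 w) (i := (pi q.+1 th, pi q th)));
    rewrite mem_undup; apply/mapP; exists th.
have kap0 : 0 <= kap by rewrite mulr_ge0 ?sqrtr_ge0.
rewrite /chain_term (_ : 2 * eps q * kap * _ = 2 * kap * (eps q * Num.sqrt (ln (2 * (size s)%:R)))); last by ring.
rewrite ler_wpM2l ?mulr_ge0// ler_wpM2l ?(ltW (eps0 _))// ler_wsqrtr//.
rewrite ler_ln ?posrE ?mulr_gt0 ?ltr0n//; last exact: leq_trans s0 sz.
by rewrite ler_pM2l// ler_nat.
Qed.

(** Here the size of [F] does enter; since [eps Q] tends to 0, a level [Q] depending on [F] makes
    the term negligible in [chain_tail]. *)
Lemma chain_last Q : Ex P (fun w => bmax F (fun th => emp C n th w - emp C n (pi Q th) w))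
  <= eps Q * kap * Num.sqrt (ln (2 * (size F)%:R)).
Proof.
pose s := [seq (th, pi Q th) | th <- F].
have memE p : p \in s -> exists2 th, Theta th & p = (th, pi Q th).
  by move=> /mapP[th /FT h ->]; exists th.
have s0 : (0 < size s)%N by rewrite size_map.
have sT p : p \in s -> Theta p.1 /\ Theta p.2.
  by move=> /memE[th h ->]; split => //; exact: piTh.
have sa p j w : p \in s -> `|cf (u p.1) j w - cf (u p.2) j w| <= eps Q * cf W j w.
  by move=> /memE[th h ->]; exact: pi_close.
have := emp_pairs_max s0 (eps0 Q) sT sa; rewrite size_map; apply: le_trans.
apply: le_Ex => [||w].
- exact: L2_intg (emp_diff_bmax_L2 Q).
- by apply: L2_intg; apply: bmax_L2 => p /sT[h1 h2]; apply: L2B; exact: emp_L2.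
apply: bmax_le => [|th thF]; first exact: bmax_ge0.
by apply: (le_bmax (fun p => emp C n p.1 w - emp C n p.2 w) (i := (th, pi Q th)));
  apply/mapP; exists th.
Qed.

Lemma chain_bound q0 m : Ex P (fun w => bmax F (fun th => emp C n th w - emp C n (pi q0 th) w))
  <= 2 * kap * (\sum_(q < q0 + m) chain_term q - \sum_(q < q0) chain_term q) +
     eps (q0 + m) * kap * Num.sqrt (ln (2 * (size F)%:R)).
Proof.
suff h : Ex P (fun w => bmax F (fun th => emp C n th w - emp C n (pi q0 th) w))
  <= 2 * kap * (\sum_(q < q0 + m) chain_term q - \sum_(q < q0) chain_term q) +
     Ex P (fun w => bmax F (fun th => emp C n th w - emp C n (pi (q0 + m) th) w)).
  by apply: le_trans h _; rewrite lerD2l; exact: chain_last.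
elim: m => [|m IH]; first by rewrite addn0 subrr mulr0 add0r.
apply: le_trans IH _; rewrite addnS big_ord_recr/=.
set A := \sum_(q < q0 + m) _; set B := \sum_(q < q0) _.
rewrite (_ : 2 * kap * (A + _ - B) = 2 * kap * (A - B) + 2 * kap * chain_term (q0 + m)); last by ring.
rewrite -addrA lerD2l; apply: le_trans (lerD (chain_step (q0 + m)) (lexx _)).
rewrite -ExD; [|by apply: L2_intg; apply: bmax_L2 => th /FT h; apply: L2B; apply: emp_L2; exact: piTh
  |exact: L2_intg (emp_diff_bmax_L2 _)].
apply: le_Ex => [||w].
- exact: L2_intg (emp_diff_bmax_L2 _).
- apply: intgD; last exact: L2_intg (emp_diff_bmax_L2 _).
  by apply: L2_intg; apply: bmax_L2 => th /FT h; apply: L2B; apply: emp_L2; exact: piTh.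
rewrite addrC; apply: le_trans (bmaxD _ _ _).
rewrite le_eqVlt; apply/orP; left; apply/eqP; apply: eq_bmax => th _; ring.
Qed.

End FixedGrid.

(** [q0] is taken where the series of [chain_term] has almost reached its supremum, so the links
    beyond cost little; the last level is adapted to [F], while [q0] is not. *)
Lemma chain_tail e : 0 < e -> exists q0, forall C n F, (0 < n)%N -> (forall i, (n <= C i)%N) ->
  (0 < size F)%N -> (forall th, th \in F -> Theta th) ->
  Ex P (fun w => bmax F (fun th => emp C n th w - emp C n (pi q0 th) w)) <= e.
Proof.
move=> e0.
have kap0 : 0 < kap.
  have om0 : 0 <= om by apply: Ex_ge0 => w; exact: sqr_ge0.
  by rewrite mulr_gt0// sqrtr_gt0 mulr_gt0//; lra.
pose S Q := \sum_(q < Q) chain_term q.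
have ct0 q : 0 <= chain_term q by rewrite mulr_ge0 ?sqrtr_ge0 ?ltW.
have Smono a m : S a <= S (a + m)%N.
  elim: m => [|m IH]; first by rewrite addn0.
  by apply: le_trans IH _; rewrite /S addnS big_ord_recr/= lerDl.
have [B SB] := chain_sum.
have hs : has_sup [set S Q | Q in [set: nat]].
  by split; [exists (S 0%N); exists 0%N|exists B => _ [Q _ <-]; exact: SB].
have [_ [q0 _ <-] hq0] := @sup_adherent R _ (e / 2 / (2 * kap))
  (divr_gt0 (divr_gt0 e0 (ltr0n _ 2)) (mulr_gt0 (ltr0n _ 2) kap0)) hs.
exists q0 => C n F n0 nC F0 FT.
have Lg0 := sqrtr_ge0 (ln (2 * (size F)%:R) : R).
set Lg := Num.sqrt _ in Lg0.
have [m hm] : exists m, eps (q0 + m) * kap * Lg <= e / 2.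
  have [q hq] := eps_cvg (divr_gt0 (divr_gt0 e0 (ltr0n R 2)) (mulr_gt0 kap0 (ltr_wpDl Lg0 ltr01))).
  exists q.
  have mono : eps (q0 + q) <= eps q.
    by elim: (q0) => // a IH; apply: le_trans IH; rewrite addSn.
  have h1 : eps (q0 + q) * (kap * (Lg + 1)) <= e / 2.
    apply: le_trans (ler_wpM2r _ (le_trans mono hq)) _; first by apply: mulr_ge0; [exact: ltW|lra].
    by rewrite divfK// gt_eqF// mulr_gt0// ltr_wpDl.
  apply: le_trans h1; rewrite -mulrA ler_wpM2l ?(ltW (eps0 _))// ler_wpM2l ?ltW//.
  by rewrite ltrDl.
apply: le_trans (chain_bound n0 nC F0 FT q0 m) _.
have ub : S (q0 + m)%N <= sup [set S Q | Q in [set: nat]].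
  by apply: sup_upper_bound => //; exists (q0 + m)%N.
have {}hq0 : S (q0 + m)%N - S q0 <= e / 2 / (2 * kap) by lra.
have h2 : 2 * kap * (S (q0 + m)%N - S q0) <= e / 2.
  apply: le_trans (ler_wpM2l _ hq0) _; first by apply: mulr_ge0; [|exact: ltW].
  by rewrite mulrC divfK// gt_eqF// mulr_gt0.
rewrite [leRHS](splitr e); exact: lerD.
Qed.

Lemma emp_bounded : exists K, forall C n F, (0 < n)%N -> (forall i, (n <= C i)%N) ->
  (forall th, th \in F -> Theta th) ->
  Ex P (fun w => bmax F (fun th => emp C n th w)) <= K.
Proof.
have [q0 hq0] := chain_tail ltr01.
exists (1 + \sum_(v <- undup (Tq q0)) b * Num.sqrt om) => C n F n0 nC FT.
have piTh th : th \in F -> Theta (pi q0 th) by move=> /FT h; exact: TT (piT q0 h).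
have [F0|F0] := posnP (size F).
  rewrite (@eq_Ex _ _ _ P _ (fun=> 0)); last by move=> w; rewrite (size0nil F0) /bmax big_nil.
  rewrite Ex_cst addr_ge0//; apply: sumr_ge0 => v _.
  by rewrite mulr_ge0 ?sqrtr_ge0.
have iL v : v \in undup (Tq q0) -> intg P (fun w => `|emp C n v w|).
  by rewrite mem_undup => /TT h; apply: intg_norm; apply: L2_intg; exact: emp_L2.
have dL := emp_diff_bmax_L2 C n FT q0.
apply: (@le_trans _ _ (Ex P (fun w => bmax F (fun th => emp C n th w - emp C n (pi q0 th) w)
   + \sum_(v <- undup (Tq q0) | v \in undup (Tq q0)) `|emp C n v w|))).
  apply: le_Ex => [||w].
  - by apply: L2_intg; apply: bmax_L2 => th /FT h; exact: emp_L2.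
  - by apply: intgD; [exact: L2_intg|apply: intg_sum].
  apply: bmax_le => [|th thF].
    by rewrite addr_ge0 ?bmax_ge0//; apply: sumr_ge0.
  rewrite -big_seq -[emp C n th w](subrK (emp C n (pi q0 th) w)).
  apply: le_trans (ler_normD _ _) _; apply: lerD.
    exact: (le_bmax (fun th => emp C n th w - emp C n (pi q0 th) w)).
  have hp : pi q0 th \in undup (Tq q0) by rewrite mem_undup; exact: piT (FT _ thF).
  by rewrite (big_rem _ hp)/= lerDl sumr_ge0.
rewrite ExD; [|exact: L2_intg|exact: intg_sum].
apply: lerD; first exact: hq0.
rewrite Ex_sum// [leRHS]big_seq; apply: ler_sum => v; rewrite mem_undup => /TT h.
exact: emp_norm_le.
Qed.

Lemma emp_equicont e : 0 < e -> exists2 s, 0 < s & forall C n th0 F, (0 < n)%N ->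
  (forall i, (n <= C i)%N) -> Theta th0 -> (forall th, th \in F -> Theta th /\ dist2 th th0 <= s ^+ 2) ->
  Ex P (fun w => bmax F (fun th => emp C n th w - emp C n th0 w)) <= e.
Proof.
move=> e0; have [q0 hq0] := chain_tail (divr_gt0 e0 (ltr0n _ 4)).
pose V0 := undup (Tq q0).
(* There are at most [size V0] representatives, each with mean deviation at most [s]. *)
pose s := e / 2 / ((size V0)%:R + 1).
have d0 : 0 < (size V0)%:R + 1 :> R by rewrite ltr_wpDl.
have s0 : 0 < s by rewrite !divr_gt0.
exists s => // C n th0 F n0 nC h0 FTs.
have FT th : th \in F -> Theta th by move=> /FTs[].
have [F0|F0] := posnP (size F).
  rewrite (@eq_Ex _ _ _ P _ (fun=> 0)); last by move=> w; rewrite (size0nil F0) /bmax big_nil.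
  by rewrite Ex_cst ltW.
(* A cover point [pi q0 th] need not be near [th0]. Each cover cell met by [F] is represented by an
   element of [F], which is near; the way from [th] to its representative passes through their
   common cover point, at the cost of two approximations. *)
pose rep v := nth th0 F (find (fun th => pi q0 th == v) F).
have repP th : th \in F -> rep (pi q0 th) \in F /\ pi q0 (rep (pi q0 th)) = pi q0 th.
  move=> thF; have hh : has (fun th' => pi q0 th' == pi q0 th) F by apply/hasP; exists th.
  by split; [rewrite /rep mem_nth// -has_find|apply/eqP; exact: (nth_find th0 hh)].
pose V := undup [seq pi q0 th | th <- F].
have VP v : v \in V -> rep v \in F.
  by rewrite mem_undup => /mapP[th /repP[h _] ->].
have szV : (size V <= size V0)%N.
  apply: uniq_leq_size; first exact: undup_uniq.
  by move=> v; rewrite !mem_undup => /mapP[th /FT h ->]; exact: piT.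
have dL := emp_diff_bmax_L2 C n FT q0.
have iL v : v \in V -> L2 P (fun w => emp C n (rep v) w - emp C n th0 w).
  by move=> /VP/FT h; apply: L2B; exact: emp_L2.
apply: (@le_trans _ _ (Ex P (fun w => 2 * bmax F (fun th => emp C n th w - emp C n (pi q0 th) w)
   + \sum_(v <- V | v \in V) `|emp C n (rep v) w - emp C n th0 w|))).
  apply: le_Ex => [||w].
  - by apply: L2_intg; apply: bmax_L2 => th /FT h; apply: L2B; exact: emp_L2.
  - apply: intgD; first by apply: intgZ; exact: L2_intg.
    by apply: intg_sum => v vV; apply: intg_norm; apply: L2_intg; exact: iL.
  apply: bmax_le => [|th thF].
    by rewrite addr_ge0 ?mulr_ge0 ?bmax_ge0//; apply: sumr_ge0.
  have [rF rE] := repP _ thF.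
  have hv : pi q0 th \in V by rewrite mem_undup; apply/mapP; exists th.
  rewrite -big_seq (_ : emp C n th w - emp C n th0 w =
    (emp C n th w - emp C n (pi q0 th) w) - (emp C n (rep (pi q0 th)) w - emp C n (pi q0 (rep (pi q0 th))) w)
    + (emp C n (rep (pi q0 th)) w - emp C n th0 w)); last by rewrite rE; ring.
  apply: le_trans (ler_normD _ _) _; apply: lerD; last first.
    by rewrite (big_rem _ hv)/= lerDl sumr_ge0.
  apply: le_trans (ler_normB _ _) _; rewrite mulr2n mulrDl mul1r; apply: lerD.
    exact: (le_bmax (fun th => emp C n th w - emp C n (pi q0 th) w)).
  exact: (le_bmax (fun th => emp C n th w - emp C n (pi q0 th) w)).
rewrite ExD; [|by apply: intgZ; exact: L2_intg|by apply: intg_sum => v vV; apply: intg_norm; apply: L2_intg; exact: iL].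
rewrite ExZ; last exact: L2_intg.
rewrite Ex_sum => [|v vV]; last by apply: intg_norm; apply: L2_intg; exact: iL.
have h1 := hq0 C n F n0 nC F0 FT.
have h2 : \sum_(v <- V | v \in V) Ex P (fun w => `|emp C n (rep v) w - emp C n th0 w|) <= e / 2.
  apply: (@le_trans _ _ (\sum_(v <- V | v \in V) s)).
    apply: ler_sum => v vV; apply: Ex_norm_le; [exact: ltW|exact: iL|].
    have [hT hs] := FTs _ (VP _ vV).
    exact: le_trans (emp_var n0 nC hT h0) hs.
  rewrite -big_seq big_const_seq count_predT iter_addr_0 -[s *+ _]mulr_natr.
  have szR : (size V)%:R <= (size V0)%:R :> R by rewrite ler_nat.
  apply: (@le_trans _ _ (s * ((size V0)%:R + 1))).
    by apply: ler_wpM2l; [exact: ltW|lra].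
  by rewrite /s divfK// gt_eqF.
lra.
Qed.

Lemma cf_dist2 th th' j : Theta th -> Theta th' ->
  Ex P (fun w => (cf (u th) j w - cf (u th') j w) ^+ 2) = dist2 th th'.
Proof.
move=> h h'.
have mf : cmeas Ycal (fun v => u th v - u th' v) by apply: cmeasB; exact: mu.
have f2 : L2 P (cf (fun v => u th v - u th' v) (cell1 k)) by apply: L2B; exact: u_L2.
exact: (cf_Ex2 mN mY YY exch j mf f2).
Qed.

(* Over a finite cover, a pair of cover cells either contains no pair of
   parameters at small L2 distance, or contains pairs at arbitrarily small L2
   distance; along the latter the increment is almost surely arbitrarily small. *)
Lemma cf_as_equicont j e : 0 < e -> exists s Nn, [/\ 0 < s, measurable Nn, P Nn = 0%E &
  forall w, ~ Nn w -> forall th th', Theta th -> Theta th' -> dist2 th th' <= s ->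
  `|cf (u th) j w - cf (u th') j w| <= e * (1 + 4 * cf W j w)].
Proof.
move=> e0; have [q hq] := eps_cvg e0.
pose Q (p : Th * Th) (m : nat) w := forall th th', Theta th -> Theta th' ->
  pi q th = p.1 -> pi q th' = p.2 -> dist2 th th' <= m.+1%:R^-1 ->
  `|cf (u th) j w - cf (u th') j w| <= e * (1 + 4 * cf W j w).
have Qmono p m m' w : (m <= m')%N -> Q p m w -> Q p m' w.
  move=> mm h th th' h1 h2 h3 h4 h5; apply: h => //; apply: le_trans h5 _.
  by rewrite lef_pV2 ?posrE ?ltr0n// ler_nat.
have one p : exists m Nn, [/\ measurable Nn, P Nn = 0%E & forall w, ~ Nn w -> Q p m w].
  have [[m hm]|act] := pselect (exists m : nat, forall th th', Theta th -> Theta th' ->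
      pi q th = p.1 -> pi q th' = p.2 -> ~ (dist2 th th' <= m.+1%:R^-1)).
    exists m, set0; split; [exact: measurable0|exact: measure0|].
    move=> w _ th th' h1 h2 h3 h4 h5; case: (hm th th' h1 h2 h3 h4 h5).
  have {}act m : exists tt : Th * Th, [/\ Theta tt.1, Theta tt.2, pi q tt.1 = p.1, pi q tt.2 = p.2 &
      dist2 tt.1 tt.2 <= m.+1%:R^-1].
    apply: contrapT => h; apply: act; exists m => th th' h1 h2 h3 h4 h5; apply: h.
    by exists (th, th').
  have [tt ttP] := choice act.
  pose A m := [set w | e < `|cf (u (tt m).1) j w - cf (u (tt m).2) j w|].
  have dL m : L2 P (fun w => cf (u (tt m).1) j w - cf (u (tt m).2) j w).
    by have [h1 h2 _ _ _] := ttP m; apply: L2B; exact: u_L2.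
  have mA m : measurable (A m).
    rewrite -[A m]setTI.
    have /(_ measurableT `]e, +oo[%classic (measurable_itv _)) : measurable_fun setT (fun w => `|cf (u (tt m).1) j w - cf (u (tt m).2) j w|).
      by apply: measurableT_comp => //; exact: (dL m).1.
    by congr measurable; congr (_ `&` _); apply/seteqP; split => w /=; rewrite in_itv/= andbT.
  (* Exceptional set: all test pairs differ by more than [e]. By Markov's inequality [A m] has
     probability at most [1 / ((m + 1) e^2)]. *)
  exists 0%N, (\bigcap_m A m); split.
  - exact: bigcap_measurable.
  - apply/eqP; rewrite eq_le measure_ge0 andbT; apply/lee_addgt0Pr => c c0.
    rewrite add0e.
    have [m hm] : exists m : nat, m.+1%:R^-1 <= c * e ^+ 2.
      exists (Num.truncn (c * e ^+ 2)^-1).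
      rewrite -[leRHS]invrK lef_pV2 ?posrE ?invr_gt0 ?mulr_gt0 ?exprn_gt0//.
      by apply: ltW; exact: truncnS_gt.
    apply: (@le_trans _ _ (P (A m))).
      apply: le_measure; rewrite ?inE//; first exact: bigcap_measurable.
      by apply: bigcap_inf.
    apply: le_trans (@markovEx _ _ _ P _ (A m) (e ^+ 2) (exprn_gt0 _ e0) (dL m).2 (mA m) _ _) _.
    + by move=> w; exact: sqr_ge0.
    + move=> w /= h; rewrite -[X in _ <= X]real_normK ?num_real//.
      by rewrite lerXn2r ?nnegrE// ltW.
    rewrite lee_fin ler_pdivrMr ?exprn_gt0//.
    have [h1 h2 _ _ h5] := ttP m.
    by rewrite cf_dist2//; apply: le_trans h5 hm.
  move=> w nw th th' h1 h2 h3 h4 _.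
  have [m nA] : exists m, ~ A m w.
    apply: contrapT => h; apply: nw => m _; apply: contrapT => h'; apply: h.
    by exists m.
  have {nA}Am : `|cf (u (tt m).1) j w - cf (u (tt m).2) j w| <= e.
    by rewrite leNgt; apply/negP.
  have [t1 t2 t3 t4 _] := ttP m.
  have W0 : 0 <= cf W j w.
    by have := le_trans (normr_ge0 _) (pi_close q j w h1); rewrite pmulr_rge0.
  (* Some test pair in the same two cover cells differs by at most [e]; reaching it takes four
     approximations of cost [eps q * W], the origin of [1 + 4 * W]. *)
  have eW : eps q * cf W j w <= e * cf W j w by rewrite ler_wpM2r.
  have c1 := pi_close q j w h1; have c2 := pi_close q j w h2.
  have c3 := pi_close q j w t1; have c4 := pi_close q j w t2.
  rewrite t3 -h3 in c3; rewrite t4 -h4 in c4.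
  move: c1 c2 c3 c4 Am; rewrite !ler_norml => /andP[? ?] /andP[? ?] /andP[? ?] /andP[? ?] /andP[? ?].
  by apply/andP; split; lra.
have all (s : seq (Th * Th)) : exists m Nn, [/\ measurable Nn, P Nn = 0%E &
    forall w, ~ Nn w -> forall p, p \in s -> Q p m w].
  elim: s => [|p s [m [Nn [mNn PN h]]]].
    by exists 0%N, set0; split; [exact: measurable0|exact: measure0|].
  have [m' [Nn' [mNn' PN' h']]] := one p.
  exists (maxn m m'), (Nn `|` Nn'); split.
  - exact: measurableU.
  - apply/eqP; rewrite eq_le measure_ge0 andbT -[leRHS]adde0 -{1}PN -PN'.
    exact: measureU2.
  move=> w nw p'; rewrite inE => /predU1P[->|ps].
    by apply: (Qmono _ m'); [exact: leq_maxr|apply: h' => h1; apply: nw; right].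
  by apply: (Qmono _ m); [exact: leq_maxl|apply: h => // h1; apply: nw; left].
have [m [Nn [mNn PN h]]] := all [seq (v, v') | v <- Tq q, v' <- Tq q].
exists m.+1%:R^-1, Nn; split => // w nw th th' h1 h2 hd.
apply: (h w nw (pi q th, pi q th')) => //.
by apply/allpairsP; exists (pi q th, pi q th'); split => //; exact: piT.
Qed.

End Chaining.

(** * Entropy integral and covers *)

Section Entropy.
Context {R : realType}.

Lemma nonincreasing_emeasurable (f : R -> \bar R) :
  (forall x y, x <= y -> (f y <= f x)%E) -> measurable_fun setT f.
Proof.
move=> fni; apply: (measurability _ (ErealGenOInfty.measurableE R)) => //.
move=> _ [_ [r ->] <-]; rewrite setTI.
apply: is_interval_measurable => s t /=; rewrite !in_itv/= !andbT => fs ft w /andP[_ wt].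
by rewrite in_itv/= andbT; exact: lt_le_trans ft (fni _ _ wt).
Qed.

Definition dyad (q : nat) : R := 2^-1 ^+ q.

Lemma dyad_gt0 q : 0 < dyad q.
Proof. by rewrite exprn_gt0// invr_gt0. Qed.

Lemma dyadS q : dyad q = 2 * dyad q.+1.
Proof. by rewrite /dyad exprS mulrA divff ?mul1r. Qed.

Lemma dyad_sum Q : \sum_(q < Q) dyad q <= 2.
Proof.
suff -> : \sum_(q < Q) dyad q = 2 - 2 * dyad Q by rewrite gerBl; have := dyad_gt0 Q; lra.
elim: Q => [|Q IH]; first by rewrite big_ord0 /dyad expr0 mulr1 subrr.
by rewrite big_ord_recr/= IH (dyadS Q); ring.
Qed.

Lemma dyad_cvg (c e : R) : 0 < e -> exists q, c * dyad q <= e.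
Proof.
move=> e0; exists (Num.truncn (`|c| / e)).+1.
set q := _.+1.
have qd : q%:R * dyad q <= 1.
  have h : forall a : nat, a%:R <= 2 ^+ a :> R.
    by move=> a; rewrite -natrX ler_nat ltnW// ltn_expl.
  by rewrite /dyad exprVn ler_pdivrMr ?exprn_gt0// mul1r.
have hq : `|c| / e <= q%:R by apply: ltW; exact: truncnS_gt.
have d0 := dyad_gt0 q.
apply: (@le_trans _ _ (`|c| * dyad q)); first by rewrite ler_pM2r// ler_norm.
rewrite ler_pdivrMr// mulrC in hq.
apply: (@le_trans _ _ (e * q%:R * dyad q)); first by rewrite ler_pM2r.
by rewrite -mulrA ger_pMr.
Qed.

(** On []dyad q.+1, dyad q]], of length [dyad q.+1], the function is at least [H (dyad q)]; the
    disjoint pieces add up to at most the integral. An infinite value would make its piece infinite,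
    so all these values are finite. *)
Lemma dyadic_entropy (H : R -> \bar R) : (forall x, 0 <= H x)%E ->
  (forall x y, x <= y -> (H y <= H x)%E) ->
  (\int[lebesgue_measure]_(x in [set x : R | (0 <= x)%R]) H x < +oo)%E ->
  exists h : nat -> R, (forall q, H (dyad q) = (h q)%:E) /\
    exists B, forall Q, \sum_(q < Q) dyad q * h q <= B.
Proof.
move=> H0 Hni; set J := (\int[_]_(_ in _) _)%E => Jy.
have mH := nonincreasing_emeasurable Hni.
have eD : [set x : R | 0 <= x] = `[0, +oo[%classic.
  by apply/seteqP; split => x /=; rewrite in_itv/= andbT.
have piece q : ((dyad q.+1)%:E * H (dyad q) <= \int[lebesgue_measure]_(x in `]dyad q.+1, dyad q]%classic) H x)%E.
  have m1 : measurable (`]dyad q.+1, dyad q]%classic : set R) by exact: measurable_itv.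
  apply: (@le_trans _ _ (\int[lebesgue_measure]_(x in `]dyad q.+1, dyad q]%classic) (cst (H (dyad q)) x))%E).
    have mE : lebesgue_measure (`]dyad q.+1, dyad q]%classic : set R) = (dyad q.+1)%:E.
      rewrite [LHS]lebesgue_measure_itv/= lte_fin ifT; last by have := dyad_gt0 q.+1; rewrite (dyadS q); lra.
      by rewrite -EFinB (dyadS q); congr EFin; ring.
    by rewrite integral_cst// muleC; apply: lee_wpmul2l => //; rewrite -mE.
  apply: ge0_le_integral => //.
  - by move=> x _; exact: H0.
  - exact: measurable_funTS.
  - by move=> x /=; rewrite in_itv/= => /andP[_ xq]; exact: Hni.
have chain Q : (\sum_(q < Q) (dyad q.+1)%:E * H (dyad q) <=
    \int[lebesgue_measure]_(x in `]dyad Q, 1%R]%classic) H x)%E.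
  elim: Q => [|Q IH]; first by rewrite big_ord0; exact: integral_ge0.
  rewrite big_ord_recr/=.
  have -> : `]dyad Q.+1, 1%R]%classic = `]dyad Q.+1, dyad Q]%classic `|` `]dyad Q, 1%R]%classic :> set R.
    apply/seteqP; split => x /=; rewrite !in_itv/=.
      by move=> /andP[h1 h2]; case: (leP x (dyad Q)) => h3; [left|right]; rewrite ?h1 ?h2.
    have d0 := dyad_gt0 Q.+1; have dS := dyadS Q.
    have d1 : dyad Q <= 1 by rewrite /dyad exprn_ile1// ?invr_ge0// invf_le1// ler1n.
    by case => /andP[h1 h2]; apply/andP; split; lra.
  rewrite ge0_integral_setU//; last 2 first.
  - exact: measurable_funTS.
  - apply/disj_setPS => x /= []; rewrite !in_itv/= => /andP[_ h1] /andP[h2 _].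
    by move: h2; rewrite ltNge h1.
  by rewrite addeC; apply: leeD => //; exact: piece.
have sub Q : (\int[lebesgue_measure]_(x in `]dyad Q, 1%R]%classic) H x <= J)%E.
  rewrite /J eD; apply: ge0_subset_integral => //.
  - exact: measurable_funTS.
  - move=> x /=; rewrite !in_itv/= andbT => /andP[h _]; apply: ltW; apply: le_lt_trans h.
    exact: ltW (dyad_gt0 _).
have fin q : H (dyad q) \is a fin_num.
  rewrite ge0_fin_numE// ltNge; apply/negP; rewrite leye_eq => /eqP Hy.
  have : (\sum_(q < q.+1) (dyad q.+1)%:E * H (dyad q) <= J)%E := le_trans (chain q.+1) (sub q.+1).
  rewrite big_ord_recr/= Hy gt0_muley ?lte_fin ?dyad_gt0//.
  rewrite addey; first by rewrite leye_eq => /eqP h; rewrite h ltxx in Jy.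
  have : (0 <= \sum_(i < q) (dyad i.+1)%:E * H (dyad i))%E.
    by apply: sume_ge0 => i _; rewrite mule_ge0// lee_fin ltW// dyad_gt0.
  by case: (\sum_(_ < _) _)%E.
exists (fun q => fine (H (dyad q))); split; first by move=> q; rewrite fineK.
have Jfin : J \is a fin_num by rewrite ge0_fin_numE//; exact: integral_ge0.
exists (2 * fine J) => Q.
have : (\sum_(q < Q) (dyad q.+1)%:E * H (dyad q) <= J)%E := le_trans (chain Q) (sub Q).
rewrite -(fineK Jfin) (eq_bigr (fun q : 'I_Q => (dyad q.+1 * fine (H (dyad q)))%:E)); last first.
  by move=> q _; rewrite EFinM fineK.
rewrite sumEFin lee_fin => h.
rewrite (eq_bigr (fun q : 'I_Q => 2 * (dyad q.+1 * fine (H (dyad q))))); last first.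
  by move=> q _; rewrite mulrA -(dyadS q).
by rewrite -mulr_sumr ler_pM2l.
Qed.

Lemma sqrtD_le (x y : R) : 0 <= x -> 0 <= y -> Num.sqrt (x + y) <= Num.sqrt x + Num.sqrt y.
Proof.
move=> x0 y0; rewrite -(@ler_pXn2r _ 2) ?nnegrE ?addr_ge0 ?sqrtr_ge0//.
rewrite sqr_sqrtr ?addr_ge0// sqrrD !sqr_sqrtr//.
by rewrite addrAC lerDl mulrn_wge0// mulr_ge0 ?sqrtr_ge0.
Qed.

End Entropy.

Section Covering.
Context {R : realType} {l : nat} (Ycal : set 'rV[R]_l) (beta : R).

(** Inverse of the weight in the norm: radius [e] in the weighted norm means the pointwise bound
    [e * wt y] on [Ycal], and the sum of [wt] over a cell is the square-integrable variable of
    (A3'). *)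
Definition wt (y : 'rV[R]_l) : R := (1 + sqnorm y) `^ (- beta / 2).

Lemma sqnorm_ge0 (p : nat) (y : 'rV[R]_p) : 0 <= sqnorm y.
Proof. by apply: sumr_ge0 => s _; exact: sqr_ge0. Qed.

Lemma wt_gt0 y : 0 < wt y.
Proof. by apply: powR_gt0; rewrite ltr_wpDr ?sqnorm_ge0. Qed.

Lemma wnorm_le f e y : (wnorm Ycal beta f <= e%:E)%E -> Ycal y -> `|f y| <= e * wt y.
Proof.
move=> fe Yy; have : ((`|f y * (1 + sqnorm y) `^ (beta / 2)|)%:E <= e%:E)%E.
  by apply: le_trans fe; apply: ereal_sup_ubound; exists y.
have p : 0 < (1 + sqnorm y) `^ (beta / 2) by apply: powR_gt0; rewrite ltr_wpDr ?sqnorm_ge0.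
rewrite lee_fin normrM (gtr0_norm p) -ler_pdivlMr//.
by rewrite /wt mulNr powRN.
Qed.

Lemma wt_borel : borel_fun_on Ycal wt.
Proof.
have cont : continuous (fun y : 'rV[R]_l => sqnorm y).
  have -> : (fun y : 'rV[R]_l => sqnorm y) = (fun y => \sum_(s < l) y ord0 s * y ord0 s).
    by apply/funext => y; apply: eq_bigr => s _; rewrite expr2.
  by move=> y; apply: (@cvg_sum _ _ _ _ _ (nbhs y) (nbhs_filter y)) => s _; apply: cvgM; exact: coord_continuous.
pose ET := g_sigma_algebraType [set O : set 'rV[R]_l | open O].
have mq : measurable_fun setT (fun y : ET => sqnorm y).
  apply: (measurability _ (RGenOpens.measurableE R)).
  move=> _ [_ [a [b ->] <-]]; rewrite setTI; apply: sub_sigma_algebra.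
  by move/continuousP : cont; apply; exact: interval_open.
have mw : measurable_fun setT (fun y : ET => wt y).
  by apply: (measurableT_comp (measurable_powR (- beta / 2))); apply: measurable_funD.
move=> B mB; exists (wt @^-1` B); split => //.
by have := mw measurableT B mB; rewrite setTI.
Qed.

Variables (Th : choiceType) (Theta : set Th) (h : Th -> 'rV[R]_l -> R) (th0 : Th).
Hypothesis h0 : Theta th0.
Let FF := [set f | exists2 th, Theta th & f = h th].

Lemma cover_gt0 e gs : eps_cover Ycal beta FF e gs -> (0 < size gs)%N.
Proof.
move=> /(_ (h th0)) [|[i i_lt] _]; first by exists th0.
exact: leq_ltn_trans i_lt.
Qed.

(** A non-empty class needs a non-empty cover. Logarithms of covering numbers are thus non-negative,
    which is the range where [sqrt_log_e] is monotone. *)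
Lemma covnum_ge1 e : (1%:E <= covnum Ycal beta FF e)%E.
Proof.
apply: le_ereal_inf_tmp; move=> _ [n [gs [<- /cover_gt0 g0]] <-].
by rewrite lee_fin ler1n.
Qed.

Lemma covnum_mono e e' : e <= e' -> (covnum Ycal beta FF e' <= covnum Ycal beta FF e)%E.
Proof.
move=> ee; apply: ereal_inf_le_tmp => _ [n [gs [gn hc]] <-]; exists n => //.
exists gs; split => // f Ff; have [i hi] := hc f Ff; exists i.
by apply: lt_le_trans hi _; rewrite lee_fin.
Qed.

Lemma sqrt_log_mono (x y : \bar R) : (1%:E <= x)%E -> (x <= y)%E -> (sqrt_log_e x <= sqrt_log_e y)%E.
Proof.
case: x => [x| |] //; case: y => [y| |] //; rewrite ?lee_fin ?leey//= => x1 xy.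
by apply: ler_wsqrtr; rewrite ler_ln ?posrE//; lra.
Qed.

Lemma sqrt_log_ge0 (x : \bar R) : (0 <= sqrt_log_e x)%E.
Proof. by case: x => //= r; rewrite lee_fin sqrtr_ge0. Qed.

(* The covering centers need not belong to the class: replacing each by a
   member of its ball doubles the radius. *)
Lemma cover_proj e c : (covnum Ycal beta FF e = c%:E)%E ->
  exists (Tl : seq Th) (pr : Th -> Th), [/\ (size Tl)%:R <= 2 * c, forall th, Theta th -> pr th \in Tl,
    forall th, th \in Tl -> Theta th &
    forall th y, Theta th -> Ycal y -> `|h th y - h (pr th) y| <= 2 * e * wt y].
Proof.
move=> ce.
have c1 : 1 <= c by have := covnum_ge1 e; rewrite ce lee_fin.
(* Some cover has fewer than [c + 1 <= 2 * c] elements; attainment of the infimum is not invoked. *)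
have : (covnum Ycal beta FF e < (c + 1)%:E)%E by rewrite ce lte_fin; lra.
move=> /ereal_inf_lt[_ [n [gs [gn hc]] <-]]; rewrite lte_fin => nc.
pose near_ th i := (wnorm Ycal beta (fun y => (h th y - nth (fun=> 0) gs i y)%R) < e%:E)%E.
have /choice[idx idxP] : forall th, exists i : nat, Theta th -> (i < size gs)%N /\ near_ th i.
  move=> th; have [ht|nt] := pselect (Theta th); last by exists 0%N.
  by have [|i hi] := hc (h th); [exists th|exists i].
(* Balls that meet no member of the class are represented by the default [th0]. *)
have /choice[rep repP] : forall i, exists th, Theta th /\ ((exists2 th', Theta th' & near_ th' i) -> near_ th i).
  move=> i; have [[th ht hn]|nn] := pselect (exists2 th', Theta th' & near_ th' i).
    by exists th.
  by exists th0.
exists [seq rep i | i <- iota 0 n], (fun th => rep (idx th)); split.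
- by rewrite size_map size_iota; lra.
- by move=> th /idxP[hi _]; apply: map_f; rewrite mem_iota add0n -gn.
- by move=> th /mapP[i _ ->]; have [] := repP i.
move=> th y ht Yy; have [_ n1] := idxP th ht.
have [_ /(_ (ex_intro2 _ _ th ht n1)) n2] := repP (idx th).
have b1 := wnorm_le (ltW n1) Yy; have b2 := wnorm_le (ltW n2) Yy.
move: b1 b2; set a := nth _ _ _ _; set b := h th y; set b' := h _ y => b1 b2.
rewrite (_ : b - b' = (b - a) - (b' - a)); last by ring.
by apply: le_trans (ler_normB _ _) _; lra.
Qed.

End Covering.

(** * One coordinate of the moment function *)

Section Component.
Context {R : realType} {d} {T : measurableType d} (P : probability T R).
Context {k l p : nat} (Ycal : set 'rV[R]_l).
Context (N : cell k -> T -> nat) (Y : cell k -> nat -> T -> 'rV[R]_l).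
Hypothesis mN : forall j n, measurable [set w | N j w = n].
Hypothesis mY : forall j ell s, measurable_fun setT (fun w => Y j ell w ord0 s).
Hypothesis YY : forall j ell w, Ycal (Y j ell w).
Hypothesis exch : sep_exchangeable P N Y.
Hypothesis bind : block_independent P N Y.
Hypothesis k0 : (0 < k)%N.
Variables (Theta : set 'rV[R]_p) (th0 : 'rV[R]_p) (h : 'rV[R]_p -> 'rV[R]_l -> R).
Hypothesis h0 : Theta th0.
Hypothesis bh : forall th, Theta th -> borel_fun_on Ycal (h th).
Hypothesis A3 : cond_A3' P N Y Ycal [set f | exists2 th, Theta th & f = h th].

Lemma component_chain : exists (W : (nat * (nat -> 'rV[R]_l)) -> R) (b : R)
  (Tq : nat -> seq 'rV[R]_p) (pi : nat -> 'rV[R]_p -> 'rV[R]_p) (eps : nat -> R),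
  [/\ cmeas Ycal W, L2 P (cf N Y W (cell1 k)), 0 <= b &
   [/\ forall th j w, Theta th -> `|cf N Y (cfun (h th)) j w| <= b * cf N Y W j w,
   forall q, 0 < eps q, forall q, eps q.+1 <= eps q, forall e, 0 < e -> exists q, eps q <= e &
   [/\ forall q th, Theta th -> pi q th \in Tq q, forall q th, th \in Tq q -> Theta th,
   forall q th j w, Theta th ->
    `|cf N Y (cfun (h th)) j w - cf N Y (cfun (h (pi q th))) j w| <= eps q * cf N Y W j w &
   exists B, forall Q, \sum_(q < Q) chain_term Tq eps q <= B]]].
Proof.
have [beta [F [bF [hF [Ffin [Wint ent]]]]]] := A3.
pose FF := [set f | exists2 th, Theta th & f = h th].
pose Nf : R := fine (wnorm Ycal beta F).
pose w0 : T := point.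
(* A value of the array shows that [Ycal] is non-empty, so the supremum defining the norm of [F] is
   non-negative. *)
have y0 : Ycal (Y (cell1 k) 0%N w0) by exact: YY.
have Nf_ge : (0%:E <= wnorm Ycal beta F)%E.
  apply: (@le_trans _ _ (`|F (Y (cell1 k) 0%N w0) * (1 + sqnorm (Y (cell1 k) 0%N w0)) `^ (beta / 2)|)%:E).
    by rewrite lee_fin.
  by apply: ereal_sup_ubound; exists (Y (cell1 k) 0%N w0).
have NfE : wnorm Ycal beta F = Nf%:E by rewrite fineK// ge0_fin_numE.
have Nf0 : 0 <= Nf by exact: fine_ge0.
have Fb y : Ycal y -> `|F y| <= Nf * wt beta y by apply: wnorm_le; rewrite NfE.
have hb th y : Theta th -> Ycal y -> `|h th y| <= Nf * wt beta y.
  move=> ht Yy; apply: le_trans (Fb y Yy); apply: le_trans (ler_norm _).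
  by apply: hF => //; exists th.
pose H (x : R) := sqrt_log_e (covnum Ycal beta FF (x * Nf)).
have [hq [hqE [B hB]]] : exists hq : nat -> R, (forall q, H (dyad q) = (hq q)%:E) /\
    exists B, forall Q, \sum_(q < Q) dyad q * hq q <= B.
  apply: dyadic_entropy => [x|x y xy|//]; first exact: sqrt_log_ge0.
  apply: sqrt_log_mono; first exact: (covnum_ge1 _ _ _ h0).
  by apply: covnum_mono; rewrite ler_wpM2r.
have hq0 q : 0 <= hq q by rewrite -lee_fin -hqE; exact: sqrt_log_ge0.
have /choice[c cE] : forall q, exists c : R, covnum Ycal beta FF (dyad q * Nf) = c%:E /\ hq q = Num.sqrt (ln c).
  move=> q; have := hqE q; rewrite /H.
  by case: (covnum _ _ _ _) => [c| |] //= [<-]; exists c.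
have c1 q : 1 <= c q by have := covnum_ge1 Ycal beta h h0 (dyad q * Nf); rewrite -/FF (cE q).1 lee_fin.
have /choice[Tp TpP] : forall q, exists Tp : seq 'rV[R]_p * ('rV[R]_p -> 'rV[R]_p),
   [/\ (size Tp.1)%:R <= 2 * c q, forall th, Theta th -> Tp.2 th \in Tp.1,
    forall th, th \in Tp.1 -> Theta th &
    forall th y, Theta th -> Ycal y -> `|h th y - h (Tp.2 th) y| <= 2 * (dyad q * Nf) * wt beta y].
  by move=> q; have [Tl [pr hh]] := cover_proj h0 (cE q).1; exists (Tl, pr).
pose W := cfun (wt beta : 'rV[R]_l -> R).
(* The factor 2 is the loss of [cover_proj]; [Nf + 1] instead of [Nf] keeps the mesh positive when
   the envelope has norm 0. *)
pose eps q : R := 2 * dyad q * (Nf + 1).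
have eps0 q : 0 < eps q by rewrite /eps mulr_gt0 ?mulr_gt0 ?dyad_gt0//; lra.
exists W, Nf, (fun q => (Tp q).1), (fun q => (Tp q).2), eps; split => //.
- by apply: cmeas_cfun; exact: wt_borel.
- have mW : measurable_fun setT (cf N Y W (cell1 k)).
    by apply: (cf_measurable mN mY YY (Ycal := Ycal)); apply: cmeas_cfun; exact: wt_borel.
  split => //; apply/integrableP; split.
    by apply/measurable_EFinP; exact: measurable_funX.
  apply: le_lt_trans Wint; rewrite le_eqVlt; apply/orP; left; apply/eqP.
  by apply: eq_integral => w _; rewrite /= ger0_norm ?sqr_ge0.
have sumb (f : 'rV[R]_l -> R) e j w : (forall y, Ycal y -> `|f y| <= e * wt beta y) ->
    `|cf N Y (cfun f) j w| <= e * cf N Y W j w.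
  move=> fe; rewrite /cf /W /cfun /= mulr_sumr.
  by apply: le_trans (ler_norm_sum _ _ _) _; apply: ler_sum => i _; exact: fe.
split => //.
- by move=> th j w ht; apply: sumb => y; exact: hb.
- by move=> q; rewrite /eps (dyadS q); apply: ler_wpM2r; [|have := @dyad_gt0 R q.+1]; lra.
- by move=> e e0; have [q hqe] := dyad_cvg (2 * (Nf + 1)) e0; exists q; rewrite /eps mulrAC.
split.
- by move=> q th ht; have [_ hp _ _] := TpP q; exact: hp.
- by move=> q th; have [_ _ hp _] := TpP q; exact: hp.
- move=> q th j w ht; have [_ _ _ hp] := TpP q.
  have -> : cf N Y (cfun (h th)) j w - cf N Y (cfun (h ((Tp q).2 th))) j w =
      cf N Y (cfun (fun y => h th y - h ((Tp q).2 th) y)) j w.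
    by rewrite /cf /cfun /= sumrB.
  apply: sumb => y Yy; apply: le_trans (hp th y ht Yy) _.
  apply: ler_wpM2r; first exact: ltW (wt_gt0 _ _).
  by rewrite /eps mulrA; apply: ler_wpM2l; [rewrite mulr_ge0// ltW// dyad_gt0|lra].
exists (2 * (Nf + 1) * (Num.sqrt (ln 8) * 2 + 2 * B + B)) => Q.
have sz q : (0 < size (Tp q).1)%N.
  by have [_ /(_ th0 h0) + _ _] := TpP q; case: (Tp q).1.
have term q : chain_term (fun q => (Tp q).1) eps q <=
    2 * (Nf + 1) * (Num.sqrt (ln 8) * dyad q + 2 * (dyad q.+1 * hq q.+1) + dyad q * hq q).
  have [s1 _ _ _] := TpP q; have [s2 _ _ _] := TpP q.+1.
  have c1q := c1 q; have c1q' := c1 q.+1.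
  have s0 : 0 < (size (Tp q).1)%:R :> R by rewrite ltr0n.
  have s0' : 0 < (size (Tp q.+1).1)%:R :> R by rewrite ltr0n.
  (* 8 is the factor 2 inside the logarithm times the losses [size <= 2 * c] at the two levels. *)
  have key : Num.sqrt (ln (2 * (size (Tp q.+1).1 * size (Tp q).1)%:R)) <=
      Num.sqrt (ln 8) + hq q.+1 + hq q.
    rewrite (cE q).2 (cE q.+1).2.
    have l0 x : 1 <= x -> 0 <= ln x :> R by move=> x1; apply: ln_ge0.
    have l8 : 0 <= ln (8 : R) by apply: l0; rewrite ler1n.
    apply: le_trans (lerD (sqrtD_le l8 (l0 _ c1q')) (lexx _)).
    apply: le_trans (sqrtD_le (addr_ge0 l8 (l0 _ c1q')) (l0 _ c1q)).
    have p8 : 0 < 8 :> R by [].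
    have cp : 0 < c q by lra.
    have cp' : 0 < c q.+1 by lra.
    rewrite -lnM ?posrE// -lnM ?posrE ?mulr_gt0//.
    apply: ler_wsqrtr; rewrite ler_ln ?posrE ?mulr_gt0//; last by rewrite ltr0n muln_gt0 !sz.
    by rewrite natrM; nra.
  rewrite /chain_term; apply: le_trans (ler_wpM2l (ltW (eps0 q)) key) _.
  by rewrite /eps le_eqVlt; apply/orP; left; apply/eqP; rewrite (dyadS q); ring.
apply: (@le_trans _ _ (\sum_(q < Q) 2 * (Nf + 1) * (Num.sqrt (ln 8) * dyad q + 2 * (dyad q.+1 * hq q.+1) + dyad q * hq q))).
  by apply: ler_sum => q _; exact: term.
rewrite -mulr_sumr; apply: ler_wpM2l; first by apply: mulr_ge0 => //; lra.
rewrite !big_split/= -!mulr_sumr; apply: lerD; last exact: hB.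
apply: lerD.
  by apply: ler_wpM2l; [exact: sqrtr_ge0|exact: dyad_sum].
rewrite ler_pM2l//; apply: le_trans (hB Q.+1).
by rewrite big_ord_recl/= lerDr mulr_ge0// ltW// dyad_gt0.
Qed.

Definition cemp (C : cell k) (n : nat) th w : R :=
  Num.sqrt n%:R * (gmean C (fun j => cellf N Y (h th) j w) - Ex P (cellf N Y (h th) (cell1 k))).

Definition cdist2 th th' : R :=
  Ex P (fun w => (cellf N Y (h th) (cell1 k) w - cellf N Y (h th') (cell1 k) w) ^+ 2).

(** Interface between chaining and estimation: square integrability, bounded and equicontinuous
    empirical process, almost sure modulus of the cell sums. Covers and envelopes do not appear
    beyond it. *)
Lemma gmm_component : [/\ forall th j, Theta th -> L2 P (cellf N Y (h th) j),
  (exists K, forall C n F, (0 < n)%N -> (forall i, (n <= C i)%N) ->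
    (forall th, th \in F -> Theta th) -> Ex P (fun w => bmax F (fun th => cemp C n th w)) <= K),
  (forall e, 0 < e -> exists2 s, 0 < s & forall C n th0 F, (0 < n)%N ->
    (forall i, (n <= C i)%N) -> Theta th0 -> (forall th, th \in F -> Theta th /\ cdist2 th th0 <= s ^+ 2) ->
    Ex P (fun w => bmax F (fun th => cemp C n th w - cemp C n th0 w)) <= e) &
  exists W : cell k -> T -> R, forall j e, 0 < e -> exists s Nn, [/\ 0 < s, measurable Nn, P Nn = 0%E &
    forall w, ~ Nn w -> forall th th', Theta th -> Theta th' -> cdist2 th th' <= s ->
    `|cellf N Y (h th) j w - cellf N Y (h th') j w| <= e * W j w]].
Proof.
have [W [b [Tq [pi [eps [mW W2 b0 [uW eps0 epsS epsc [piT TT pic cs]]]]]]]] := component_chain.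
pose u th := cfun (h th).
have mu th : Theta th -> cmeas Ycal (u th) by move=> ht; apply: cmeas_cfun; exact: bh.
split.
- by move=> th j ht; exact (u_L2 mN mY YY exch mu W2 uW j ht).
- exact (emp_bounded mN mY YY exch bind k0 mu mW W2 b0 uW eps0 epsS epsc piT TT pic cs).
- exact (emp_equicont mN mY YY exch bind k0 mu mW W2 uW eps0 epsS epsc piT TT pic cs).
exists (fun j w => 1 + 4 * cf N Y W j w).
exact (cf_as_equicont mN mY YY exch mu W2 uW eps0 epsc piT pic).
Qed.

End Component.

(** * Levy's continuity theorem *)

Section RowNorm.
Context {R : realType} {p : nat}.
Implicit Types v : 'rV[R]_p.

Lemma le_row_norm v s : `|v ord0 s| <= `|v|.
Proof.
rewrite [leRHS]mx_normrE; apply: (le_trans _ (le_bigmax _ _ (ord0, s))) => //=.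
Qed.

Lemma row_norm_le v c : 0 <= c -> (forall s, `|v ord0 s| <= c) -> `|v| <= c.
Proof.
move=> c0 vc; have [v0|v0] := eqVneq `|v| 0; first by rewrite v0.
have [[i j] /= vE] := @mx_norm_neq0 _ _ _ v v0.
by rewrite [leLHS]vE (ord1 i); exact: vc.
Qed.

Lemma compact_unif_cont (K : set 'rV[R]_p) (f : 'rV[R]_p -> R) :
  compact K -> (forall x, K x -> f y @[y --> within K (nbhs x)] --> f x) ->
  forall e, 0 < e -> exists2 dl, 0 < dl &
    forall x y, K x -> K y -> `|x - y| < dl -> `|f x - f y| <= e.
Proof.
move=> cK cf e e0.
have nc := (near_covering_withinP K).2 ((compact_near_coveringP K).1 cK).
have := nc R (0^'+) (fun dl x => forall y, K y -> `|x - y| < dl -> `|f x - f y| <= e) _.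
case.
  move=> x Kx; have e2 : 0 < e / 2 by rewrite divr_gt0.
  have : \forall y \near within K (nbhs x), `|f x - f y| < e / 2.
    have := cf x Kx; move=> /cvgrPdist_lt /(_ _ e2); exact.
  rewrite near_withinE => /nbhs_ballP[r /= r0 hr].
  have r2 : 0 < r / 2 by rewrite divr_gt0.
  exists (ball x (r / 2), [set dl | dl < r / 2]) => /=.
    split; first exact: nbhsx_ballx.
    exact: nbhs_right_lt.
  move=> [x' dl] /= [xx' dlr] Kx' y Ky x'y.
  rewrite -ball_normE/= in xx'.
  have h1 : `|f x - f x'| < e / 2.
    by apply: hr => //; rewrite -ball_normE/=; lra.
  have h2 : `|f x - f y| < e / 2.
    apply: hr => //; rewrite -ball_normE/= -(subrKA x').
    by apply: le_lt_trans (ler_normD _ _) _; lra.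
  rewrite -(subrKA (f x)); apply: le_trans (ler_normD _ _) _.
  by rewrite (distrC (f x')); lra.
move=> dl /= dl0 hdl.
exists (dl / 2); first by rewrite divr_gt0.
move=> x y Kx Ky xy; apply: (hdl (dl / 2) _ _ x) => //=.
- by rewrite sub0r normrN gtr0_norm ?divr_gt0//; lra.
- by rewrite divr_gt0.
Qed.

Lemma cube_compact A : compact [set v : 'rV[R]_p | forall s, `|v ord0 s| <= A].
Proof.
have := @rV_compact R p (fun=> [set x : R | `|x| <= A]); apply => _.
rewrite (_ : mkset _ = `[- A, A]%classic); first exact: segment_compact.
by apply/seteqP; split => x /=; rewrite in_itv/= ler_norml.
Qed.

(* Bounding the modulus of continuity by a quadratic lets a second-moment
   estimate replace a Chebyshev argument. *)
Lemma cube_quadratic_modulus (f : 'rV[R]_p -> R) M A : continuous f -> (forall x, `|f x| <= M) ->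
  forall e, 0 < e -> exists2 c, 0 <= c & forall x y : 'rV[R]_p,
    (forall s, `|x ord0 s| <= A) -> (forall s, `|y ord0 s| <= A) ->
    `|f x - f y| <= e + c * \sum_(s < p) (x ord0 s - y ord0 s) ^+ 2.
Proof.
move=> cf fM e e0.
have M0 : 0 <= M by exact: le_trans (fM 0).
have cw x : [set v : 'rV[R]_p | forall s, `|v ord0 s| <= A] x ->
    f y @[y --> within [set v : 'rV[R]_p | forall s, `|v ord0 s| <= A] (nbhs x)] --> f x.
  by move=> _; apply: cvg_within_filter; exact: cf.
have [dl dl0 hdl] := compact_unif_cont (@cube_compact A) cw e0.
have dl2 : 0 < (dl / 2) ^+ 2 by rewrite exprn_gt0// divr_gt0.
(* If some coordinate differs by at least [dl / 2], the quadratic term alone reaches the trivial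
   bound [2 * M]. *)
exists (2 * M / (dl / 2) ^+ 2).
  by rewrite divr_ge0 ?mulr_ge0// ltW.
move=> x y hx hy.
have s0 : 0 <= \sum_(s < p) (x ord0 s - y ord0 s) ^+ 2 by apply: sumr_ge0 => s _; exact: sqr_ge0.
have [/forallP xy|/forallPn[s]] := boolP [forall s : 'I_p, `|x ord0 s - y ord0 s| < dl / 2].
  apply: (@le_trans _ _ e).
    apply: hdl => //; apply: (@le_lt_trans _ _ (dl / 2)); last by lra.
    by apply: row_norm_le => [|s]; [lra|rewrite !mxE ltW].
  by rewrite lerDl mulr_ge0// divr_ge0 ?mulr_ge0// ltW.
rewrite -leNgt => hs.
apply: (@le_trans _ _ (2 * M)).
  by apply: le_trans (ler_normB _ _) _; have := fM x; have := fM y; lra.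
apply: (@le_trans _ _ (2 * M / (dl / 2) ^+ 2 * \sum_(s < p) (x ord0 s - y ord0 s) ^+ 2)); last by lra.
rewrite mulrAC ler_pdivlMr// ler_wpM2l ?mulr_ge0//.
rewrite (bigD1 s)//= -[leLHS]addr0; apply: lerD; last by apply: sumr_ge0 => i _; exact: sqr_ge0.
rewrite -[leRHS]real_normK ?num_real// ler_sqr ?nnegrE//; lra.
Qed.

End RowNorm.

(** * Bernstein's kernel for biased signs *)

Section CoinFlips.
Context {R : realType} {I : finType}.
Implicit Types (y : I -> R) (e : {ffun I -> bool}).

Definition coin (b : bool) : R := if b then 1 else -1.

(** Probability of the outcome [e] for independent signs with means [y i], and at the same time a
    polynomial in the [y i]. *)
Definition coin_wt y e : R := \prod_i ((1 + coin (e i) * y i) / 2).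

Lemma coin_prod (a : I -> bool -> R) :
  \sum_(e : {ffun I -> bool}) \prod_i a i (e i) = \prod_i (a i true + a i false).
Proof.
rewrite (eq_bigr (fun i => \sum_(b : bool) a i b)); last by move=> i _; rewrite big_bool.
by rewrite bigA_distr_bigA.
Qed.

Lemma coin_wt_ge0 y e : (forall i, `|y i| <= 1) -> 0 <= coin_wt y e.
Proof.
move=> y1; apply: prodr_ge0 => i _; have := y1 i; rewrite ler_norml => /andP[a b].
by rewrite /coin; case: (e i); apply: divr_ge0 => //; lra.
Qed.

Lemma coin_wt_sum y : \sum_e coin_wt y e = 1.
Proof.
rewrite (coin_prod (fun i b => (1 + coin b * y i) / 2)) big1// => i _.
by rewrite /coin /=; field.
Qed.

Lemma coin_cov y i j : \sum_(e : {ffun I -> bool}) (coin (e i) - y i) * (coin (e j) - y j) * coin_wt y e =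
  if i == j then 1 - y i ^+ 2 else 0.
Proof.
pose a (h : I) (b : bool) := (if h == i then coin b - y h else 1) * ((if h == j then coin b - y h else 1) *
  ((1 + coin b * y h) / 2)).
rewrite (eq_bigr (fun e => \prod_h a h (e h))); last first.
  move=> e _; rewrite /a big_split/= big_split/= mulrA; congr (_ * _ * _).
    by rewrite -big_mkcond big_pred1_eq.
  by rewrite -big_mkcond big_pred1_eq.
rewrite coin_prod (bigD1 i)//= /a eqxx.
case: eqP => [<-|ij].
  rewrite big1 ?mulr1 => [|h /negbTE hi].
    by rewrite /coin; field.
  by rewrite hi /coin; field.
by rewrite /coin; rewrite (_ : _ + _ = 0) ?mul0r//; field.
Qed.

End CoinFlips.

Lemma continuous_bigsum {R : realType} (U : topologicalType) (I : Type) (r : seq I) (h : I -> U -> R) :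
  (forall i, continuous (h i)) -> continuous (fun x => \sum_(i <- r) h i x).
Proof.
move=> ch; elim: r => [|i r IH].
  rewrite (_ : (fun _ => _) = (fun=> 0)); first exact: cst_continuous.
  by apply/funext => x; rewrite big_nil.
rewrite (_ : (fun _ => _) = (fun x => h i x + \sum_(j <- r) h j x)).
  by move=> x; apply: continuousD; [exact: ch|exact: IH].
by apply/funext => x; rewrite big_cons.
Qed.

Section TrigPolynomials.
Context {R : realType} {p : nat}.
Implicit Types (f g : 'rV[R]_p -> R) (t x : 'rV[R]_p).

(** The free phase covers sines as well and makes the span of cosines closed under products, by the
    product-to-sum formula. *)
Inductive trigp : ('rV[R]_p -> R) -> Prop :=
| trig_cos t b : trigp (fun x => cos (b + (x *m t^T) ord0 ord0))
| trig_add f g : trigp f -> trigp g -> trigp (fun x => f x + g x)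
| trig_scale c f : trigp f -> trigp (fun x => c * f x).

Lemma eq_trigp f g : f =1 g -> trigp f -> trigp g.
Proof. by move=> /funext ->. Qed.

Lemma trig_cst c : trigp (fun=> c).
Proof.
apply: eq_trigp (trig_scale c (trig_cos 0 0)) => x.
by rewrite trmx0 mulmx0 mxE addr0 cos0 mulr1.
Qed.

Lemma trig_mul f g : trigp f -> trigp g -> trigp (fun x => f x * g x).
Proof.
move=> tf tg; elim: tf => [t b|f1 f2 _ h1 _ h2|c f1 _ h1].
- elim: tg => [t' b'|g1 g2 _ h1 _ h2|c g1 _ h1].
  + apply: eq_trigp (trig_scale (1 / 2) (trig_add (trig_cos (t + t') (b + b')) (trig_cos (t - t') (b - b')))) => x.
    rewrite linearD linearB/= mulmxDr mulmxBr !mxE.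
    set u := \sum_(j < _) _; set v := \sum_(j < _) _.
    rewrite (_ : b + b' + (u + v) = (b + u) + (b' + v)); last by ring.
    rewrite (_ : b - b' + (u - v) = (b + u) - (b' + v)); last by ring.
    by rewrite cosD cosB; field.
  + by apply: eq_trigp (trig_add h1 h2) => x; rewrite mulrDr.
  + by apply: eq_trigp (trig_scale c h1) => x; rewrite mulrCA.
- by apply: eq_trigp (trig_add h1 h2) => x; rewrite mulrDl.
- by apply: eq_trigp (trig_scale c h1) => x; rewrite mulrA.
Qed.

Lemma trig_sum (I : Type) (r : seq I) (h : I -> 'rV[R]_p -> R) :
  (forall i, trigp (h i)) -> trigp (fun x => \sum_(i <- r) h i x).
Proof.
move=> th; elim: r => [|i r IH].
  by apply: eq_trigp (trig_cst 0) => x; rewrite big_nil.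
by apply: eq_trigp (trig_add (th i) IH) => x; rewrite big_cons.
Qed.

Lemma trig_prod (I : Type) (r : seq I) (h : I -> 'rV[R]_p -> R) :
  (forall i, trigp (h i)) -> trigp (fun x => \prod_(i <- r) h i x).
Proof.
move=> th; elim: r => [|i r IH].
  by apply: eq_trigp (trig_cst 1) => x; rewrite big_nil.
by apply: eq_trigp (trig_mul (th i) IH) => x; rewrite big_cons.
Qed.

Lemma trig_sin_coord c s : trigp (fun x => sin (c * x ord0 s)).
Proof.
apply: eq_trigp (trig_cos (c *: delta_mx ord0 s) (- (pi / 2))) => x.
rewrite mxE (bigD1 s)//= big1 => [|s' /negbTE s's]; last first.
  by rewrite !mxE s's andbF !mulr0.
rewrite !mxE !eqxx mulr1 addr0 (mulrC (x _ _)).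
by rewrite addrC cosB cos_pihalf sin_pihalf mulr0 add0r mulr1.
Qed.

Lemma trig_continuous f : trigp f -> continuous f.
Proof.
elim=> [t b|f1 f2 _ h1 _ h2|c f1 _ h1] x.
- apply: (@continuous_comp _ _ _ (fun x : 'rV[R]_p => b + (x *m t^T) ord0 ord0) cos).
    apply: (@continuousD _ _ _ (fun=> b)); first exact: cst_continuous.
    have -> : (fun y : 'rV[R]_p => (y *m t^T) ord0 ord0) = (fun y => \sum_s y ord0 s * t^T s ord0).
      by apply/funext => y; rewrite mxE.
    move: x; apply: continuous_bigsum => s x.
    apply: (@continuousM _ _ (fun y : 'rV[R]_p => y ord0 s) (fun=> t^T s ord0)); last exact: cst_continuous.
    exact: coord_continuous.
  exact: continuous_cos.
- by apply: continuousD; [exact: h1|exact: h2].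
- by apply: (@continuousM _ _ (fun=> c)); [exact: cst_continuous|exact: h1].
Qed.

(* Bernstein's kernel at the points A sin(x / A), which makes the approximant a
   trigonometric polynomial with the same bound as [f]. *)
Lemma coin_approx f M A e : continuous f -> (forall x, `|f x| <= M) -> 0 < A -> 0 < e ->
  exists q, [/\ trigp q, forall x, `|q x| <= M &
    forall x, `|f (\row_s (A * sin (A^-1 * x ord0 s))) - q x| <= e].
Proof.
move=> cf fM A0 e0.
have e2 : 0 < e / 2 by rewrite divr_gt0.
have [c c0 hc] := cube_quadratic_modulus A cf fM e2.
(* The mean of [n] signs, scaled by [A], has variance at most [A^2 / n] in each of the [p]
   coordinates; [n] brings [c] times the total below [e / 2]. *)
have [n n0 hn] : exists2 n, (0 < n)%N & c * (A ^+ 2 * p%:R) <= e / 2 * n%:R.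
  have [n hn] : exists n : nat, c * (A ^+ 2 * p%:R) / (e / 2) < n%:R.
    by exists (Num.truncn (c * (A ^+ 2 * p%:R) / (e / 2))).+1; exact: truncnS_gt.
  exists n.+1 => //; rewrite [leRHS]mulrC -ler_pdivrMr//; apply/ltW/(lt_le_trans hn).
  by rewrite ler_nat.
have nR : 0 < n%:R :> R by rewrite ltr0n.
pose y x (i : 'I_p * 'I_n) := sin (A^-1 * x ord0 i.1).
have y1 x i : `|y x i| <= 1 by exact: norm_sin_le1.
(* Random point whose coordinates are [A] times means of [n] signs; under [coin_wt (y x)] its
   expectation is [A * sin (x / A)]. *)
pose pt (ep : {ffun 'I_p * 'I_n -> bool}) : 'rV[R]_p := \row_s (A / n%:R * \sum_(r < n) coin (ep (s, r))).
have q1 (a : R) x : a = \sum_(ep : {ffun 'I_p * 'I_n -> bool}) a * coin_wt (y x) ep.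
  by rewrite -mulr_sumr coin_wt_sum mulr1.
exists (fun x => \sum_(ep : {ffun 'I_p * 'I_n -> bool}) f (pt ep) * coin_wt (y x) ep); split.
- apply: trig_sum => ep; apply: trig_scale; apply: trig_prod => i.
  apply: eq_trigp (trig_scale 2^-1 (trig_add (trig_cst 1) (trig_scale (coin (ep i)) (trig_sin_coord A^-1 i.1)))) => x.
  by rewrite mulrC.
- move=> x; apply: le_trans (ler_norm_sum _ _ _) _; rewrite [leRHS](q1 M x).
  apply: ler_sum => ep _; rewrite normrM (ger0_norm (coin_wt_ge0 _ (y1 x))).
  by apply: ler_wpM2r (fM _); exact: coin_wt_ge0.
move=> x; set z := \row_s _.
rewrite [f z](q1 _ x) -sumrB; apply: le_trans (ler_norm_sum _ _ _) _.
have zA s : `|z ord0 s| <= A.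
  by rewrite mxE normrM (gtr0_norm A0) ler_piMr ?norm_sin_le1// ltW.
have ptA ep s : `|pt ep ord0 s| <= A.
  rewrite mxE normrM (gtr0_norm (divr_gt0 A0 nR)) -mulrA ler_piMr ?(ltW A0)//.
  rewrite mulrC ler_pdivrMr// mul1r; apply: le_trans (ler_norm_sum _ _ _) _.
  rewrite -[leRHS](_ : \sum_(r < n) 1 = n%:R); last by rewrite sumr_const card_ord.
  by apply: ler_sum => r _; rewrite /coin; case: (ep _); rewrite ?normrN normr1.
apply: (@le_trans _ _ (\sum_(ep : {ffun 'I_p * 'I_n -> bool})
   (e / 2 + c * \sum_(s < p) (z ord0 s - pt ep ord0 s) ^+ 2) * coin_wt (y x) ep)).
  apply: ler_sum => ep _; rewrite -mulrBl normrM (ger0_norm (coin_wt_ge0 _ (y1 x))).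
  by apply: ler_wpM2r; [exact: coin_wt_ge0|exact: hc].
under eq_bigr => ep _ do rewrite mulrDl -(mulrA c) mulr_suml.
rewrite big_split/= -(q1 (e / 2) x) -mulr_sumr exchange_big/=.
have var s : \sum_(ep : {ffun 'I_p * 'I_n -> bool}) (z ord0 s - pt ep ord0 s) ^+ 2 * coin_wt (y x) ep <= A ^+ 2 / n%:R.
  have sq ep : (z ord0 s - pt ep ord0 s) ^+ 2 = (A / n%:R) ^+ 2 *
      \sum_(r < n) \sum_(r' < n) (coin (ep (s, r)) - y x (s, r)) * (coin (ep (s, r')) - y x (s, r')).
    have -> : z ord0 s - pt ep ord0 s = - (A / n%:R * \sum_(r < n) (coin (ep (s, r)) - y x (s, r))).
      rewrite sumrB (_ : \sum_(r < n) y x (s, r) = n%:R * sin (A^-1 * x ord0 s)).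
        by rewrite /z /pt !mxE; field; rewrite (gt_eqF nR).
      by rewrite /y /= sumr_const card_ord mulr_natl.
    rewrite sqrrN exprMn; congr (_ * _); rewrite expr2 mulr_suml.
    by apply: eq_bigr => r _; rewrite mulr_sumr.
  under eq_bigr => ep _ do rewrite sq -mulrA mulr_suml.
  rewrite -mulr_sumr exchange_big/=.
  apply: (@le_trans _ _ ((A / n%:R) ^+ 2 * \sum_(r < n) 1)); last first.
    rewrite sumr_const card_ord le_eqVlt; apply/orP; left; apply/eqP; field.
    by rewrite (gt_eqF nR).
  apply: ler_wpM2l; first exact: sqr_ge0.
  apply: ler_sum => r _; under eq_bigr => ep _ do rewrite mulr_suml.
  rewrite exchange_big/= (bigD1 r)//= coin_cov eqxx big1 => [|r' r'r].
    by rewrite addr0 lerBlDr lerDl sqr_ge0.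
  by rewrite coin_cov; case: eqP => // -[] rr'; rewrite rr' eqxx in r'r.
apply: (@le_trans _ _ (e / 2 + c * \sum_(s < p) A ^+ 2 / n%:R)).
  by rewrite lerD2l ler_wpM2l//; apply: ler_sum => s _; exact: var.
rewrite sumr_const card_ord.
have -> : c * (A ^+ 2 / n%:R *+ p) = c * (A ^+ 2 * p%:R) / n%:R.
  by rewrite -mulr_natr; ring.
have : c * (A ^+ 2 * p%:R) / n%:R <= e / 2 by rewrite ler_pdivrMr.
lra.
Qed.

End TrigPolynomials.

(** * From characteristic functions to convergence in law *)

Section Levy.
Context {R : realType} {p : nat}.

Lemma Ex_ind {d} {T : measurableType d} (P : probability T R) (B : set T) : measurable B ->
  ((Ex P (\1_B))%:E = P B)%E /\ intg P (\1_B).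
Proof.
move=> mB; have i1 : intg P (\1_B : T -> R).
  by apply: (@intg_bnd _ _ _ _ _ 1) => // w; rewrite indicE; case: (_ \in _); rewrite ?normr1 ?normr0.
by split => //; rewrite ExE// integral_indic// setIT.
Qed.

Lemma prob1_near {d} {T : measurableType d} (P : probability T R) (A : nat -> set T) :
  (forall n, measurable (A n)) -> (P (A n) @[n --> \oo] --> 1)%E ->
  forall e, 0 < e -> \forall n \near \oo, (P (~` A n) <= e%:E)%E.
Proof.
move=> mA /fine_cvg /cvgrPdist_le cv e /cv; apply: filterS => n /=.
rewrite probability_setC//; have := fineK (fin_num_measure P _ (mA n)).
set r := fine _ => <- h; rewrite (_ : (1 - r%:E)%E = (1 - r)%:E)// lee_fin.
exact: le_trans (ler_norm _) h.
Qed.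

Lemma Ex_close {d} {T : measurableType d} (P : probability T R) (f g : T -> R) (B : set T) (a b c : R) :
  measurable_fun setT f -> measurable_fun setT g -> (forall w, `|f w| <= b) -> (forall w, `|g w| <= b) ->
  measurable B -> (P B <= c%:E)%E -> 0 <= a -> (forall w, ~ B w -> `|f w - g w| <= a) ->
  `|Ex P f - Ex P g| <= a + 2 * b * c.
Proof.
move=> mf mg fb gb mB PB a0 fg.
have [EB iB] := Ex_ind P mB.
have b0 : 0 <= b by exact: le_trans (fb point).
have i1 := intg_bnd P mf fb; have i2 := intg_bnd P mg gb.
rewrite -ExB//; apply: le_trans (Ex_norm (intgB i1 i2)) _.
have i3 := intgD (intg_cst P a) (intgZ (2 * b) iB).
apply: (@le_trans _ _ (Ex P (fun w => a + 2 * b * \1_B w))).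
  apply: le_Ex => [||w]; [exact: intg_norm (intgB i1 i2)|exact: i3|].
  rewrite indicE; have [Bw|Bw] := pselect (B w).
    rewrite mem_set// mulr1; apply: le_trans (ler_normB _ _) _.
    by have := fb w; have := gb w; lra.
  by rewrite memNset// mulr0 addr0; exact: fg.
rewrite ExD ?ExZ ?Ex_cst//; [|exact: intg_cst|exact: intgZ].
rewrite lerD2l ler_wpM2l ?mulr_ge0//.
by rewrite -lee_fin EB.
Qed.

(** By [|u - sin u| <= u^2] the error is at most [z^2 / A]: a periodic function imitates the
    identity on a bounded set. *)
Lemma sin_scale_close K e : 0 < e -> exists2 A : R, 0 < A &
  forall z, `|z| <= K -> `|z - A * sin (A^-1 * z)| <= e.
Proof.
move=> e0; have [|K0] := ltP K 0.
  by move=> K0; exists 1 => // z zK; have := normr_ge0 z; lra.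
exists ((K ^+ 2 + 1) / e); first by rewrite divr_gt0// ltr_wpDl// sqr_ge0.
set A := _ / _; move=> z zK.
have A0 : 0 < A by rewrite divr_gt0// ltr_wpDl// sqr_ge0.
have [h _] := sub_sin_le (A^-1 * z).
rewrite (_ : z - A * sin (A^-1 * z) = A * (A^-1 * z - sin (A^-1 * z))); last first.
  by field; rewrite gt_eqF.
rewrite normrM gtr0_norm//; apply: le_trans (ler_wpM2l (ltW A0) h) _.
rewrite exprMn (_ : A * _ = z ^+ 2 / A); last by field; rewrite gt_eqF.
rewrite ler_pdivrMr// /A mulrCA divff ?gt_eqF// mulr1.
rewrite -real_normK ?num_real//; apply: (@le_trans _ _ (K ^+ 2)); last by rewrite lerDl.
by rewrite ler_sqr ?nnegrE.
Qed.

Context {d} {T : measurableType d} (P : probability T R) {d'} {T' : measurableType d'} (P' : probability T' R).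
Variables (X : nat -> T -> 'rV[R]_p) (W : T' -> 'rV[R]_p).
Hypothesis mX : forall n s, measurable_fun setT (fun w => X n w ord0 s).
Hypothesis mW : forall s, measurable_fun setT (fun w => W w ord0 s).
Hypothesis cfX : forall (t : 'rV[R]_p) b, Ex P (fun w => cos (b + (X n w *m t^T) ord0 ord0)) @[n --> \oo] -->
  Ex P' (fun w => cos (b + (W w *m t^T) ord0 ord0)).
Hypothesis tightX : forall e, 0 < e -> exists K : R, \forall n \near \oo, exists B : set T,
  [/\ measurable B, (P B <= e%:E)%E & forall w, ~ B w -> forall s : 'I_p, `|X n w ord0 s| <= K].

Lemma trigp_cvg g : trigp g -> Ex P (fun w => g (X n w)) @[n --> \oo] --> Ex P' (fun w => g (W w)).
Proof.
have iX h n : trigp h -> intg P (fun w => h (X n w)).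
  elim=> [t b|f1 f2 _ h1 _ h2|c f1 _ h1].
  - apply: (@intg_bnd _ _ _ _ _ 1) => [|w]; last exact: norm_cos_le1.
    exact: (continuous_row_measurable (mX n) (trig_continuous (trig_cos t b))).
  - exact: intgD.
  - exact: intgZ.
have iW h : trigp h -> intg P' (fun w => h (W w)).
  elim=> [t b|f1 f2 _ h1 _ h2|c f1 _ h1].
  - apply: (@intg_bnd _ _ _ _ _ 1) => [|w]; last exact: norm_cos_le1.
    exact: (continuous_row_measurable mW (trig_continuous (trig_cos t b))).
  - exact: intgD.
  - exact: intgZ.
elim=> [t b|f1 f2 t1 h1 t2 h2|c f1 t1 h1].
- exact: cfX.
- rewrite ExD; [|exact: iW|exact: iW].
  rewrite (_ : (fun n => _) = (fun n => Ex P (fun w => f1 (X n w)) + Ex P (fun w => f2 (X n w)))).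
    exact: cvgD.
  by apply/funext => n; rewrite ExD//; exact: iX.
- rewrite ExZ; [|exact: iW].
  rewrite (_ : (fun n => _) = (fun n => c * Ex P (fun w => f1 (X n w)))).
    by apply: cvgM => //; exact: cvg_cst.
  by apply/funext => n; rewrite ExZ//; exact: iX.
Qed.

Lemma tightW e : 0 < e -> exists K : R, exists B : set T',
  [/\ measurable B, (P' B <= e%:E)%E & forall w, ~ B w -> forall s : 'I_p, `|W w ord0 s| <= K].
Proof.
move=> e0.
pose F n := [set w | forall s : 'I_p, `|W w ord0 s| <= n%:R].
have FE n : F n = \bigcap_(s in [set: 'I_p]) [set w | `|W w ord0 s| <= n%:R].
  by apply/seteqP; split => [w Fw s _|w Fw s]; [exact: Fw|exact: (Fw s I)].
have mF n : measurable (F n).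
  rewrite FE; apply: fin_bigcap_measurable => // s _.
  rewrite -[X in measurable X]setTI.
  have mn : measurable_fun setT (fun w => `|W w ord0 s|) by apply: measurableT_comp => //; exact: mW.
  have := mn measurableT `]-oo, n%:R]%classic (measurable_itv _).
  by congr measurable; apply/seteqP; split => w [_ /=]; rewrite in_itv.
have FU : \bigcup_n F n = setT.
  apply/seteqP; split => // w _.
  exists (Num.truncn (\sum_s `|W w ord0 s|)).+1 => // s.
  apply/ltW/(le_lt_trans _ (truncnS_gt _)).
  by rewrite (bigD1 s)//= lerDl sumr_ge0.
have nd : nondecreasing_seq F.
  move=> a b ab; apply/subsetPset => w Fw s; apply: le_trans (Fw s) _.
  by rewrite ler_nat.
have := @nondecreasing_cvg_mu _ _ _ P' F mF _ nd.
rewrite FU => /(_ measurableT) cv0.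
have cv : (P' \o F) n @[n --> \oo] --> 1%E by rewrite -(probability_setT P').
have [n _ hn] := prob1_near mF cv e0.
exists n%:R, (~` F n); split; [exact: measurableC|exact: (hn n (leqnn n))|].
by move=> w /contrapT.
Qed.

(** The approximating trigonometric polynomial has the same bound [M] as [f], so it remains under
    control outside the cube, where only the small probability given by tightness helps. *)
Lemma levy_continuity f M : continuous f -> (forall x, `|f x| <= M) ->
  Ex P (fun w => f (X n w)) @[n --> \oo] --> Ex P' (fun w => f (W w)).
Proof.
move=> cf fM; apply/cvgrPdist_le => e e0.
have M0 : 0 <= M by exact: le_trans (fM 0).
have a0 : 0 < e / 10 by rewrite divr_gt0.
have b0 : 0 < e / (20 * (M + 1)) by rewrite divr_gt0// mulr_gt0//; lra.
have bM : 2 * M * (e / (20 * (M + 1))) <= e / 10.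
  rewrite mulrA ler_pdivrMr ?mulr_gt0//; [nra|lra].
have [K1 tX] := tightX b0; have [K2 [B2 [mB2 PB2 hB2]]] := tightW b0.
pose K := Num.max K1 K2.
have K1K : K1 <= K by rewrite le_max lexx.
have K2K : K2 <= K by rewrite le_max lexx orbT.
have [dl dl0 hdl] : exists2 dl, 0 < dl & forall x y : 'rV[R]_p, (forall s, `|x ord0 s| <= K + 1) ->
    (forall s, `|y ord0 s| <= K + 1) -> `|x - y| < dl -> `|f x - f y| <= e / 10.
  have cw x : [set v : 'rV[R]_p | forall s, `|v ord0 s| <= K + 1] x ->
      f y @[y --> within [set v : 'rV[R]_p | forall s, `|v ord0 s| <= K + 1] (nbhs x)] --> f x.
    by move=> _; apply: cvg_within_filter; exact: cf.
  have [dl dl0 hdl] := compact_unif_cont (@cube_compact _ _ (K + 1)) cw a0.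
  by exists dl.
(* Replacing [x] by [A * sin (x / A)] is to move each coordinate by at most 1, hence the cube of
   half-side [K + 1], and by less than the modulus [dl]. *)
have dm0 : 0 < Num.min 1 (dl / 2) by rewrite lt_min ltr01 divr_gt0.
have [A A0 hA] := sin_scale_close K dm0.
have [q [tq qM hq]] := coin_approx cf fM A0 a0.
have fq (x : 'rV[R]_p) : (forall s, `|x ord0 s| <= K) -> `|f x - q x| <= e / 5.
  move=> xK; rewrite -(subrKA (f (\row_s (A * sin (A^-1 * x ord0 s))))).
  apply: le_trans (ler_normD _ _) _.
  have := hq x; suff : `|f x - f (\row_s (A * sin (A^-1 * x ord0 s)))| <= e / 10 by lra.
  have close s : `|x ord0 s - A * sin (A^-1 * x ord0 s)| <= Num.min 1 (dl / 2) by exact: hA.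
  apply: hdl => [s|s|].
  - by have := xK s; lra.
  - rewrite mxE; have := close s; rewrite le_min => /andP[+ _].
    have := xK s; have := ler_normB (x ord0 s) (x ord0 s - A * sin (A^-1 * x ord0 s)).
    by rewrite subKr; lra.
  - apply: (@le_lt_trans _ _ (dl / 2)); last lra.
    apply: row_norm_le => [|s]; first lra.
    by rewrite !mxE; have := close s; rewrite le_min => /andP[].
have cq := trig_continuous tq.
have := trigp_cvg tq => /cvgrPdist_le /(_ _ a0) hc.
near=> n.
have [B [mB PB hB]] : exists B : set T, [/\ measurable B, (P B <= (e / (20 * (M + 1)))%:E)%E &
    forall w, ~ B w -> forall s : 'I_p, `|X n w ord0 s| <= K1] by near: n.
have e5 : 0 <= e / 5 by lra.
have h1 := Ex_close (continuous_row_measurable (mX n) cf) (continuous_row_measurable (mX n) cq)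
  (fun w => fM _) (fun w => qM _) mB PB e5
  (fun w Bw => fq _ (fun s => le_trans (hB w Bw s) K1K)).
have h2 := Ex_close (continuous_row_measurable mW cf) (continuous_row_measurable mW cq)
  (fun w => fM _) (fun w => qM _) mB2 PB2 e5
  (fun w Bw => fq _ (fun s => le_trans (hB2 w Bw s) K2K)).
have h3 : `|Ex P' (fun w => q (W w)) - Ex P (fun w => q (X n w))| <= e / 10 by near: n.
move: h1 h2 h3 bM; rewrite !ler_norml => /andP[? ?] /andP[? ?] /andP[? ?] ?.
by apply/andP; split; lra.
Unshelve. all: by end_near. Qed.

End Levy.

(** * Minimization of perturbed quadratic forms *)

Section QuadraticForms.
Context {R : realType}.

Definition qf {n q} (X : 'M[R]_(n, q)) (u : 'rV[R]_n) (v : 'rV[R]_q) : R := (u *m X *m v^T) ord0 ord0.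

Lemma qfE n q (X : 'M[R]_(n, q)) u v : qf X u v = \sum_t \sum_s u ord0 s * X s t * v ord0 t.
Proof. by rewrite /qf mxE; apply: eq_bigr => t _; rewrite !mxE mulr_suml. Qed.

Lemma qfDl n q (X : 'M[R]_(n, q)) u u' v : qf X (u + u') v = qf X u v + qf X u' v.
Proof. by rewrite /qf !mulmxDl !mxE. Qed.

Lemma qfDr n q (X : 'M[R]_(n, q)) u v v' : qf X u (v + v') = qf X u v + qf X u v'.
Proof. by rewrite /qf linearD/= mulmxDr mxE. Qed.

Lemma qfBm n q (X X' : 'M[R]_(n, q)) u v : qf (X - X') u v = qf X u v - qf X' u v.
Proof. by rewrite /qf mulmxBr mulmxBl !mxE. Qed.

Lemma qfZ n (X : 'M[R]_n) c v : qf X (c *: v) (c *: v) = c ^+ 2 * qf X v v.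
Proof. by rewrite /qf linearZ/= -!scalemxAl -scalemxAr !mxE mulrA. Qed.

Lemma qfC n (X : 'M[R]_n) u v : X^T = X -> qf X u v = qf X v u.
Proof.
move=> sX; rewrite !qfE exchange_big/=; apply: eq_bigr => t _; apply: eq_bigr => s _.
by rewrite -[in LHS]sX mxE; ring.
Qed.

Lemma qf_bound n q (X : 'M[R]_(n, q)) (u : 'rV[R]_n) (v : 'rV[R]_q) a b c : 0 <= a -> 0 <= c ->
  (forall s, `|u ord0 s| <= a) -> (forall s, `|v ord0 s| <= b) -> (forall s t, `|X s t| <= c) ->
  `|qf X u v| <= (n%:R * q%:R) * (a * c * b).
Proof.
move=> a0 c0 ua vb Xc; rewrite qfE.
apply: le_trans (ler_norm_sum _ _ _) _.
apply: (@le_trans _ _ (\sum_(t < q) \sum_(s < n) a * c * b)).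
  apply: ler_sum => t _; apply: le_trans (ler_norm_sum _ _ _) _; apply: ler_sum => s _.
  rewrite !normrM; apply: ler_pM => //; exact: ler_pM.
by rewrite !sumr_const !card_ord -mulrnA -[leLHS]mulr_natl natrM.
Qed.

Lemma sqr_le_sqnorm n (v : 'rV[R]_n) s : (v ord0 s) ^+ 2 <= sqnorm v.
Proof. by rewrite /sqnorm (bigD1 s)//= lerDl sumr_ge0// => i _; exact: sqr_ge0. Qed.

Lemma coord_le_sqnorm n (v : 'rV[R]_n) s : `|v ord0 s| <= Num.sqrt (sqnorm v).
Proof. by rewrite -sqrtr_sqr ler_wsqrtr// sqr_le_sqnorm. Qed.

Lemma sqnorm_le n (v : 'rV[R]_n) a : (forall s, `|v ord0 s| <= a) -> sqnorm v <= n%:R * a ^+ 2.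
Proof.
move=> va; apply: (@le_trans _ _ (\sum_(s < n) a ^+ 2)); last by rewrite sumr_const card_ord mulr_natl.
apply: ler_sum => s _; have a0 : 0 <= a by exact: le_trans (va s).
by rewrite -real_normK ?num_real// ler_sqr ?nnegrE.
Qed.

Lemma sqnormZ n c (v : 'rV[R]_n) : sqnorm (c *: v) = c ^+ 2 * sqnorm v.
Proof. by rewrite /sqnorm mulr_sumr; apply: eq_bigr => s _; rewrite mxE exprMn. Qed.

Lemma sqnormD_le n (u v : 'rV[R]_n) : sqnorm (u + v) <= 2 * sqnorm u + 2 * sqnorm v.
Proof.
rewrite /sqnorm !mulr_sumr -big_split/=; apply: ler_sum => s _; rewrite mxE.
by have := sqr_ge0 (u ord0 s - v ord0 s); nra.
Qed.

Lemma sqnorm_eq0 n (v : 'rV[R]_n) : sqnorm v = 0 -> v = 0.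
Proof.
move=> v0; apply/rowP => s; rewrite mxE; apply/eqP; rewrite -sqrf_eq0 eq_le sqr_ge0 andbT.
by rewrite -v0 sqr_le_sqnorm.
Qed.

Lemma qf_norm_le n (X : 'M[R]_n) v c : 0 <= c -> (forall s t, `|X s t| <= c) ->
  `|qf X v v| <= n%:R ^+ 2 * c * sqnorm v.
Proof.
move=> c0 Xc.
apply: le_trans (qf_bound (sqrtr_ge0 (sqnorm v)) c0 (coord_le_sqnorm v) (coord_le_sqnorm v) Xc) _.
rewrite -[X in _ <= _ * X](sqr_sqrtr (sqnorm_ge0 v)) le_eqVlt; apply/orP; left; apply/eqP; ring.
Qed.

(** The minimum over the compact unit sphere is positive, and homogeneity extends the bound. *)
Lemma qf_pd_lower n (X : 'M[R]_n) : (forall v, v != 0 -> 0 < qf X v v) ->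
  exists2 c, 0 < c & forall v, c * sqnorm v <= qf X v v.
Proof.
move=> pd.
pose S := [set v : 'rV[R]_n | sqnorm v = 1].
have ccoord s : continuous (fun v : 'rV[R]_n => v ord0 s) by move=> x; exact: coord_continuous.
have csq : continuous (fun v : 'rV[R]_n => sqnorm v).
  by apply: continuous_bigsum => s x; apply: (@continuousM _ _ (fun v : 'rV[R]_n => v ord0 s) (fun v => v ord0 s)); exact: ccoord.
have cqf : continuous (fun v : 'rV[R]_n => qf X v v).
  rewrite (_ : (fun v => _) = fun v : 'rV[R]_n => \sum_t \sum_s v ord0 s * X s t * v ord0 t); last first.
    by apply/funext => v; rewrite qfE.
  apply: continuous_bigsum => t; apply: continuous_bigsum => s x.
  apply: (@continuousM _ _ (fun v : 'rV[R]_n => v ord0 s * X s t) (fun v => v ord0 t)); last exact: ccoord.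
  by apply: (@continuousM _ _ (fun v : 'rV[R]_n => v ord0 s) (fun=> X s t)); [exact: ccoord|exact: cst_continuous].
have cS : compact S.
  apply: (@subclosed_compact _ S [set v : 'rV[R]_n | forall s, `|v ord0 s| <= 1]).
  - rewrite (_ : S = (fun v : 'rV[R]_n => sqnorm v) @^-1` [set 1])//.
    apply: closed_comp => [x _|]; [exact: csq|exact: closed_eq].
  - exact: cube_compact.
  - by move=> v Sv s; apply: le_trans (coord_le_sqnorm v s) _; rewrite Sv sqrtr1.
have nrm v : v != 0 -> S ((Num.sqrt (sqnorm v))^-1 *: v).
  move=> v0; rewrite /S /= sqnormZ exprVn sqr_sqrtr ?sqnorm_ge0// mulVf//.
  by apply: contra v0 => /eqP /sqnorm_eq0 ->.
(* An empty sphere leaves only the zero vector, for which any constant works. *)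
have [S0|S0] := pselect (S !=set0); last first.
  exists 1 => // v; have [->|v0] := eqVneq v 0.
    by rewrite /qf !mul0mx mxE mul1r /sqnorm big1// => s _; rewrite mxE expr0n.
  by exfalso; apply: S0; exists ((Num.sqrt (sqnorm v))^-1 *: v); exact: nrm.
have [c /set_mem Sc hc] := EVT_min_rV S0 cS (continuous_subspaceT cqf).
exists (qf X c c).
  apply: pd; apply/eqP => c0; move: Sc; rewrite /S /= c0 /sqnorm big1 => [|s _].
    by move/esym/eqP; rewrite oner_eq0.
  by rewrite mxE expr0n.
move=> v; have [->|v0] := eqVneq v 0.
  rewrite [qf X 0 0]/qf !mul0mx mxE (_ : sqnorm 0 = 0) ?mulr0// /sqnorm big1// => s _.
  by rewrite mxE expr0n.
have := hc _ (mem_set (nrm v v0)); rewrite qfZ exprVn sqr_sqrtr ?sqnorm_ge0// mulrC ler_pdivlMr//.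
rewrite lt_neqAle sqnorm_ge0 andbT eq_sym.
by apply: contra v0 => /eqP /sqnorm_eq0 ->.
Qed.

Lemma qf_close n (X Xi : 'M[R]_n) (v a : 'rV[R]_n) A x0 eta : 0 <= A -> 0 <= x0 -> 0 <= eta ->
  (forall s, `|v ord0 s| <= A) -> (forall s, `|a ord0 s| <= A) ->
  (forall s, `|(v - a) ord0 s| <= 2 * eta) ->
  (forall s t, `|X s t - Xi s t| <= eta) -> (forall s t, `|Xi s t| <= x0) ->
  `|qf X v v - qf Xi a a| <= n%:R * n%:R * (A ^+ 2 + 4 * (x0 * A)) * eta.
Proof.
move=> A0 x00 eta0 va aA b1 hX hx0.
have e1 : `|qf X v v - qf Xi v v| <= n%:R * n%:R * (A * eta * A).
  by rewrite -qfBm; apply: qf_bound => // s t; rewrite !mxE; exact: hX.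
have e2 : `|qf Xi (v - a) v| <= n%:R * n%:R * (2 * eta * x0 * A).
  by apply: qf_bound => //; rewrite mulr_ge0.
have e3 : `|qf Xi a (v - a)| <= n%:R * n%:R * (A * x0 * (2 * eta)) by apply: qf_bound.
have -> : qf X v v - qf Xi a a = (qf X v v - qf Xi v v) + (qf Xi (v - a) v + qf Xi a (v - a)).
  have -> : qf Xi (v - a) v = qf Xi v v - qf Xi a v.
    by apply/eqP; rewrite -subr_eq opprK -qfDl subrK.
  have -> : qf Xi a (v - a) = qf Xi a v - qf Xi a a.
    by apply/eqP; rewrite -subr_eq opprK -qfDr subrK.
  by ring.
apply: le_trans (ler_normD _ _) _.
have := ler_normD (qf Xi (v - a) v) (qf Xi a (v - a)).
have -> : n%:R * n%:R * (A ^+ 2 + 4 * (x0 * A)) * eta = n%:R * n%:R * (A * eta * A) +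
   (n%:R * n%:R * (2 * eta * x0 * A) + n%:R * n%:R * (A * x0 * (2 * eta))) by ring.
lra.
Qed.

End QuadraticForms.

(** * Deterministic analysis of the minimizer *)

Section MEstimation.
Context {R : realType} {p L : nat}.
Variables (Theta : set 'rV[R]_p) (th0 : 'rV[R]_p) (Gm : 'rV[R]_p -> 'rV[R]_L).
Variables (Jr : 'M[R]_(p, L)) (Xi : 'M[R]_L).
Hypothesis cT : compact Theta.
Hypothesis iT : (interior Theta) th0.
Hypothesis G0 : Gm th0 = 0.
Hypothesis Gz : forall th, Theta th -> Gm th = 0 -> th = th0.
Hypothesis Gc : {within Theta, continuous (fun th => sqnorm (Gm th))}.
Hypothesis Jfree : row_free Jr.
Hypothesis Gd : forall e, 0 < e -> exists2 dl, 0 < dl & forall th, `|th - th0| < dl ->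
  forall s, `|Gm th ord0 s - ((th - th0) *m Jr) ord0 s| <= e * `|th - th0|.
Hypothesis sXi : Xi^T = Xi.
Hypothesis pdXi : forall v : 'rV[R]_L, v != 0 -> 0 < qf Xi v v.

(** Parameters are row vectors, so [Jr] is the transpose of the Jacobian and this is the matrix
    [J' Xi J] of the sandwich. *)
Definition bread : 'M[R]_p := Jr *m Xi *m Jr^T.

Lemma mulJr_eq0 (h : 'rV[R]_p) : h *m Jr = 0 -> h = 0.
Proof. by move=> hJ; apply: (row_free_inj Jfree); rewrite hJ mul0mx. Qed.

Lemma bread_unit : bread \in unitmx.
Proof.
rewrite unitmxE unitfE; apply/det0P => -[v v0 vM].
have vJ : v *m Jr != 0 by apply: contra v0 => /eqP/mulJr_eq0 ->.
have E : qf Xi (v *m Jr) (v *m Jr) = (v *m bread *m v^T) ord0 ord0.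
  by rewrite /qf /bread trmx_mul !mulmxA.
by have := pdXi vJ; rewrite E vM mul0mx mxE ltxx.
Qed.

Lemma bread_sym : bread^T = bread.
Proof. by rewrite /bread !trmx_mul trmxK sXi mulmxA. Qed.

(** The point [h] that minimizes the form [qf Xi] at [z + h *m Jr]; [influence_foc] is the
    orthogonality that characterizes it. *)
Definition influence (z : 'rV[R]_L) : 'rV[R]_p := - (z *m Xi *m Jr^T *m invmx bread).

Lemma Jr_lower : exists2 c, 0 < c & forall h, c * sqnorm h <= sqnorm (h *m Jr).
Proof.
have sq h : sqnorm (h *m Jr) = qf (Jr *m Jr^T) h h.
  rewrite /qf mulmxA -mulmxA -trmx_mul [RHS]mxE; apply: eq_bigr => s _.
  by rewrite !mxE expr2.
have [v v0|c c0 hc] := @qf_pd_lower _ _ (Jr *m Jr^T).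
  rewrite -sq lt_neqAle sqnorm_ge0 andbT eq_sym.
  by apply: contra v0 => /eqP /sqnorm_eq0 /mulJr_eq0 ->.
by exists c => // h; rewrite sq.
Qed.

Lemma Gm_lower_loc : exists2 c, 0 < c & exists2 dl, 0 < dl &
  forall th, `|th - th0| < dl -> c * sqnorm (th - th0) <= sqnorm (Gm th).
Proof.
have [c c0 hc] := Jr_lower.
have L0 : 0 <= L%:R :> R by [].
(* Makes the squared linearization error, over [L] coordinates, at most [c / 4] times
   [sqnorm (th - th0)]; then [|a + b|^2 <= 2 |a|^2 + 2 |b|^2] leaves the constant [c / 4]. *)
have e0 : 0 < Num.sqrt (c / (4 * (L%:R + 1))).
  by rewrite sqrtr_gt0 divr_gt0// mulr_gt0//; lra.
have [dl dl0 hdl] := Gd e0.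
exists (c / 4); first by rewrite divr_gt0.
exists dl => // th hth; have hs := hdl _ hth.
have h1 := hc (th - th0).
have h2 := sqnormD_le (Gm th) ((th - th0) *m Jr - Gm th).
rewrite addrC subrK in h2.
have h3 : sqnorm ((th - th0) *m Jr - Gm th) <= c / 4 * sqnorm (th - th0).
  have n2 : `|th - th0| ^+ 2 <= sqnorm (th - th0).
    rewrite -[leRHS]sqr_sqrtr ?sqnorm_ge0// ler_sqr ?nnegrE//.
    by apply: row_norm_le => // s; exact: coord_le_sqnorm.
  apply: (@le_trans _ _ (L%:R * (Num.sqrt (c / (4 * (L%:R + 1))) * `|th - th0|) ^+ 2)).
    by apply: sqnorm_le => s; have := hs s; rewrite !mxE distrC.
  rewrite exprMn sqr_sqrtr; last by rewrite ltW// divr_gt0// mulr_gt0//; lra.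
  rewrite mulrA; apply: ler_pM => //; first by rewrite mulr_ge0// ltW// divr_gt0// mulr_gt0//; lra.
  rewrite mulrCA ler_pM2l// ler_pdivrMr; last by rewrite mulr_gt0//; lra.
  by lra.
by lra.
Qed.

(** Off the ball, [sqnorm (Gm th)] attains its minimum on a compact set, and identification makes it
    positive. *)
Lemma Gm_separated dl : 0 < dl -> exists2 rho, 0 < rho &
  forall th, Theta th -> sqnorm (Gm th) < rho -> `|th - th0| < dl.
Proof.
move=> dl0.
pose A := Theta `&` [set th | dl <= `|th - th0|].
have cA : compact A.
  apply: (@subclosed_compact _ A Theta) => //; last by move=> x [].
  apply: closedI; first exact: compact_closed (@norm_hausdorff _ _) cT.
  apply: (@closed_comp _ _ (fun th : 'rV[R]_p => `|th - th0|) [set x | dl <= x]); last exact: closed_ge.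
  move=> x _; apply: (@continuous_comp _ _ _ (fun th : 'rV[R]_p => th - th0) (fun v => `|v|)); last exact: norm_continuous.
  by apply: (@continuousB _ _ _ id (fun=> th0)); [exact: cvg_id|exact: cst_continuous].
have [A0|A0] := pselect (A !=set0); last first.
  exists 1 => // th hth _; rewrite ltNge; apply/negP => h; apply: A0.
  by exists th.
have cGA : {within A, continuous (fun th => sqnorm (Gm th))}.
  by apply: continuous_subspaceW Gc => x [].
have [c /set_mem [Tc dlc] hc] := EVT_min_rV A0 cA cGA.
exists (sqnorm (Gm c)).
  rewrite lt_neqAle sqnorm_ge0 andbT eq_sym; apply/eqP => /sqnorm_eq0 /(Gz Tc) c0.
  by move: dlc; rewrite /= c0 subrr normr0 leNgt dl0.
move=> th hth; apply: contraTT; rewrite -!leNgt => h.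
by apply: hc; apply: mem_set.
Qed.

Lemma influence_foc z (h : 'rV[R]_p) : qf Xi (z + influence z *m Jr) (h *m Jr) = 0.
Proof.
rewrite /qf trmx_mul mulmxA -[X in X *m h^T]mulmxA.
rewrite (_ : (z + _) *m (Xi *m Jr^T) = 0) ?mul0mx ?mxE//.
rewrite mulmxDl /influence mulNmx mulNmx -!mulmxA (mulmxA Jr) -/bread mulVmx ?bread_unit//.
by rewrite mulmx1 subrr.
Qed.

Lemma entries_bounded n q (X : 'M[R]_(n, q)) : exists2 c, 0 <= c & forall i j, `|X i j| <= c.
Proof.
exists (\sum_i \sum_j `|X i j|); first by apply: sumr_ge0 => i _; apply: sumr_ge0.
move=> i j; rewrite (bigD1 i)//= (bigD1 j)//= -addrA lerDl addr_ge0 ?sumr_ge0// => i' _.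
exact: sumr_ge0.
Qed.

Lemma mulmx_entry_le n q (X : 'M[R]_(n, q)) (u : 'rV[R]_n) a c j : 0 <= a ->
  (forall s, `|u ord0 s| <= a) -> (forall s t, `|X s t| <= c) -> `|(u *m X) ord0 j| <= n%:R * (a * c).
Proof.
move=> a0 ua Xc; rewrite mxE; apply: le_trans (ler_norm_sum _ _ _) _.
apply: (@le_trans _ _ (\sum_(s < n) a * c)); last by rewrite sumr_const card_ord mulr_natl.
by apply: ler_sum => s _; rewrite normrM; apply: ler_pM.
Qed.

Lemma linear_close r (g : 'rV[R]_p -> 'rV[R]_L) t Hm eta s (k := r *: (t - th0)) : 0 < Hm -> 0 < r ->
  (forall s, `|k ord0 s| <= Hm) ->
  `|r * (g t ord0 s - Gm t ord0 s) - r * g th0 ord0 s| <= eta ->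
  `|Gm t ord0 s - ((t - th0) *m Jr) ord0 s| <= eta / Hm * `|t - th0| ->
  `|(r *: g t - (r *: g th0 + k *m Jr)) ord0 s| <= 2 * eta.
Proof.
move=> Hm0 r0 kH q1 q2.
have kJ : (k *m Jr) ord0 s = r * ((t - th0) *m Jr) ord0 s by rewrite /k -scalemxAl mxE.
have kn : r * `|t - th0| <= Hm.
  by rewrite -[r]gtr0_norm// -normrZ; apply: row_norm_le => //; exact: ltW.
have e0 : 0 <= eta by exact: le_trans q1.
have {}q2 : `|r * Gm t ord0 s - (k *m Jr) ord0 s| <= eta.
  rewrite kJ -mulrBr normrM gtr0_norm//.
  apply: le_trans (ler_wpM2l (ltW r0) q2) _.
  rewrite mulrCA; apply: le_trans (ler_wpM2l _ kn) _; first by rewrite divr_ge0// ltW.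
  by rewrite divfK// gt_eqF.
have -> : (r *: g t - (r *: g th0 + k *m Jr)) ord0 s =
    (r * (g t ord0 s - Gm t ord0 s) - r * g th0 ord0 s) + (r * Gm t ord0 s - (k *m Jr) ord0 s).
  move: (k *m Jr) => z; rewrite !mxE; ring.
by apply: le_trans (ler_normD _ _) _; lra.
Qed.

(** Comparison with [th0], where [r *: g th0] is bounded because [Gm] vanishes, bounds [r *: g th]:
    the forms of [X] and [Xi] are comparable when [eta] is small against the ellipticity [lam].
    Passing from [g] to [Gm] costs [K] once more. *)
Lemma argmin_rate K lam x0 eta r (g : 'rV[R]_p -> 'rV[R]_L) (X : 'M[R]_L) th
    (Lam := L%:R ^+ 2 * x0 + lam / 2) : 0 < lam -> 0 <= x0 -> 0 <= eta ->
  (forall v, lam * sqnorm v <= qf Xi v v) -> (forall s t, `|Xi s t| <= x0) ->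
  L%:R ^+ 2 * eta <= lam / 2 -> (forall s t, `|X s t - Xi s t| <= eta) ->
  (forall th s, Theta th -> `|r * (g th ord0 s - Gm th ord0 s)| <= K) ->
  Theta th -> (forall th', Theta th' -> qf X (g th) (g th) <= qf X (g th') (g th')) ->
  r ^+ 2 * sqnorm (Gm th) <= 2 * (2 * Lam / lam * (L%:R * K ^+ 2)) + 2 * (L%:R * K ^+ 2).
Proof.
move=> lam0 x00 eta0 hlam hx0 eta2 hX gK Tth mth.
have Th0 : Theta th0 by exact: interior_subset.
have Lam0 : 0 <= Lam by rewrite addr_ge0 ?mulr_ge0 ?sqr_ge0 ?divr_ge0// ltW.
have XXi v : `|qf X v v - qf Xi v v| <= lam / 2 * sqnorm v.
  rewrite -qfBm; apply: le_trans (qf_norm_le _ eta0 _) _.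
    by move=> s t; rewrite !mxE; exact: hX.
  by apply: ler_wpM2r; [exact: sqnorm_ge0|exact: eta2].
have Xlow v : lam / 2 * sqnorm v <= qf X v v.
  by have := XXi v; have := hlam v; rewrite ler_norml => h /andP[h1 h2]; lra.
have Xup v : qf X v v <= Lam * sqnorm v.
  have := XXi v; have := qf_norm_le v x00 hx0; rewrite !ler_norml /Lam.
  by move=> /andP[_ h] /andP[_ h2]; rewrite mulrDl; lra.
have sg : r ^+ 2 * sqnorm (g th) <= 2 * Lam / lam * (L%:R * K ^+ 2).
  have h := le_trans (Xlow (g th)) (le_trans (mth _ Th0) (Xup (g th0))).
  have rg0 s : `|(r *: g th0) ord0 s| <= K.
    by have := gK th0 s Th0; rewrite G0 !mxE subr0.
  have hz := sqnorm_le rg0; rewrite sqnormZ in hz.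
  have {}h := ler_wpM2l (sqr_ge0 r) h.
  have h2 : lam / 2 * (r ^+ 2 * sqnorm (g th)) <= Lam * (L%:R * K ^+ 2).
    by apply: le_trans (ler_wpM2l Lam0 hz); rewrite mulrCA (mulrCA Lam).
  have l2 : 0 < lam / 2 by rewrite divr_gt0.
  rewrite -(ler_pM2l l2).
  apply: (le_trans h2); rewrite le_eqVlt; apply/orP; left; apply/eqP; field.
  by rewrite gt_eqF.
have h := sqnormD_le (g th) (Gm th - g th); rewrite addrC subrK in h.
have h2 : sqnorm (r *: (Gm th - g th)) <= L%:R * K ^+ 2.
  by apply: sqnorm_le => s; have := gK th s Tth; rewrite !mxE -normrN -mulrN opprB.
rewrite sqnormZ in h2; have {}h := ler_wpM2l (sqr_ge0 r) h.
lra.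
Qed.

(** The order of choices mirrors the probabilistic input: [eta] depends on [K] and [kap] only,
    equicontinuity at level [eta] then yields [dl], and [r] must be large in terms of [dl]. *)
Lemma argmin_linearization K kap : 0 < K -> 0 < kap ->
  exists2 eta, 0 < eta & forall dl, 0 < dl -> exists r0, forall r, r0 <= r ->
  forall (g : 'rV[R]_p -> 'rV[R]_L) (X : 'M[R]_L) th,
    (forall th s, Theta th -> `|r * (g th ord0 s - Gm th ord0 s)| <= K) ->
    (forall s t, `|X s t - Xi s t| <= eta) ->
    (forall th s, Theta th -> `|th - th0| < dl ->
      `|r * (g th ord0 s - Gm th ord0 s) - r * (g th0 ord0 s - Gm th0 ord0 s)| <= eta) ->
    Theta th -> (forall th', Theta th' -> qf X (g th) (g th) <= qf X (g th') (g th')) ->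
    forall s, `|r * (th - th0) ord0 s - influence (r *: g th0) ord0 s| <= kap.
Proof.
move=> K0 kap0.
have Th0 : Theta th0 by exact: interior_subset.
have [lam lam0 hlam] := qf_pd_lower pdXi.
have [x0 x00 hx0] := entries_bounded Xi.
have [cJ cJ0 hcJ] := Jr_lower.
have [c2 c20 [dl1 dl10 hdl1]] := Gm_lower_loc.
have [bJ bJ0 hbJ] := entries_bounded Jr.
have [bI bI0 hbI] := entries_bounded (Xi *m Jr^T *m invmx bread).
pose l := L%:R : R; have l0 : 0 <= l by [].
pose Lam := l ^+ 2 * x0 + lam / 2.
have Lam0 : 0 <= Lam by rewrite addr_ge0 ?mulr_ge0 ?sqr_ge0 ?divr_ge0// ltW.
pose C1 := 2 * Lam / lam * (l * K ^+ 2).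
have C10 : 0 <= C1 by rewrite /C1 !mulr_ge0 ?invr_ge0 ?sqr_ge0// ltW.
pose C2 := 2 * C1 + 2 * (l * K ^+ 2).
have lK0 : 0 <= l * K ^+ 2 by rewrite mulr_ge0 ?sqr_ge0.
have C20 : 0 <= C2 by rewrite /C2; lra.
(* Common bound for the rescaled minimizer, by the rate, and for the rescaled competitor, which is
   linear in [r *: g th0]; the 1 makes it positive. *)
pose Hm := Num.sqrt (C2 / c2) + l * (K * bI) + 1.
have q0 : 0 <= Num.sqrt (C2 / c2) by exact: sqrtr_ge0.
have lKb : 0 <= l * (K * bI) by rewrite !mulr_ge0// ltW.
have Hm1 : 1 <= Hm by rewrite /Hm; lra.
have HmC : Num.sqrt (C2 / c2) <= Hm by rewrite /Hm; lra.
have HmI : l * (K * bI) <= Hm by rewrite /Hm; lra.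
pose A' := K + p%:R * (Hm * bJ).
pose A := A' + 2.
have Hm0 : 0 <= Hm by exact: le_trans Hm1.
have Ap : 0 <= p%:R * (Hm * bJ) by rewrite !mulr_ge0.
have AA' : A' <= A by rewrite lerDl.
have A0 : 0 <= A by rewrite !addr_ge0// ltW.
pose C3 := l * l * (A ^+ 2 + 4 * (x0 * A)) + 1.
have C31 : 1 <= C3 by rewrite /C3 lerDr !mulr_ge0// addr_ge0 ?sqr_ge0 ?mulr_ge0.
(* The three bounds serve, in turn, to keep the rescaled moments within [A = A' + 2], to preserve
   half the ellipticity of [Xi], and to make the final error at most [kap]. *)
pose eta := Num.min 1 (Num.min (lam / (2 * (l ^+ 2 + 1))) (kap ^+ 2 * (lam * cJ) / (2 * C3))).
have eta0 : 0 < eta.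
  rewrite !lt_min ltr01/=; apply/andP; split; apply: divr_gt0 => //.
  - by rewrite mulr_gt0// ltr_wpDl// sqr_ge0.
  - by rewrite !mulr_gt0// exprn_gt0.
  - by rewrite mulr_gt0//; lra.
have eta1 : eta <= 1 by rewrite ge_min lexx.
have eta2 : l ^+ 2 * eta <= lam / 2.
  have : eta <= lam / (2 * (l ^+ 2 + 1)) by rewrite !ge_min lexx orbT.
  have l2 := sqr_ge0 l.
  rewrite ler_pdivlMr; last by rewrite mulr_gt0//; lra.
  by move=> h; nra.
have eta3 : 2 * C3 * eta <= kap ^+ 2 * (lam * cJ).
  have : eta <= kap ^+ 2 * (lam * cJ) / (2 * C3) by rewrite !ge_min lexx !orbT.
  by rewrite ler_pdivlMr ?mulr_gt0//; [rewrite mulrC|lra].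
exists eta => // dl dl0.
have [dld dld0 hdld] := Gd (divr_gt0 eta0 (lt_le_trans ltr01 Hm1)).
have [di di0 hdi] : exists2 di, 0 < di & forall th, `|th - th0| < di -> Theta th.
  have [di /= di0 hdi] := (nbhs_ballP _ _).1 iT.
  by exists di => // th hth; apply: hdi; rewrite -ball_normE/= distrC.
pose dm := Num.min dl (Num.min dl1 (Num.min dld di)).
have dm0 : 0 < dm by rewrite !lt_min dl0 dl10 dld0.
have [rho rho0 hrho] := Gm_separated dm0.
exists (Num.max 1 (Num.max (C2 / rho + 1) (Hm / dm + 1))) => r.
rewrite !ge_max => /and3P[r1 r2 r3] g X th gK hX geq Tth mth.
have r0 : 0 < r by exact: lt_le_trans r1.
have rr : r <= r ^+ 2 by rewrite expr2 ler_peMr// ltW.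
have rg0 s : `|(r *: g th0) ord0 s| <= K.
  by have := gK th0 s Th0; rewrite G0 !mxE subr0.
have sG : r ^+ 2 * sqnorm (Gm th) <= C2.
  exact (argmin_rate lam0 x00 (ltW eta0) hlam hx0 eta2 hX gK Tth mth).
have thdm : `|th - th0| < dm.
  apply: hrho => //; have : C2 / rho < r ^+ 2 by apply: (lt_le_trans _ (le_trans r2 rr)); rewrite ltrDl.
  rewrite ltr_pdivrMr// => h; have r20 : 0 < r ^+ 2 by rewrite exprn_gt0.
  by rewrite -(ltr_pM2l r20); exact: le_lt_trans sG h.
pose h := r *: (th - th0); pose hs := influence (r *: g th0).
have hH s : `|h ord0 s| <= Hm.
  apply: le_trans HmC.
  apply: le_trans (coord_le_sqnorm h s) _; apply: ler_wsqrtr.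
  rewrite /h sqnormZ ler_pdivlMr// mulrAC -mulrA; apply: le_trans sG.
  apply: ler_wpM2l; first exact: sqr_ge0.
  apply: hdl1.
  by move: thdm; rewrite !lt_min => /and3P[].
have hsH s : `|hs ord0 s| <= Hm.
  apply: le_trans HmI.
  rewrite /hs /influence mxE normrN -!mulmxA; apply: mulmx_entry_le => [|//|]; first exact: ltW.
  by move=> *; rewrite mulmxA; exact: hbI.
(* The competitor: its rescaled deviation is exactly [hs], and it lies in [Theta] for large [r]
   because [th0] is interior. *)
pose ths := th0 + r^-1 *: hs.
have rths : r *: (ths - th0) = hs.
  by rewrite /ths addrC addKr scalerA divff ?scale1r// gt_eqF.
have thsdm : `|ths - th0| < dm.
  apply: (@le_lt_trans _ _ (Hm / r)).
    apply: row_norm_le => [|s]; first by rewrite divr_ge0// ltW.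
    rewrite /ths addrC addKr mxE normrM gtr0_norm ?invr_gt0// mulrC.
    by apply: ler_wpM2r; [rewrite invr_ge0 ltW|exact: hsH].
  rewrite ltr_pdivrMr// mulrC -ltr_pdivrMr//; by apply: lt_le_trans r3; rewrite ltrDl.
have Tths : Theta ths by apply: hdi; move: thsdm; rewrite !lt_min => /and4P[].
have lin t (k := r *: (t - th0)) : Theta t -> `|t - th0| < dm -> (forall s, `|k ord0 s| <= Hm) ->
    (forall s, `|(r *: g t - (r *: g th0 + k *m Jr)) ord0 s| <= 2 * eta) /\
    (forall s, `|(r *: g th0 + k *m Jr) ord0 s| <= K + p%:R * (Hm * bJ)).
  move=> Tt; rewrite !lt_min => /and4P[t1 t2 t3 t4] kH; split => s.
    have q1 := geq t s Tt t1; rewrite G0 mxE subr0 in q1.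
    exact: (linear_close (lt_le_trans ltr01 Hm1) r0 kH q1 (hdld t t3 s)).
  rewrite mxE; apply: le_trans (ler_normD _ _) _; apply: lerD; first exact: rg0.
  by apply: mulmx_entry_le => //; lra.
have bound t (k := r *: (t - th0)) : Theta t -> `|t - th0| < dm -> (forall s, `|k ord0 s| <= Hm) ->
    `|qf X (r *: g t) (r *: g t) - qf Xi (r *: g th0 + k *m Jr) (r *: g th0 + k *m Jr)| <= C3 * eta.
  move=> Tt tdm kH; have [b1 b2] := lin t Tt tdm kH.
  set a := r *: g th0 + _ in b1 b2 *; set v := r *: g t in b1 *.
  have va s : `|v ord0 s| <= A.
    have -> : v ord0 s = a ord0 s + (v - a) ord0 s by rewrite !mxE addrCA subrr addr0.
    by apply: le_trans (ler_normD _ _) _; apply: lerD; [exact: b2|apply: le_trans (b1 s) _; rewrite ler_piMr].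
  have aA s : `|a ord0 s| <= A by apply: le_trans (b2 s) _; exact: AA'.
  apply: le_trans (qf_close A0 x00 (ltW eta0) va aA b1 hX hx0) _.
  by apply: ler_wpM2r; [exact: ltW|rewrite lerDl].
have bh := bound th Tth thdm hH.
have bhs := bound ths Tths thsdm; rewrite rths in bhs; have {}bhs := bhs hsH.
have qX : qf X (r *: g th) (r *: g th) <= qf X (r *: g ths) (r *: g ths).
  by rewrite !qfZ ler_wpM2l ?sqr_ge0//; exact: mth.
(* Pythagoras: the first-order condition kills the cross term, so the excess of the linearized
   objective at [h] over [hs] is the form at [(h - hs) *m Jr]. *)
have qE : qf Xi (r *: g th0 + h *m Jr) (r *: g th0 + h *m Jr) =
    qf Xi (r *: g th0 + hs *m Jr) (r *: g th0 + hs *m Jr) + qf Xi ((h - hs) *m Jr) ((h - hs) *m Jr).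
  have -> : r *: g th0 + h *m Jr = (r *: g th0 + hs *m Jr) + (h - hs) *m Jr.
    by rewrite mulmxBl -addrA [X in _ = _ + X]addrC subrK.
  have z := influence_foc (r *: g th0) (h - hs); rewrite -/hs in z.
  move: (_ + hs *m Jr) z => a z.
  by rewrite qfDl !qfDr (qfC ((h - hs) *m Jr) a sXi) z addr0 add0r.
have low := le_trans (ler_wpM2l (ltW lam0) (hcJ (h - hs))) (hlam _).
move=> s; have -> : r * (th - th0) ord0 s - influence (r *: g th0) ord0 s = (h - hs) ord0 s.
  by rewrite [RHS]mxE /h [X in _ = X + _]mxE [X in _ = _ + X]mxE.
have sl := sqr_le_sqnorm (h - hs) s.
rewrite -(ger0_norm (ltW kap0)) -ler_sqr ?nnegrE// !real_normK ?num_real//.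
have lc : 0 < lam * cJ by rewrite mulr_gt0.
rewrite -(ler_pM2r lc); apply: le_trans eta3.
(* The linearized objective errs by at most [C3 * eta] at each of the two points and the true one is
   not larger at [th], so the excess is at most [2 * C3 * eta]. *)
move: bh bhs; rewrite -/h !ler_norml => /andP[u1 u2] /andP[u3 u4].
have : (lam * cJ) * (h - hs) ord0 s ^+ 2 <= (lam * cJ) * sqnorm (h - hs) by rewrite ler_pM2l.
by rewrite mulrC -mulrA in low *; lra.
Qed.

End MEstimation.

(** * The empirical process over the parameter space *)

Section DenseSup.
Context {R : realType} {d} {T : measurableType d} (P : probability T R).

Lemma null_countable_union (I : countType) (F : I -> set T) :
  (forall i, measurable (F i)) -> (forall i, P (F i) = 0%E) ->
  exists B, [/\ measurable B, P B = 0%E & forall i, F i `<=` B].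
Proof.
move=> mF F0.
pose G n := if unpickle n is Some i then F i else set0.
have mG n : measurable (G n) by rewrite /G; case: (unpickle n).
have G0 n : P.-negligible (G n).
  by exists (G n); split => //; rewrite /G; case: (unpickle n) => [i|]; [exact: F0|exact: measure0].
exists (\bigcup_n G n); split; first exact: bigcupT_measurable.
- by apply/(negligibleP _ _).1; [exact: bigcupT_measurable|exact: negligible_bigcup].
- by move=> i w Fw; exists (pickle i) => //; rewrite /G pickleK.
Qed.

Lemma finite_union_le (I : finType) (F : I -> set T) (c : R) :
  (forall i, measurable (F i)) -> (forall i, (P (F i) <= c%:E)%E) ->
  exists B, [/\ measurable B, (P B <= (#|I|%:R * c)%:E)%E & forall i, F i `<=` B].
Proof.
move=> mF Fc.
have [B [mB PB FB]] : exists B, [/\ measurable B, (P B <= ((size (enum I))%:R * c)%:E)%E &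
    forall i, i \in enum I -> F i `<=` B].
  elim: (enum I) => [|i s [B [mB PB FB]]].
    by exists set0; split => //; rewrite mul0r measure0.
  exists (F i `|` B); split; first exact: measurableU.
    apply: le_trans (measureU2 _ (mF i) mB) _.
    by rewrite /= -natr1 mulrDl mul1r addrC EFinD; apply: leeD.
  move=> j; rewrite inE => /predU1P[->|js]; first exact: subsetUl.
  by apply: subset_trans (FB j js) _; exact: subsetUr.
exists B; split => //; first by rewrite cardE.
by move=> i; apply: FB; rewrite mem_enum.
Qed.

(** Markov's inequality bounds the maximum over the first [q] points uniformly in [q], and these
    events increase to the one for the whole sequence. *)
Lemma countable_sup_event (I : eqType) (D : nat -> I) (f : I -> T -> R) (b a : R) :
  (forall i, L2 P (f (D i))) -> (forall q, Ex P (fun w => bmax (map D (iota 0 q)) (fun i => f i w)) <= b) ->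
  0 < a -> exists B, [/\ measurable B, (P B <= (b / a)%:E)%E & forall w, ~ B w -> forall i, `|f (D i) w| <= a].
Proof.
move=> f2 fb a0.
pose F q := [set w | a < bmax (map D (iota 0 q)) (fun i => f i w)].
have b2 q : L2 P (fun w => bmax (map D (iota 0 q)) (fun i => f i w)).
  by apply: bmax_L2 => i /mapP[j _ ->]; exact: f2.
have mF q : measurable (F q).
  rewrite (_ : F q = (fun w => bmax (map D (iota 0 q)) (fun i => f i w)) @^-1` `]a, +oo[%classic).
    by rewrite -[X in measurable X]setTI; apply: (b2 q).1 => //; exact: measurable_itv.
  by apply/seteqP; split => w /=; rewrite in_itv/= andbT.
have PF q : (P (F q) <= (b / a)%:E)%E.
  apply: le_trans (markovEx a0 (L2_intg (b2 q)) (mF q) (fun w => bmax_ge0 _ _) _) _ => [w /ltW//|].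
  by rewrite lee_fin ler_pM2r ?invr_gt0.
have nd : nondecreasing_seq F.
  move=> q q' qq'; apply/subsetPset => w /lt_le_trans; apply.
  apply: bmax_le => [|i /mapP[j jq ->]]; first exact: bmax_ge0.
  apply: le_bmax; apply: map_f; move: jq; rewrite !mem_iota/= !add0n => jq.
  exact: leq_trans jq qq'.
exists (\bigcup_q F q); split; first exact: bigcupT_measurable.
  have cv := @nondecreasing_cvg_mu _ _ _ P F mF (bigcupT_measurable F mF) nd.
  by apply: (cvge_le _ cv); near=> q; exact: PF.
move=> w Bw i; rewrite leNgt; apply/negP => fa; apply: Bw.
exists i.+1 => //; apply: lt_le_trans fa _; apply: le_bmax.
by apply: map_f; rewrite mem_iota/= add0n.
Unshelve. all: by end_near. Qed.

Context {p : nat}.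
Implicit Types Th : set 'rV[R]_p.

Definition dense_seq Th (D : nat -> 'rV[R]_p) := (forall i, Th (D i)) /\
  forall th, Th th -> forall r, 0 < r -> exists i, `|D i - th| < r.

(** The sequence enumerates finite nets of mesh [1 / (q + 1)] by pairs of a level and a position;
    positions outside a net return [th0]. *)
Lemma compact_dense_seq Th th0 : compact Th -> Th th0 -> exists D, dense_seq Th D.
Proof.
move=> cT T0.
have /choice[S hS] : forall q : nat, exists S : seq 'rV[R]_p, (forall x, x \in S -> Th x) /\
    forall th, Th th -> exists2 x, x \in S & `|x - th| < q.+1%:R^-1.
  move=> q; have := cT; rewrite compact_cover => /(_ _ Th (fun x => ball x (q.+1%:R^-1 : R))).
  case.
  - by move=> x _; exact: ball_open.
  - by move=> x Tx; exists x => //; apply: ballxx; rewrite invr_gt0.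
  move=> S ST cS; exists (finmap.enum_fset S); split.
    by move=> x xS; apply: set_mem; exact: ST.
  move=> th /cS [x /= xS xth]; exists x => //.
  by move: xth; rewrite -ball_normE.
pose D i := if unpickle i is Some (q, a) then nth th0 (S q) a else th0.
exists D; split.
  move=> i; rewrite /D; case: unpickle => // -[q a].
  have [aS|aS] := ltnP a (size (S q)); last by rewrite nth_default.
  by apply: (hS q).1; exact: mem_nth.
move=> th Tt r r0.
have [q hq] : exists q : nat, r^-1 < q.+1%:R by exists (Num.truncn r^-1); exact: truncnS_gt.
have [x xS xth] := (hS q).2 th Tt.
exists (pickle (q, index x (S q))); rewrite /D pickleK nth_index//.
apply: lt_trans xth _; rewrite -[ltRHS]invrK ltf_pV2// posrE ?invr_gt0//.
Qed.

Lemma ball_dense_seq Th D th0 r : dense_seq Th D -> Th th0 -> 0 < r ->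
  exists D', dense_seq (Th `&` [set th | `|th - th0| < r]) D'.
Proof.
move=> [TD dD] T0 r0.
exists (fun i => if `|D i - th0| < r then D i else th0); split.
  move=> i; case: ifP => [h|_]; first by split => //; exact: TD.
  by split => //=; rewrite subrr normr0.
move=> th [Tt thr] e e0 /=.
have m0 : 0 < Num.min e (r - `|th - th0|) by rewrite lt_min e0 subr_gt0.
have [i] := dD th Tt _ m0; rewrite lt_min => /andP[h1 h2]; exists i.
rewrite ifT//; rewrite -(subrKA th); apply: le_lt_trans (ler_normD _ _) _; lra.
Qed.

(** Off the null set where continuity may fail, a value above [a] would persist at a nearby point of
    the dense sequence. *)
Lemma dense_sup_event Th D (f : 'rV[R]_p -> T -> R) (N0 : set T) (b a : R) : dense_seq Th D ->
  (forall th, Th th -> L2 P (f th)) -> measurable N0 -> P N0 = 0%E ->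
  (forall w, ~ N0 w -> {within Th, continuous (fun th => f th w)}) ->
  (forall F, (forall th, th \in F -> Th th) -> Ex P (fun w => bmax F (fun th => f th w)) <= b) ->
  0 < a -> exists B, [/\ measurable B, (P B <= (b / a)%:E)%E &
    forall w, ~ B w -> forall th, Th th -> `|f th w| <= a].
Proof.
move=> [TD dD] f2 mN PN fc fb a0.
have [||B [mB PB hB]] := @countable_sup_event _ D f b a _ _ a0.
- by move=> i; apply: f2.
- by move=> q; apply: fb => th /mapP[i _ ->]; exact: TD.
exists (B `|` N0); split; first exact: measurableU.
  apply: le_trans (measureU2 _ mB mN) _; rewrite -[leRHS]adde0; apply: leeD => //.
  by rewrite le_eqVlt; apply/orP; left; apply/eqP; exact: PN.
move=> w /not_orP[Bw Nw] th Tt; rewrite leNgt; apply/negP => fa.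
have := (subspace_continuousP _ _).1 (fc w Nw) th Tt.
have e0 : 0 < `|f th w| - a by rewrite subr_gt0.
move=> /cvgrPdist_lt /(_ _ e0); rewrite near_withinE => /nbhs_ballP[r /= r0 hr].
have [i hi] := dD th Tt r r0.
have := hr (D i); rewrite -ball_normE/= distrC => /(_ hi (TD i)).
have := hB w Bw i; have := ler_normD (f th w - f (D i) w) (f (D i) w); rewrite subrK; lra.
Qed.

End DenseSup.

(** * Uniform events for the empirical moments *)

Section GMMEvents.
Context {R : realType} {d} {T : measurableType d} (P : probability T R).
Context {k l L p : nat} (Ycal : set 'rV[R]_l).
Context (N : cell k -> T -> nat) (Y : cell k -> nat -> T -> 'rV[R]_l).
Hypothesis mN : forall j n, measurable [set w | N j w = n].
Hypothesis mY : forall j ell s, measurable_fun setT (fun w => Y j ell w ord0 s).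
Hypothesis YY : forall j ell w, Ycal (Y j ell w).
Hypothesis exch : sep_exchangeable P N Y.
Hypothesis bind : block_independent P N Y.
Hypothesis k0 : (0 < k)%N.
Variables (m : 'rV[R]_l -> 'rV[R]_p -> 'rV[R]_L) (Theta : set 'rV[R]_p) (th0 : 'rV[R]_p).
Hypothesis cT : compact Theta.
Hypothesis T0 : Theta th0.
Hypothesis G3 : forall th, Theta th ->
  ((\int[P]_w (sqnorm (cellsum N Y m (cell1 k) th' w - cellsum N Y m (cell1 k) th w)%R)%:E)
     @[th' --> within Theta (nbhs th)] --> 0)%E.
Hypothesis bh : forall s th, Theta th -> borel_fun_on Ycal (fun y => m y th ord0 s).
Hypothesis A3 : forall s : 'I_L, cond_A3' P N Y Ycal
  [set f | exists2 th, Theta th & f = (fun y => m y th ord0 s)].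

Definition mcoord (s : 'I_L) (th : 'rV[R]_p) (y : 'rV[R]_l) : R := m y th ord0 s.

Lemma cellsumE j th w s : cellsum N Y m j th w ord0 s = cellf N Y (mcoord s th) j w.
Proof. by rewrite /cellsum summxE. Qed.

Lemma ghatE C th w s : ghat N Y m C th w ord0 s = gmean C (fun j => cellf N Y (mcoord s th) j w).
Proof.
rewrite /ghat mxE summxE /gmean; congr (_ * _); apply: eq_bigr => j _.
exact: cellsumE.
Qed.

Let comp s := gmm_component mN mY YY exch bind k0 T0 (h := mcoord s) (bh s) (A3 s).

Lemma mcoord_L2 s th j : Theta th -> L2 P (cellf N Y (mcoord s th) j).
Proof. by case: (comp s) => h _ _ _; exact: h. Qed.

Lemma cdist2_continuous s th : Theta th -> forall e, 0 < e -> exists2 dl, 0 < dl &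
  forall th', Theta th' -> `|th' - th| < dl -> cdist2 P N Y (mcoord s) th' th <= e.
Proof.
move=> Tt e e0.
have := G3 Tt => /fine_cvg /cvgrPdist_le /(_ _ e0).
rewrite near_withinE => /nbhs_ballP[dl /= dl0 hdl].
exists dl => // th' Tt' hth'.
have := hdl th'; rewrite -ball_normE/= distrC => /(_ hth' Tt').
rewrite sub0r normrN; apply: le_trans.
have i2 s' : L2 P (fun w => cellf N Y (mcoord s' th') (cell1 k) w - cellf N Y (mcoord s' th) (cell1 k) w).
  by apply: L2B; exact: mcoord_L2.
have E : (fun w => sqnorm (cellsum N Y m (cell1 k) th' w - cellsum N Y m (cell1 k) th w)) =
    (fun w => \sum_s' (cellf N Y (mcoord s' th') (cell1 k) w - cellf N Y (mcoord s' th) (cell1 k) w) ^+ 2).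
  by apply/funext => w; apply: eq_bigr => s' _; rewrite mxE [X in _ + X]mxE !cellsumE.
have iS : intg P (fun w => \sum_s' (cellf N Y (mcoord s' th') (cell1 k) w - cellf N Y (mcoord s' th) (cell1 k) w) ^+ 2).
  by apply: intg_sum => s' _; exact: (i2 s').2.
apply: le_trans (ler_norm _); rewrite /cdist2.
change (Ex P (fun w => (cellf N Y (mcoord s th') (cell1 k) w - cellf N Y (mcoord s th) (cell1 k) w) ^+ 2)
  <= Ex P (fun w => sqnorm (cellsum N Y m (cell1 k) th' w - cellsum N Y m (cell1 k) th w))).
rewrite E; apply: le_Ex => [|//|w]; first exact: (i2 s).2.
by rewrite (bigD1 s)//= lerDl sumr_ge0// => i _; exact: sqr_ge0.
Qed.

Lemma cellf_as_continuous : exists N0, [/\ measurable N0, P N0 = 0%E & forall w, ~ N0 w ->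
  forall s j, {within Theta, continuous (fun th => cellf N Y (mcoord s th) j w)}].
Proof.
have /choice[W hW] : forall s, exists W : cell k -> T -> R, forall j e, 0 < e -> exists s' Nn,
    [/\ 0 < s', measurable Nn, P Nn = 0%E &
    forall w, ~ Nn w -> forall th th', Theta th -> Theta th' -> cdist2 P N Y (mcoord s) th th' <= s' ->
    `|cellf N Y (mcoord s th) j w - cellf N Y (mcoord s th') j w| <= e * W j w].
  by move=> s; case: (comp s).
(* One null set per tolerance, coordinate and cell; cells are coded as finite functions so that the
   index type is countable. *)
have /choice[S hS] : forall i : nat * 'I_L * {ffun 'I_k -> nat}, exists S : R * set T,
    [/\ 0 < S.1, measurable S.2, P S.2 = 0%E &
    forall w, ~ S.2 w -> forall th th', Theta th -> Theta th' -> cdist2 P N Y (mcoord i.1.2) th th' <= S.1 ->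
    `|cellf N Y (mcoord i.1.2 th) i.2 w - cellf N Y (mcoord i.1.2 th') i.2 w| <= i.1.1.+1%:R^-1 * W i.1.2 i.2 w].
  move=> i; have e0 : 0 < i.1.1.+1%:R^-1 :> R by rewrite invr_gt0.
  by have [s' [Nn h]] := hW i.1.2 i.2 _ e0; exists (s', Nn).
have [|i|N0 [mN0 PN0 hN0]] := @null_countable_union _ _ _ P _ (fun i => (S i).2).
- by move=> i; case: (hS i).
- by case: (hS i).
exists N0; split => // w Nw s j.
apply/subspace_continuousP => th Tt; apply/cvgrPdist_le => e e0.
have [q hq] : exists q : nat, `|W s j w| / e < q.+1%:R.
  by exists (Num.truncn (`|W s j w| / e)); exact: truncnS_gt.
pose i := (q, s, [ffun i => j i]) : nat * 'I_L * {ffun 'I_k -> nat}.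
have jE : (i.2 : cell k) = j by apply/funext => i'; rewrite ffunE.
have [s0 _ _ hw] := hS i.
have {}hw := hw w (fun h => Nw (hN0 i w h)).
have [dl dl0 hdl] := cdist2_continuous s Tt s0.
rewrite near_withinE; apply/nbhs_ballP; exists dl => //= th'.
rewrite -ball_normE/= distrC => hth' Tt'.
have := hw th' th Tt' Tt (hdl th' Tt' hth'); rewrite distrC jE => /le_trans; apply.
rewrite /= mulrC ler_pdivrMr//.
by move: hq; rewrite ltr_pdivrMr// mulrC => /ltW; apply: le_trans; exact: ler_norm.
Qed.

Lemma gmean_continuous C w s :
  (forall j, {within Theta, continuous (fun th => cellf N Y (mcoord s th) j w)}) ->
  {within Theta, continuous (fun th => gmean C (fun j => cellf N Y (mcoord s th) j w))}.
Proof.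
move=> hc; rewrite /gmean => th.
apply: (@continuousM _ (subspace Theta) (fun=> (PiC C)%:R^-1)); first exact: cst_continuous.
by move: th; apply: (@continuous_bigsum _ (subspace Theta)) => j; exact: hc.
Qed.

Lemma mean_continuous s :
  {within Theta, continuous (fun th => Ex P (cellf N Y (mcoord s th) (cell1 k)))}.
Proof.
apply/subspace_continuousP => th Tt; apply/cvgrPdist_le => e e0.
have [dl dl0 hdl] := cdist2_continuous s Tt (exprn_gt0 2 e0).
rewrite near_withinE; apply/nbhs_ballP; exists dl => //= th'.
rewrite -ball_normE/= distrC => hth' Tt'.
have L1 := mcoord_L2 s (cell1 k) Tt; have L1' := mcoord_L2 s (cell1 k) Tt'.
rewrite distrC -ExB; [|exact: L2_intg..].
apply: le_trans (Ex_norm (intgB (L2_intg L1') (L2_intg L1))) _.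
by apply: Ex_norm_le; [exact: ltW|exact (L2B L1' L1)|exact: hdl].
Qed.

Lemma cemp_continuous C n w s :
  (forall j, {within Theta, continuous (fun th => cellf N Y (mcoord s th) j w)}) ->
  {within Theta, continuous (fun th => cemp P N Y (mcoord s) C n th w)}.
Proof.
move=> hc th; apply: (@continuousM _ (subspace Theta) (fun=> Num.sqrt n%:R)); first exact: cst_continuous.
by apply: (@continuousB _ _ (subspace Theta)); [exact: gmean_continuous|exact: mean_continuous].
Qed.

Lemma cemp_L2 s C n th : Theta th -> L2 P (cemp P N Y (mcoord s) C n th).
Proof.
move=> Tt; apply: (L2Z _ (f := fun w => gmean C (fun j => cellf N Y (mcoord s th) j w) - _)).
apply: L2B; last exact (L2_cst _ _).
by apply: L2Z; apply: L2_sum => j _; exact: mcoord_L2.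
Qed.

Lemma cemp_bound_event e : 0 < e -> exists2 K, 0 < K & forall C n, (0 < n)%N -> (forall i, (n <= C i)%N) ->
  exists B, [/\ measurable B, (P B <= e%:E)%E & forall w, ~ B w -> forall s th, Theta th ->
    `|cemp P N Y (mcoord s) C n th w| <= K].
Proof.
move=> e0; have [D dD] := compact_dense_seq cT T0.
have [N0 [mN0 PN0 cN0]] := cellf_as_continuous.
have /choice[b hb] : forall s, exists b, forall C n F, (0 < n)%N -> (forall i, (n <= C i)%N) ->
    (forall th, th \in F -> Theta th) -> Ex P (fun w => bmax F (fun th => cemp P N Y (mcoord s) C n th w)) <= b.
  by move=> s; case: (comp s).
pose b' := \sum_s `|b s| + 1.
have b'0 : 0 < b' by apply: ltr_wpDl => //; apply: sumr_ge0.
have bb' s : b s <= b'.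
  rewrite /b' (bigD1 s)//= -addrA; apply: le_trans (ler_norm _) _; rewrite lerDl addr_ge0// sumr_ge0//.
have L1 : 0 < L%:R + 1 :> R by rewrite ltr_wpDl.
(* With this threshold each of the [L] coordinates fails with probability at most [e / (L + 1)]. *)
pose K := b' * (L%:R + 1) / e.
have K0 : 0 < K by rewrite divr_gt0// mulr_gt0.
exists K => // C n n0 nC.
have /choice[F hF] : forall s, exists F, [/\ measurable F, (P F <= (b' / K)%:E)%E &
    forall w, ~ F w -> forall th, Theta th -> `|cemp P N Y (mcoord s) C n th w| <= K].
  move=> s; apply: (dense_sup_event dD _ mN0 PN0) => //.
  - by move=> th; exact: cemp_L2.
  - by move=> w Nw; apply: cemp_continuous => j; exact: cN0.
  - by move=> F FT; apply: le_trans (bb' s); exact: hb.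
have [||B [mB PB FB]] := @finite_union_le _ _ _ P _ F (b' / K).
- by move=> s; case: (hF s).
- by move=> s; case: (hF s).
exists B; split => //.
  apply: le_trans PB _; rewrite lee_fin card_ord /K.
  rewrite (_ : _ * _ = L%:R / (L%:R + 1) * e); last by field; rewrite !gt_eqF.
  by rewrite ler_piMl ?(ltW e0)// ler_pdivrMr// mul1r lerDl.
move=> w Bw s th; have [_ _ h] := hF s; apply: h => Fw.
exact: Bw (FB s _ Fw).
Qed.

Lemma cemp_equicont_event e eta : 0 < e -> 0 < eta -> exists2 dl, 0 < dl &
  forall C n, (0 < n)%N -> (forall i, (n <= C i)%N) ->
  exists B, [/\ measurable B, (P B <= e%:E)%E & forall w, ~ B w -> forall s th, Theta th -> `|th - th0| < dl ->
    `|cemp P N Y (mcoord s) C n th w - cemp P N Y (mcoord s) C n th0 w| <= eta].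
Proof.
move=> e0 eta0; have [D dD] := compact_dense_seq cT T0.
have [N0 [mN0 PN0 cN0]] := cellf_as_continuous.
have L1 : 0 < L%:R + 1 :> R by rewrite ltr_wpDl.
(* The mean oscillation that Markov's inequality at level [eta] turns into probability [e / (L + 1)]
   per coordinate. *)
pose b := e * eta / (L%:R + 1).
have b0 : 0 < b by rewrite divr_gt0// mulr_gt0.
have /choice[dls hdls] : forall s, exists dl, 0 < dl /\ forall C n F, (0 < n)%N -> (forall i, (n <= C i)%N) ->
    (forall th, th \in F -> Theta th /\ `|th - th0| < dl) ->
    Ex P (fun w => bmax F (fun th => cemp P N Y (mcoord s) C n th w - cemp P N Y (mcoord s) C n th0 w)) <= b.
  move=> s; case: (comp s) => _ _ h _; have [sg sg0 hsg] := h _ b0.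
  have [dl dl0 hdl] := cdist2_continuous s T0 (exprn_gt0 2 sg0).
  exists dl; split => // C n F n0 nC hF; apply: hsg => // th thF.
  by have [Tt tdl] := hF th thF; split => //; exact: hdl.
have [dl dl0 hdl] : exists2 dl, 0 < dl & forall s, dl <= dls s.
  exists (\big[Num.min/1]_s dls s); last by move=> s; exact: bigmin_le_cond.
  by elim/big_ind: _ => // [x y x0 y0|s _]; [rewrite lt_min x0|case: (hdls s)].
exists dl => // C n n0 nC.
have [D' dD'] := ball_dense_seq dD T0 dl0.
have sub : Theta `&` [set th | `|th - th0| < dl] `<=` Theta by move=> x [].
have /choice[F hF] : forall s, exists F, [/\ measurable F, (P F <= (b / eta)%:E)%E &
    forall w, ~ F w -> forall th, (Theta `&` [set th | `|th - th0| < dl]) th ->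
    `|cemp P N Y (mcoord s) C n th w - cemp P N Y (mcoord s) C n th0 w| <= eta].
  move=> s; apply: (dense_sup_event dD' _ mN0 PN0) => //.
  - by move=> th [Tt _]; apply: L2B; [exact (cemp_L2 s C n Tt)|exact (cemp_L2 s C n T0)].
  - move=> w Nw; apply: (continuous_subspaceW sub) => th.
    apply: (@continuousB _ _ (subspace Theta)); last exact: cst_continuous.
    by apply: cemp_continuous => j; exact: cN0.
  - move=> F FT; apply: (hdls s).2 => // th thF; have [Tt tdl] := FT th thF; split => //.
    exact: lt_le_trans tdl (hdl s).
have [||B [mB PB FB]] := @finite_union_le _ _ _ P _ F (b / eta).
- by move=> s; case: (hF s).
- by move=> s; case: (hF s).
exists B; split => //.
  apply: le_trans PB _; rewrite lee_fin card_ord /b.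
  rewrite (_ : _ * _ = L%:R / (L%:R + 1) * e); last by field; rewrite !gt_eqF.
  by rewrite ler_piMl ?(ltW e0)// ler_pdivrMr// mul1r lerDl.
move=> w Bw s th Tt tdl; have [_ _ h] := hF s; apply: h => // Fw.
exact: Bw (FB s _ Fw).
Qed.

End GMMEvents.

(** * Asymptotic normality *)

Section BorelTrace.
Context {R : realType} {l : nat} (Ycal : set 'rV[R]_l).

(** The sets that look Borel from inside [Ycal] form a sigma-algebra for which [borel_fun_on] is
    plain measurability; closure under linear combinations is then inherited. *)
Let traces : set (set 'rV[R]_l) := [set S | exists A, borel_rV A /\ Ycal `&` S = Ycal `&` A].

Let traces_sigma : sigma_algebra setT traces.
Proof.
split.
- by exists set0; split => //; exact: sigma_algebra0.
- move=> S [A [bA SA]]; exists (setT `\` A); split; first exact: sigma_algebraCD.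
  by rewrite !setTD; apply/seteqP; split => y [Yy nS]; split => // h; apply: nS;
    [have : (Ycal `&` A) y by []; rewrite -SA => -[]|have : (Ycal `&` S) y by []; rewrite SA => -[]].
- move=> S /choice[A hA]; exists (\bigcup_k A k); split.
    by apply: sigma_algebra_bigcup => i; exact: (hA i).1.
  by rewrite !setI_bigcupr; apply: eq_bigcupr => i _; exact: (hA i).2.
Qed.

Lemma borel_fun_on_meas (f : 'rV[R]_l -> R) :
  borel_fun_on Ycal f <-> measurable_fun setT (f : g_sigma_algebraType traces -> R).
Proof.
split=> [bf _ B mB|mf B mB].
  by rewrite setTI; apply: sub_sigma_algebra; exact: bf.
have := mf measurableT B mB; rewrite setTI => h.
have : <<s traces >> (f @^-1` B) by exact: h.
by rewrite sigma_algebra_id.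
Qed.

Lemma borel_fun_on_lincomb (I : Type) (r : seq I) (v : I -> R) (f : I -> 'rV[R]_l -> R) :
  (forall i, borel_fun_on Ycal (f i)) -> borel_fun_on Ycal (fun y => \sum_(i <- r) v i * f i y).
Proof.
move=> bf; apply/borel_fun_on_meas; elim: r => [|i r IH].
  rewrite (_ : (fun _ => _) = cst 0); first exact: measurable_cst.
  by apply/funext => y; rewrite big_nil.
rewrite (_ : (fun _ => _) = (fun y => v i * f i y + \sum_(j <- r) v j * f j y)); last first.
  by apply/funext => y; rewrite big_cons.
have h := (borel_fun_on_meas _).1 (bf i).
exact (measurable_funD (measurable_funM (measurable_cst (v i)) h) IH).
Qed.

End BorelTrace.

Section Jacobian.
Context {R : realType} {p L : nat}.

(** ['J] acts on rows from the right, so it is the transpose of the usual Jacobian matrix; this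
    accounts for the transposes in the final statement. *)
Lemma jacobian_approx (f : 'rV[R]_p -> 'rV[R]_L) a : differentiable f a -> f a = 0 ->
  forall e, 0 < e -> exists2 dl, 0 < dl & forall th, `|th - a| < dl ->
    forall s, `|f th ord0 s - ((th - a) *m 'J f a) ord0 s| <= e * `|th - a|.
Proof.
move=> df fa0 e e0; have := diff_locally df => /eqaddoE/eqaddoP /(_ e e0).
move=> /nbhs_ballP[dl /= dl0 hdl]; exists dl => // th hth s.
have := hdl (th - a); rewrite -ball_normE/= sub0r normrN => /(_ hth).
rewrite !fctE /= fa0 add0r subrK => h.
have -> : (th - a) *m 'J f a = 'd f a (th - a) by rewrite /jacobian mul_rV_lin1.
by apply: le_trans h; apply: le_trans (le_row_norm _ s); rewrite !mxE.
Qed.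

End Jacobian.

Section Sandwich.
Context {R : realType} {p L : nat} (Jr : 'M[R]_(p, L)) (Xi : 'M[R]_L).
Hypothesis sXi : Xi^T = Xi.

(** Coefficients of the linear functional of [z] obtained by testing [influence] against [t]: the
    Cramer-Wold reduction to scalar functionals of the cells. *)
Definition influence_dir (t : 'rV[R]_p) : 'cV[R]_L := - (Xi *m Jr^T *m invmx (bread Jr Xi) *m t^T).

Lemma influence_dot (z : 'rV[R]_L) (t : 'rV[R]_p) :
  (influence Jr Xi z *m t^T) ord0 ord0 = \sum_s z ord0 s * influence_dir t s ord0.
Proof.
rewrite -[RHS](_ : (z *m influence_dir t) ord0 ord0 = _); last by rewrite mxE.
by rewrite /influence /influence_dir mulNmx mulmxN !mulmxA.
Qed.

Lemma sandwich_qf (H : 'M[R]_L) (t : 'rV[R]_p) :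
  (t *m sandwich Jr^T Xi H *m t^T) ord0 ord0 =
  \sum_s \sum_s' influence_dir t s ord0 * influence_dir t s' ord0 * H s s'.
Proof.
have tE : (influence_dir t)^T = - (t *m invmx (bread Jr Xi) *m Jr *m Xi).
  rewrite /influence_dir linearN/= !trmx_mul trmxK trmx_inv (bread_sym Jr sXi) trmxK sXi.
  by rewrite !mulmxA.
have -> : t *m sandwich Jr^T Xi H *m t^T = (influence_dir t)^T *m H *m influence_dir t.
  rewrite tE /influence_dir mulNmx mulmxN mulNmx opprK /sandwich trmxK -/(bread Jr Xi).
  by rewrite !mulmxA.
rewrite mxE exchange_big/=; apply: eq_bigr => s' _; rewrite mxE mulr_suml.
by apply: eq_bigr => s _; rewrite mxE; ring.
Qed.

End Sandwich.

(** * Linearization, characteristic functions and the limit law *)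

Section AsymptoticNormality.
Context {R : realType} {d : measure_display} {T : measurableType d} (P : probability T R).
Context {k l L p : nat} (Ycal : set 'rV[R]_l).
Context (N : cell k -> T -> nat) (Y : cell k -> nat -> T -> 'rV[R]_l).
Variables (m : 'rV[R]_l -> 'rV[R]_p -> 'rV[R]_L) (Theta : set 'rV[R]_p) (th0 : 'rV[R]_p).
Variables (Xi : 'M[R]_L) (Xihat : nat -> T -> 'M[R]_L) (Cs : nat -> cell k) (lam : 'I_k -> R).
Hypothesis k0 : (0 < k)%N.
Hypothesis mN : forall j n, measurable [set w | N j w = n].
Hypothesis mY : forall j ell s, measurable_fun setT (fun w => Y j ell w ord0 s).
Hypothesis YY : forall j ell w, Ycal (Y j ell w).
Hypothesis exch : sep_exchangeable P N Y.
Hypothesis bind : block_independent P N Y.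
Hypothesis Cy : forall M : nat, \forall n \near \oo, (M <= Cmin (Cs n))%N.
Hypothesis Clam : forall i, ((Cmin (Cs n))%:R / (Cs n i)%:R : R) @[n --> \oo] --> lam i.
Hypothesis cT : compact Theta.
Hypothesis iT : (interior Theta) th0.
Hypothesis Gz : forall th, Theta th ->
  ((forall s : 'I_L, (\int[P]_w (cellsum N Y m (cell1 k) th w ord0 s)%:E = 0)%E) <-> th = th0).
Hypothesis G3 : forall th, Theta th ->
  ((\int[P]_w (sqnorm (cellsum N Y m (cell1 k) th' w - cellsum N Y m (cell1 k) th w)%R)%:E)
     @[th' --> within Theta (nbhs th)] --> 0)%E.
Hypothesis dG : differentiable (Gam P N Y m) th0.
Hypothesis rJ : \rank ('J (Gam P N Y m) th0)^T = p.
Hypothesis sX : forall n w, (Xihat n w)^T = Xihat n w.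
Hypothesis mX : forall n i j, measurable_fun setT (fun w => Xihat n w i j).
Hypothesis cX : forall i j (e : R), 0 < e ->
  (P [set w | (e <= `|Xihat n w i j - Xi i j|)%R] @[n --> \oo] --> 0)%E.
Hypothesis pdXi : forall v : 'rV[R]_L, v != 0 -> 0 < (v *m Xi *m v^T) ord0 ord0.
Hypothesis bh : forall s th, Theta th -> borel_fun_on Ycal (fun y => m y th ord0 s).
Hypothesis A3 : forall s : 'I_L, cond_A3' P N Y Ycal
  [set f | exists2 th, Theta th & f = (fun y => m y th ord0 s)].

Let T0 : Theta th0. Proof. exact: interior_subset. Qed.
Let Jr := 'J (Gam P N Y m) th0.
Let mean s th := Ex P (cellf N Y (mcoord m s th) (cell1 k)).
Let mL2 s th j := mcoord_L2 mN mY YY exch bind k0 T0 bh A3 s j (th := th).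
Let rC n : R := Num.sqrt (Cmin (Cs n))%:R.

Lemma GamE th s : Gam P N Y m th ord0 s = mean s th.
Proof.
rewrite /Gam mxE /mean /Ex /Rintegral; congr fine; apply: eq_integral => w _.
by rewrite cellsumE.
Qed.

Lemma Gam_th0 : Gam P N Y m th0 = 0.
Proof.
apply/rowP => s; rewrite /Gam !mxE.
by have [_ /(_ erefl) ->] := Gz T0.
Qed.

Lemma mean_th0 s : mean s th0 = 0.
Proof. by rewrite -GamE Gam_th0 mxE. Qed.

Lemma Gam_zero th : Theta th -> Gam P N Y m th = 0 -> th = th0.
Proof.
move=> Tt G0; apply: (Gz Tt).1 => s.
transitivity ((mean s th)%:E); last by rewrite -GamE G0 mxE.
rewrite /mean (ExE (L2_intg (mL2 s (cell1 k) Tt))); apply: eq_integral => w _.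
by rewrite cellsumE.
Qed.

Lemma Gam_sqnorm_continuous : {within Theta, continuous (fun th => sqnorm (Gam P N Y m th))}.
Proof.
rewrite (_ : (fun th => _) = fun th => \sum_s mean s th * mean s th); last first.
  by apply/funext => th; apply: eq_bigr => s _; rewrite GamE expr2.
apply: (@continuous_bigsum _ (subspace Theta)) => s th.
have := @mean_continuous _ _ _ P _ _ _ _ _ N Y mN mY YY exch bind k0 m Theta th0 T0 G3 bh A3 s.
by move=> h; apply: (@continuousM _ (subspace Theta)); exact: h.
Qed.

Lemma Jr_free : row_free Jr.
Proof. by apply/eqP; have := rJ; rewrite mxrank_tr. Qed.

Lemma Xi_event e eta : 0 < e -> 0 < eta -> \forall n \near \oo, exists B,
  [/\ measurable B, (P B <= e%:E)%E & forall w, ~ B w -> forall i j, `|Xihat n w i j - Xi i j| <= eta].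
Proof.
move=> e0 eta0.
have c0 : 0 < e / ((L * L)%N%:R + 1) by rewrite divr_gt0// ltr_wpDl.
have mF n i j : measurable [set w | (eta <= `|Xihat n w i j - Xi i j|)%R].
  rewrite (_ : [set w | _] = (fun w => `|Xihat n w i j - Xi i j|) @^-1` `[eta, +oo[%classic).
    rewrite -[X in measurable X]setTI.
    have mf : measurable_fun setT (fun w => `|Xihat n w i j - Xi i j|).
      by apply: measurableT_comp => //; apply: measurable_funB; [exact: mX|exact: measurable_cst].
    by apply: mf => //; exact: measurable_itv.
  by apply/seteqP; split => w /=; rewrite in_itv/= andbT.
have near1 i j : \forall n \near \oo, (P [set w | (eta <= `|Xihat n w i j - Xi i j|)%R] <= (e / ((L * L)%N%:R + 1))%:E)%E.
  have /fine_cvg/cvgrPdist_le/(_ _ c0) := cX i j eta0; apply: filterS => n /=.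
  rewrite sub0r normrN => h; rewrite -(fineK (fin_num_measure P _ (mF n i j))) lee_fin.
  exact: le_trans (ler_norm _) h.
have near2 : \forall n \near \oo, forall ij : 'I_L * 'I_L,
    (P [set w | (eta <= `|Xihat n w ij.1 ij.2 - Xi ij.1 ij.2|)%R] <= (e / ((L * L)%N%:R + 1))%:E)%E.
  by apply: filter_forall => ij; exact: near1.
apply: filterS near2 => n hn.
have [||B [mB PB FB]] := @finite_union_le _ _ _ P _ (fun ij : 'I_L * 'I_L => [set w | (eta <= `|Xihat n w ij.1 ij.2 - Xi ij.1 ij.2|)%R]) (e / ((L * L)%N%:R + 1)).
- by move=> ij; exact: mF.
- by move=> ij; exact: hn.
exists B; split => //.
  apply: le_trans PB _; rewrite lee_fin card_prod !card_ord mulrA ler_pdivrMr ?ltr_wpDl//.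
  by rewrite mulrC ler_pM2l// lerDl.
move=> w Bw i j; rewrite leNgt; apply/negP => h; apply: Bw.
by apply: (FB (i, j)) => /=; exact: ltW.
Qed.

(** Symmetry passes to limits in probability: at some outcome both entries lie within a quarter of
    their supposed gap of the same number. *)
Lemma Xi_sym : Xi^T = Xi.
Proof.
apply/matrixP => i j; rewrite mxE; apply/eqP; rewrite -subr_eq0; apply/eqP.
apply/eqP/negPn/negP => ne0.
have c0 : 0 < `|Xi j i - Xi i j| / 4 by rewrite divr_gt0// normr_gt0.
have half : 0 < 1 / 2 :> R by [].
have [n _ hn] := Xi_event half c0; have [B [mB PB hB]] := hn n (leqnn n).
have [w Bw] : exists w, ~ B w.
  apply: contrapT => h; have BT : B = setT.
    by apply/seteqP; split => // w _; apply: contrapT => nB; apply: h; exists w.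
  by move: PB; rewrite BT probability_setT lee_fin; lra.
have h1 := hB w Bw i j; have h2 := hB w Bw j i.
have sw : Xihat n w j i = Xihat n w i j by rewrite -[in LHS](sX n w) mxE.
rewrite sw in h2.
have := ler_normB (Xihat n w i j - Xi i j) (Xihat n w i j - Xi j i).
rewrite (_ : _ - _ - _ = Xi j i - Xi i j); last by ring.
by lra.
Qed.

Lemma rC_ge (r : R) : \forall n \near \oo, r <= rC n.
Proof.
have := Cy (Num.truncn (r ^+ 2)).+1; apply: filterS => n hn.
apply: le_trans (ler_norm _) _; rewrite -sqrtr_sqr; apply: ler_wsqrtr.
by apply/ltW/(lt_le_trans (truncnS_gt _)); rewrite ler_nat.
Qed.

Lemma gmm_objE C X th w : gmm_obj N Y m C X th w = qf X (ghat N Y m C th w) (ghat N Y m C th w).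
Proof. by []. Qed.

Lemma gmm_minimizer_as : exists N0, [/\ measurable N0, P N0 = 0%E & forall w, ~ N0 w ->
  forall n, exists th, is_minimizer Theta (fun th => gmm_obj N Y m (Cs n) (Xihat n w) th w) th].
Proof.
have [N0 [mN0 PN0 cN0]] := cellf_as_continuous mN mY YY exch bind k0 T0 G3 bh A3.
exists N0; split => // w Nw n.
have cg s : {within Theta, continuous (fun th => gmean (Cs n) (fun j => cellf N Y (mcoord m s th) j w))}.
  by apply: gmean_continuous => j; exact: cN0.
have cobj : {within Theta, continuous (fun th => gmm_obj N Y m (Cs n) (Xihat n w) th w)}.
  rewrite (_ : (fun th => _) = fun th => \sum_t \sum_s gmean (Cs n) (fun j => cellf N Y (mcoord m s th) j w) *
      Xihat n w s t * gmean (Cs n) (fun j => cellf N Y (mcoord m t th) j w)); last first.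
    apply/funext => th; rewrite gmm_objE qfE; apply: eq_bigr => t _; apply: eq_bigr => s _.
    by rewrite !ghatE.
  apply: (@continuous_bigsum _ (subspace Theta)) => t; apply: (@continuous_bigsum _ (subspace Theta)) => s th.
  apply: (@continuousM _ (subspace Theta)); last exact: cg.
  by apply: (@continuousM _ (subspace Theta)); [exact: cg|exact: cst_continuous].
have [c /set_mem Tc hc] := EVT_min_rV (ex_intro _ th0 T0) cT cobj.
by exists c; split => // th' Tt'; apply: hc; exact: mem_set.
Qed.

Section Estimator.
Variable thetahat : nat -> T -> 'rV[R]_p.
Hypothesis mth : forall n s, measurable_fun setT (fun w => thetahat n w ord0 s).
Variable Bmin : nat -> set T.
Hypothesis mBmin : forall n, measurable (Bmin n).
Hypothesis PBmin : (P (Bmin n) @[n --> \oo] --> 1)%E.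
Hypothesis hBmin : forall n w, Bmin n w ->
  is_minimizer Theta (fun th => gmm_obj N Y m (Cs n) (Xihat n w) th w) (thetahat n w).

Let hX n w : 'rV[R]_p := rC n *: (thetahat n w - th0).
Let hS n w : 'rV[R]_p := influence Jr Xi (rC n *: ghat N Y m (Cs n) th0 w).

(** [K] is fixed before [kap], so one statement gives both tightness, with [kap = 1], and closeness
    of characteristic functions, with [kap] small. Four exceptional events of probability [e / 4]
    concern boundedness, equicontinuity, the weighting matrix and minimization. *)
Lemma linearization_event e : 0 < e -> exists K, forall kap, 0 < kap -> \forall n \near \oo, exists B,
  [/\ measurable B, (P B <= e%:E)%E & forall w, ~ B w -> forall s,
    `|hX n w ord0 s - hS n w ord0 s| <= kap /\ `|hS n w ord0 s| <= K].
Proof.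
move=> e0; have e4 : 0 < e / 4 by rewrite divr_gt0.
have [K K0 hK] := cemp_bound_event mN mY YY exch bind k0 cT T0 G3 bh A3 e4.
have [c c0 hc] := entries_bounded (Xi *m Jr^T *m invmx (bread Jr Xi)).
exists (L%:R * (K * c)) => kap kap0.
have [eta eta0 heta] := argmin_linearization cT iT Gam_th0 Gam_zero Gam_sqnorm_continuous Jr_free
  (jacobian_approx dG Gam_th0) Xi_sym pdXi K0 kap0.
have [dl dl0 hdl] := cemp_equicont_event mN mY YY exch bind k0 cT T0 G3 bh A3 e4 eta0.
have [r0 hr0] := heta dl dl0.
have near_min := prob1_near mBmin PBmin e4.
near=> n.
have C1 : (1 <= Cmin (Cs n))%N by near: n; exact: Cy.
have CC i : (Cmin (Cs n) <= Cs n i)%N by exact: Cmin_le.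
have [B1 [mB1 PB1 hB1]] := hK (Cs n) _ C1 CC.
have [B2 [mB2 PB2 hB2]] := hdl (Cs n) _ C1 CC.
have [B3 [mB3 PB3 hB3]] : exists B, [/\ measurable B, (P B <= (e / 4)%:E)%E &
    forall w, ~ B w -> forall i j, `|Xihat n w i j - Xi i j| <= eta].
  by near: n; exact: Xi_event.
have PB4 : (P (~` Bmin n) <= (e / 4)%:E)%E by near: n.
exists (B1 `|` B2 `|` (B3 `|` ~` Bmin n)); split.
- by apply: measurableU; apply: measurableU => //; exact: measurableC.
- have mB4 := measurableC (mBmin n).
  apply: le_trans (measureU2 _ (measurableU _ _ mB1 mB2) (measurableU _ _ mB3 mB4)) _.
  apply: le_trans (leeD (measureU2 _ mB1 mB2) (measureU2 _ mB3 mB4)) _.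
  apply: le_trans (leeD (leeD PB1 PB2) (leeD PB3 PB4)) _.
  by rewrite -!EFinD lee_fin; lra.
move=> w /not_orP[/not_orP[Bw1 Bw2] /not_orP[Bw3 /contrapT Bw4]] s.
have [Tth mmin] := hBmin Bw4.
have cE s' th : cemp P N Y (mcoord m s') (Cs n) (Cmin (Cs n)) th w =
    rC n * (ghat N Y m (Cs n) th w ord0 s' - Gam P N Y m th ord0 s').
  by rewrite ghatE GamE.
have rn : r0 <= rC n by near: n; exact: rC_ge.
split; last first.
  rewrite /hS /influence mxE normrN -!mulmxA; apply: mulmx_entry_le => [|s'|s' t].
  - exact: ltW.
  - have := hB1 w Bw1 s' th0 T0; rewrite cE Gam_th0 [X in _ - X]mxE subr0 => h.
    by rewrite [X in `|X|]mxE.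
  - by rewrite mulmxA; exact: hc.
have -> : hX n w ord0 s = rC n * (thetahat n w - th0) ord0 s by rewrite /hX mxE.
have := hr0 _ rn (fun th => ghat N Y m (Cs n) th w) (Xihat n w) (thetahat n w) _ _ _ Tth mmin s.
apply.
- by move=> th s' Tt; rewrite -cE; exact: hB1.
- by move=> i j; exact: hB3.
- by move=> th s' Tt tdl; rewrite -!cE; exact: hB2.
Unshelve. all: by end_near. Qed.

Lemma ghat_measurable n s : measurable_fun setT (fun w => ghat N Y m (Cs n) th0 w ord0 s).
Proof.
rewrite (_ : (fun w => _) = fun w => gmean (Cs n) (fun j => cellf N Y (mcoord m s th0) j w)); last first.
  by apply/funext => w; rewrite ghatE.
apply: measurable_funM; first exact: measurable_cst.
have h : L2 P (fun w => \sum_j cellf N Y (mcoord m s th0) (gcell (C := Cs n) j) w).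
  by apply: L2_sum => j _; exact: mL2.
exact: h.1.
Qed.

Lemma row_dot_measurable (X : T -> 'rV[R]_p) (t : 'rV[R]_p) b :
  (forall s, measurable_fun setT (fun w => X w ord0 s)) ->
  measurable_fun setT (fun w => cos (b + (X w *m t^T) ord0 ord0)).
Proof.
by move=> mX'; exact: (continuous_row_measurable mX' (trig_continuous (trig_cos t b))).
Qed.

Lemma hX_measurable n s : measurable_fun setT (fun w => hX n w ord0 s).
Proof.
rewrite (_ : (fun w => _) = fun w => rC n * (thetahat n w ord0 s - th0 ord0 s)); last first.
  by apply/funext => w; rewrite /hX !mxE.
by apply: measurable_funM; [exact: measurable_cst|apply: measurable_funB; [exact: mth|exact: measurable_cst]].
Qed.

Let V := sandwich Jr^T Xi (Hmat P N Y m lam th0).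
(** Scalar moment function whose normalized grid averages are the projections of [hS] on [t]; the
    one-dimensional central limit theorem is applied to it. *)
Let uf (t : 'rV[R]_p) (y : 'rV[R]_l) : R := \sum_s influence_dir Jr Xi t s ord0 * mcoord m s th0 y.

Lemma cellf_uf t j w : cellf N Y (uf t) j w =
  \sum_s influence_dir Jr Xi t s ord0 * cellf N Y (mcoord m s th0) j w.
Proof.
rewrite /cellf /uf exchange_big/=; apply: eq_bigr => s _.
by rewrite mulr_sumr.
Qed.

Lemma uf_L2 t j : L2 P (cellf N Y (uf t) j).
Proof.
apply: (@eq_L2 _ _ _ P (fun w => \sum_s influence_dir Jr Xi t s ord0 * cellf N Y (mcoord m s th0) j w)).
  by move=> w; rewrite cellf_uf.
by apply: L2_sum => s _; apply: L2Z; exact: mL2.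
Qed.

Lemma hS_dot n w (t : 'rV[R]_p) : (hS n w *m t^T) ord0 ord0 = rC n * gmean (Cs n) (fun j => cellf N Y (uf t) j w).
Proof.
rewrite /hS influence_dot.
rewrite (_ : (fun j => _) = fun j => \sum_s influence_dir Jr Xi t s ord0 * cellf N Y (mcoord m s th0) j w).
  rewrite gmean_sum mulr_sumr; apply: eq_bigr => s _.
  by rewrite gmeanZ mxE ghatE; ring.
by apply/funext => j; rewrite cellf_uf.
Qed.

Lemma uf_variance (t : 'rV[R]_p) : \sum_(i < k) lam i * Ex P (fun w => cellf N Y (uf t) (cell1 k) w * cellf N Y (uf t) (cell2 i) w) / 2 =
  (t *m V *m t^T) ord0 ord0 / 2.
Proof.
rewrite -mulr_suml; congr (_ / 2); rewrite /V (sandwich_qf _ Xi_sym).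
have step i : lam i * Ex P (fun w => cellf N Y (uf t) (cell1 k) w * cellf N Y (uf t) (cell2 i) w) =
  \sum_s \sum_s' influence_dir Jr Xi t s ord0 * influence_dir Jr Xi t s' ord0 *
    (lam i * Ex P (fun w => cellf N Y (mcoord m s th0) (cell1 k) w * cellf N Y (mcoord m s' th0) (cell2 i) w)).
  pose c s s' := influence_dir Jr Xi t s ord0 * influence_dir Jr Xi t s' ord0.
  have i1 s s' : intg P (fun w => cellf N Y (mcoord m s th0) (cell1 k) w * cellf N Y (mcoord m s' th0) (cell2 i) w).
    by apply: L2M; exact: mL2.
  rewrite (@eq_Ex _ _ _ P _ (fun w => \sum_s \sum_s' c s s' *
      (cellf N Y (mcoord m s th0) (cell1 k) w * cellf N Y (mcoord m s' th0) (cell2 i) w))); last first.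
    move=> w; rewrite !cellf_uf mulr_suml; apply: eq_bigr => s _; rewrite mulr_sumr; apply: eq_bigr => s' _.
    by rewrite /c; ring.
  rewrite Ex_sum => [|s _]; last by apply: intg_sum => s' _; apply: intgZ.
  rewrite mulr_sumr; apply: eq_bigr => s _.
  rewrite Ex_sum => [|s' _]; last by apply: intgZ.
  rewrite mulr_sumr; apply: eq_bigr => s' _.
  by rewrite ExZ// mulrCA.
rewrite (eq_bigr _ (fun i _ => step i)) exchange_big/=; apply: eq_bigr => s _.
rewrite exchange_big/=; apply: eq_bigr => s' _.
rewrite -mulr_sumr; congr (_ * _); rewrite /Hmat mxE; apply: eq_bigr => i _; congr (_ * _).
rewrite /Ex /Rintegral; congr fine; apply: eq_integral => w _.
by rewrite !cellsumE.
Qed.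

Lemma hS_charf (t : 'rV[R]_p) b : Ex P (fun w => cos (b + (hS n w *m t^T) ord0 ord0)) @[n --> \oo] -->
  cos b * expR (- ((t *m V *m t^T) ord0 ord0 / 2)).
Proof.
have u0 : Ex P (cellf N Y (uf t) (cell1 k)) = 0.
  rewrite (@eq_Ex _ _ _ P _ (fun w => \sum_s influence_dir Jr Xi t s ord0 * cellf N Y (mcoord m s th0) (cell1 k) w)); last first.
    by move=> w; rewrite cellf_uf.
  rewrite Ex_sum => [|s _]; last by apply: intgZ; apply: L2_intg; exact: mL2.
  rewrite big1// => s _; rewrite ExZ; last by apply: L2_intg; exact: mL2.
  by rewrite -/(mean s th0) mean_th0 mulr0.
have bu : borel_fun_on Ycal (uf t) by apply: borel_fun_on_lincomb => s; exact: bh.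
have := clt_limit mN mY YY exch bind k0 Cy Clam bu (uf_L2 t (cell1 k)) u0 (b := b).
rewrite uf_variance.
rewrite (_ : (fun n => Ex P _) = fun n => Ex P (fun w => cos (b + (hS n w *m t^T) ord0 ord0)))//.
apply/funext => n; apply: eq_Ex => w; rewrite hS_dot.
by [].
Qed.

Lemma hX_charf (t : 'rV[R]_p) b : Ex P (fun w => cos (b + (hX n w *m t^T) ord0 ord0)) @[n --> \oo] -->
  cos b * expR (- ((t *m V *m t^T) ord0 ord0 / 2)).
Proof.
apply/cvgrPdist_le => e e0.
have e3 : 0 < e / 10 by rewrite divr_gt0.
have [K hK] := linearization_event e3.
(* Bound on the l1 norm of [t], made positive by the 1: coordinate errors of [e / 10 / S] change the
   argument of the cosine by at most [e / 10]. *)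
pose S := \sum_s `|t ord0 s| + 1.
have S0 : 0 < S by apply: ltr_wpDl => //; apply: sumr_ge0.
have kap0 : 0 < e / 10 / S by rewrite divr_gt0.
have near_lin := hK _ kap0.
have /cvgrPdist_le /(_ _ e3) hc := hS_charf (t := t) (b := b).
near=> n.
have [B [mB PB hB]] : exists B, [/\ measurable B, (P B <= (e / 10)%:E)%E & forall w, ~ B w -> forall s,
    `|hX n w ord0 s - hS n w ord0 s| <= e / 10 / S /\ `|hS n w ord0 s| <= K] by near: n.
have mS s : measurable_fun setT (fun w => hS n w ord0 s).
  (* Expanding the matrix product in the basis exhibits the coordinate as a finite combination of
     measurable functions. *)
  rewrite (_ : (fun w => _) = fun w => \sum_s' rC n * ghat N Y m (Cs n) th0 w ord0 s' * influence Jr Xi (delta_mx ord0 s') ord0 s).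
    have h := @measurable_sum _ T R setT _ (index_enum 'I_L) (fun s' w => rC n * ghat N Y m (Cs n) th0 w ord0 s' * influence Jr Xi (delta_mx ord0 s') ord0 s).
    apply: h => s'; apply: measurable_funM; last exact: measurable_cst.
    by apply: measurable_funM; [exact: measurable_cst|exact: ghat_measurable].
  apply/funext => w; rewrite /hS {1}(row_sum_delta (rC n *: _)) /influence.
  rewrite !mulmx_suml -sumrN summxE; apply: eq_bigr => s' _.
  by rewrite -!scalemxAl -scalerN [in LHS]mxE; congr (_ * _); rewrite mxE.
have c1 : `|Ex P (fun w => cos (b + (hX n w *m t^T) ord0 ord0)) - Ex P (fun w => cos (b + (hS n w *m t^T) ord0 ord0))|
    <= e / 10 + 2 * 1 * (e / 10).
  apply: (Ex_close _ _ _ _ mB PB) => [||w|w||w Bw].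
  - by apply: row_dot_measurable; exact: hX_measurable.
  - by apply: row_dot_measurable; exact: mS.
  - exact: norm_cos_le1.
  - exact: norm_cos_le1.
  - exact: ltW.
  apply: le_trans (cos_lip _ _) _.
  rewrite opprD addrACA subrr add0r.
  rewrite (_ : _ - _ = ((hX n w - hS n w) *m t^T) ord0 ord0); last by rewrite mulmxBl !mxE.
  rewrite mxE; apply: le_trans (ler_norm_sum _ _ _) _.
  apply: (@le_trans _ _ (\sum_s e / 10 / S * `|t ord0 s|)).
    apply: ler_sum => s _; rewrite normrM [t^T _ _]mxE; apply: ler_wpM2r => //.
    by have [h _] := hB w Bw s; rewrite !mxE in h *.
  rewrite -mulr_sumr -mulrA ler_piMr ?(ltW e3)// mulrC ler_pdivrMr// mul1r.
  by rewrite /S lerDl.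
have c2 : `|cos b * expR (- ((t *m V *m t^T) ord0 ord0 / 2)) - Ex P (fun w => cos (b + (hS n w *m t^T) ord0 ord0))| <= e / 10.
  by near: n.
move: c1 c2; rewrite !ler_norml => /andP[? ?] /andP[? ?]; apply/andP; split; lra.
Unshelve. all: by end_near. Qed.

Lemma gmm_asymptotic_normality : cvg_dist_gaussian P hX V.
Proof.
move=> d' T' P' W [mW cW] f cf [M fM].
have mfX n : measurable_fun setT (fun w => f (hX n w)).
  by apply: continuous_row_measurable => // s; exact: hX_measurable.
have mfW : measurable_fun setT (fun w => f (W w)) by exact: continuous_row_measurable.
rewrite -(ExE (intg_bnd P' mfW (fun w => fM _))).
rewrite (_ : (fun n => (\int[P]_w (f (hX n w))%:E)%E) = fun n => (Ex P (fun w => f (hX n w)))%:E); last first.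
  by apply/funext => n; rewrite (ExE (intg_bnd P (mfX n) (fun w => fM _))).
apply: cvg_EFin; first by near=> n.
apply: (levy_continuity hX_measurable mW _ _ cf fM).
- move=> t b.
  have [c1 s1] := cW t.
  have mdot : measurable_fun setT (fun w => (W w *m t^T) ord0 ord0).
    rewrite (_ : (fun w => _) = fun w => \sum_s W w ord0 s * t^T s ord0).
      have h := @measurable_sum _ T' R setT _ (index_enum 'I_p) (fun s w => W w ord0 s * t^T s ord0).
      by apply: h => s; apply: measurable_funM; [exact: mW|exact: measurable_cst].
    by apply/funext => w; rewrite mxE.
  have -> : Ex P' (fun w => cos (b + (W w *m t^T) ord0 ord0)) = cos b * expR (- ((t *m V *m t^T) ord0 ord0 / 2)).
    (* The addition formula reduces the phase to the two integrals of [is_centered_gaussian], of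
       which the sine one vanishes. *)
    rewrite (@eq_Ex _ _ _ P' _ (fun w => cos b * cos ((W w *m t^T) ord0 ord0) - sin b * sin ((W w *m t^T) ord0 ord0))); last first.
      by move=> w; rewrite cosD.
    rewrite ExB; [|by apply: intgZ; exact: cos_intg|by apply: intgZ; exact: sin_intg].
    rewrite !ExZ; [|exact: sin_intg|exact: cos_intg].
    rewrite /Ex /Rintegral c1 s1 /= mulr0 subr0.
    by rewrite mulNr.
  exact: hX_charf.
- move=> e e0; have [K hK] := linearization_event e0.
  exists (K + 1); apply: filterS (hK 1 ltr01) => n [B [mB PB hB]].
  exists B; split => // w Bw s; have [h1 h2] := hB w Bw s.
  rewrite -(subrK (hS n w ord0 s) (hX n w ord0 s)); apply: le_trans (ler_normD _ _) _; lra.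
Unshelve. all: by end_near. Qed.

End Estimator.
End AsymptoticNormality.

Unset Implicit Arguments.

Theorem theorem7 (R : realType) (d : measure_display) (Omega : measurableType d)
  (P : probability Omega R)
  (k l L p : nat) (Ycal : set 'rV[R]_l)
  (N : cell k -> Omega -> nat) (Y : cell k -> nat -> Omega -> 'rV[R]_l)
  (m : 'rV[R]_l -> 'rV[R]_p -> 'rV[R]_L)
  (Theta : set 'rV[R]_p) (theta0 : 'rV[R]_p)
  (Xi : 'M[R]_L) (Xihat : nat -> Omega -> 'M[R]_L)
  (Cs : nat -> cell k) (lam : 'I_k -> R) :
  (0 < k)%N -> (0 < l)%N -> (0 < L)%N -> (0 < p)%N ->
  (* the data array consists of random variables with values in Ycal *)
  (forall j n, measurable [set w | N j w = n]) ->
  (forall j ell s, measurable_fun setT (fun w => Y j ell w ord0 s)) ->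
  (forall j ell w, Ycal (Y j ell w)) ->
  (* (A1) (i)-(iii) *)
  sep_exchangeable P N Y ->
  block_independent P N Y ->
  (0 < \int[P]_w ((N (cell1 k) w)%:R)%:E)%E ->
  (* (A1) (iv): the sequence of observed designs C = Cs n, min C -> oo,
     min C / C_i -> lam_i *)
  (forall M : nat, \forall n \near \oo, (M <= Cmin (Cs n))%N) ->
  (forall i, ((Cmin (Cs n))%:R / (Cs n i)%:R : R) @[n --> \oo] --> lam i) ->
  (* (G') (1) *)
  compact Theta -> (interior Theta) theta0 ->
  (* (G') (2) *)
  (forall th, Theta th ->
     ((forall s : 'I_L,
        (\int[P]_w (cellsum N Y m (cell1 k) th w ord0 s)%:E = 0)%E) <-> th = theta0)) ->
  (* (G') (3) *)
  (forall th, Theta th ->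
     ((\int[P]_w (sqnorm (cellsum N Y m (cell1 k) th' w
                          - cellsum N Y m (cell1 k) th w)%R)%:E)
        @[th' --> within Theta (nbhs th)] --> 0)%E) ->
  (* (G') (4) *)
  differentiable (Gam P N Y m) theta0 ->
  \rank ('J (Gam P N Y m) theta0)^T = p ->
  (* (G') (5) *)
  (forall n w, (Xihat n w)^T = Xihat n w) ->
  (forall n i j, measurable_fun setT (fun w => Xihat n w i j)) ->
  (forall i j (e : R), 0 < e ->
     (P [set w | (e <= `|Xihat n w i j - Xi i j|)%R] @[n --> \oo] --> 0)%E) ->
  (forall v : 'rV[R]_L, v != 0 -> 0 < (v *m Xi *m v^T) ord0 ord0) ->
  (* (G') (6) *)
  (forall s : 'I_L, forall th, Theta th -> borel_fun_on Ycal (fun y => m y th ord0 s)) ->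
  (forall s : 'I_L,
     let FF := [set f | exists2 th, Theta th & f = (fun y => m y th ord0 s)] in
     pointwise_measurable Ycal FF /\ cond_A3' P N Y Ycal FF) ->
  (* conclusion *)
  (exists A : nat -> set Omega, (forall n, measurable (A n)) /\
     (P (A n) @[n --> \oo] --> 1)%E /\
     forall n w, A n w ->
       exists th, is_minimizer Theta (fun th => gmm_obj N Y m (Cs n) (Xihat n w) th w) th)
  /\
  (forall thetahat : nat -> Omega -> 'rV[R]_p,
     (forall n s, measurable_fun setT (fun w => thetahat n w ord0 s)) ->
     (exists B : nat -> set Omega, (forall n, measurable (B n)) /\
        (P (B n) @[n --> \oo] --> 1)%E /\
        forall n w, B n w ->
          is_minimizer Theta (fun th => gmm_obj N Y m (Cs n) (Xihat n w) th w)
                       (thetahat n w)) ->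
     cvg_dist_gaussian P
       (fun n w => Num.sqrt ((Cmin (Cs n))%:R) *: (thetahat n w - theta0))
       (sandwich ('J (Gam P N Y m) theta0)^T Xi (Hmat P N Y m lam theta0))).
Proof.
move=> k0 _ _ _ mN mY YY exch bind _ Cy Clam cT iT Gz G3 dG rJ sX mX cX pdXi bh pmA3.
have A3 s := (pmA3 s).2.
split.
  have [N0 [mN0 PN0 hN0]] := gmm_minimizer_as Xihat Cs k0 mN mY YY exch bind cT iT G3 bh A3.
  (* Minimizers exist almost surely for all [n] at once, so one event serves every [n]. *)
  exists (fun=> ~` N0); split; first by move=> n; exact: measurableC.
  split; last by move=> n w Nw; exact: hN0.
  rewrite (_ : (fun n : nat => P (~` N0)) = fun=> 1%E); first exact: cvg_cst.
  by apply/funext => _; rewrite probability_setC// PN0 sube0.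
move=> thetahat mth [B [mB [PB hB]]].
exact (gmm_asymptotic_normality k0 mN mY YY exch bind Cy Clam cT iT Gz G3 dG rJ sX mX cX pdXi bh A3 mth mB PB hB).
Qed.
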